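(* Let $T$ be a complete first-order theory which is NATP. Then for each model $M$ and each tuple of parameters $b$, there exists a global coheir $p(x)$ over $M$ containing $\mathrm{tp}(b/M)$ such that, for every small set $B$ and every $b'\models p(x)|_{MB}$, the type $\mathrm{tp}(B/Mb')$ does not Kim-fork over $M$.
   Context: $T$ is a complete first-order $\mathcal{L}$-theory with monster model $\mathbb{M}$; tuples and small sets live in $\mathbb{M}$ and models $M$ are small elementary submodels of $\mathbb{M}$. A global type is a complete type over $\mathbb{M}$. Formulas $\varphi(x,y)$ may use parameters from the base. ATP/NATP: An $\mathcal{L}$-formula $\varphi(x,y)$ has the antichain tree property (ATP) if there is $(a_\eta)_{\eta\in 2^{<\omega}}$ such that $\{\varphi(x,a_\eta)\}_{\eta\in X}$ is consistent for every antichain $X\subseteq 2^{<\omega}$ (a set of pairwise $\subseteq$-incomparable strings), and $\{\varphi(x,a_\eta),\varphi(x,a_\nu)\}$ is inconsistent whenever $\eta\subsetneq\nu$. $T$ is NATP if no formula has ATP. A global type $p(x)$ is a coheir over $M$ if it is finitely satisfiable in $M$; it is invariant over $M$ if $\varphi(x,b)\in p\Leftrightarrow\varphi(x,b')\in p$ whenever $b\equiv_M b'$. An invariant Morley sequence in $\mathrm{tp}(a/M)$ is a sequence $(a_i)_{i<\omega}$ for which there is a global $M$-invariant type $p\supseteq\mathrm{tp}(a/M)$ with $a_i\models p|_{Ma_{<i}}$ for all $i$. $\varphi(x,a)$ Kim-divides over $M$ if there is an invariant Morley sequence $(a_i)_{i<\omega}$ in $\mathrm{tp}(a/M)$ such that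 $\{\varphi(x,a_i)\}_{i<\omega}$ is inconsistent. A type Kim-forks over $M$ if it implies a finite disjunction $\bigvee_{i\le n}\psi_i(x)$ of formulas with parameters, each of which Kim-divides over $M$. *)

(* Defs.v *)
From mathcomp Require Import all_boot all_classical.

Set Implicit Arguments.
Unset Strict Implicit.
Unset Printing Implicit Defensive.

Local Open Scope classical_set_scope.
Local Open Scope card_scope.

(* The free variables of a formula are named by an arbitrary type [V]: [form L V]
   is the set of formulas in the (possibly infinite) tuple of variables
   [(x_v)_(v : V)]; a tuple is a function [V -> U].  A quantifier binds the new
   variable [None : option V]. *)

Record language := Language {
  fsym : Type; farity : fsym -> nat;
  rsym : Type; rarity : rsym -> nat }.

Inductive term (L : language) (V : Type) : Type :=
| Var (v : V)
| App (f : fsym L) (args : 'I_(farity f) -> term L V).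

Inductive form (L : language) (V : Type) : Type :=
| Bot
| Eq (t u : term L V)
| Rel (r : rsym L) (args : 'I_(rarity r) -> term L V)
| Imp (phi psi : form L V)
| All (phi : form L (option V)).

Arguments Bot {L V}.

Definition Not L V (phi : form L V) : form L V := Imp phi Bot.

Fixpoint term_map L V W (g : V -> W) (t : term L V) : term L W :=
  match t with
  | Var v => Var L (g v)
  | App f args => App (fun i => term_map g (args i))
  end.

Fixpoint form_map L V W (g : V -> W) (phi : form L V) : form L W :=
  match phi with
  | Bot => Bot
  | Eq t u => Eq (term_map g t) (term_map g u)
  | Rel r args => Rel (fun i => term_map g (args i))
  | Imp phi psi => Imp (form_map g phi) (form_map g psi)
  | All phi => All (form_map (omap g) phi)
  end.

Record structure (L : language) (U : Type) := Structure {
  fint : forall f : fsym L, ('I_(farity f) -> U) -> U;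
  rint : forall r : rsym L, ('I_(rarity r) -> U) -> Prop }.

Fixpoint eval L U (S : structure L U) V (v : V -> U) (t : term L V) : U :=
  match t with
  | Var x => v x
  | App f args => fint S (fun i => eval S v (args i))
  end.

Fixpoint sat L U (S : structure L U) V (v : V -> U) (phi : form L V) : Prop :=
  match phi with
  | Bot => False
  | Eq t u => eval S v t = eval S v u
  | Rel r args => rint S (fun i => eval S v (args i))
  | Imp phi psi => sat S v phi -> sat S v psi
  | All phi => forall d : U, sat S (fun o => if o is Some x then v x else d) phi
  end.

Definition sentence L := form L void.

(* Models are non-empty. *)
Definition models L U (S : structure L U) (T : set (sentence L)) : Prop :=
  inhabited U /\ forall s, T s -> sat S (fun x : void => match x with end) s.

Definition entails L (T : set (sentence L)) (s : sentence L) : Prop :=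
  forall (U : Type) (S : structure L U),
    models S T -> sat S (fun x : void => match x with end) s.

Definition complete_theory L (T : set (sentence L)) : Prop :=
  (exists (U : Type) (S : structure L U), models S T) /\
  (forall s, entails T s \/ entails T (Not s)).

Definition elementary_embedding L U (S : structure L U) U' (S' : structure L U')
    (h : U -> U') : Prop :=
  forall n (phi : form L 'I_n) (v : 'I_n -> U),
    sat S v phi <-> sat S' (h \o v) phi.

(* [M] is the carrier of a structure whose inclusion into [U] is elementary; this
   inclusion determines the structure, and forces [M] to be non-empty if [U] is. *)
Definition elementary_submodel L U (S : structure L U) (M : set U) : Prop :=
  exists N : structure L M, elementary_embedding N S (fun m : M => val m).

Definition automorphism L U (S : structure L U) (s : U -> U) : Prop :=
  [/\ bijective s,
      forall f args, s (fint S (f := f) args) = fint S (fun i => s (args i))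
    & forall r args, rint S (r := r) args <-> rint S (fun i => s (args i))].

Section Types.
Variables (L : language) (U : Type) (S : structure L U).

(* [inr u] is a name for the parameter [u]. *)
Definition pform (V : Type) := form L (V + U).

Definition holds V (v : V -> U) (phi : pform V) : Prop :=
  sat S (fun z => match z with inl x => v x | inr u => u end) phi.

Definition realizes V (v : V -> U) (Gamma : set (pform V)) : Prop :=
  forall phi, Gamma phi -> holds v phi.

(* phi(x, a) *)
Definition inst V J (phi : form L (V + J)) (a : J -> U) : pform V :=
  form_map (fun z => match z with inl x => inl x | inr j => inr (a j) end) phi.

Definition over V (A : set U) (phi : pform V) : Prop :=
  exists psi : form L (V + A), phi = inst psi (fun u : A => val u).

Definition tp V (v : V -> U) (A : set U) : set (pform V) :=
  [set phi | over A phi /\ holds v phi].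

(* With [A = setT] this is, by compactness, consistency with the elementary
   diagram of [U]. *)
Definition fin_sat_in V (A : set U) (Gamma : set (pform V)) : Prop :=
  forall Gamma0, finite_set Gamma0 -> Gamma0 `<=` Gamma ->
    exists v : V -> U, range v `<=` A /\ realizes v Gamma0.

Definition consistent V (Gamma : set (pform V)) : Prop := fin_sat_in setT Gamma.

Definition global_type V (p : set (pform V)) : Prop :=
  consistent p /\ forall phi, p phi \/ p (Not phi).

Definition restr V (p : set (pform V)) (A : set U) : set (pform V) :=
  [set phi | p phi /\ over A phi].

Definition global_coheir V (M : set U) (p : set (pform V)) : Prop :=
  global_type p /\ fin_sat_in M p.

Definition global_invariant V (M : set U) (p : set (pform V)) : Prop :=
  global_type p /\
  forall n (phi : form L (V + 'I_n)) (b b' : 'I_n -> U),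
    tp b M = tp b' M -> (p (inst phi b) <-> p (inst phi b')).

Definition inv_morley_seq V (M : set U) (a : V -> U) (s : nat -> V -> U) : Prop :=
  exists p : set (pform V),
    [/\ global_invariant M p, tp a M `<=` p
      & forall i, realizes (s i)
          (restr p (M `|` \bigcup_(j in [set j | (j < i)%N]) range (s j)))].

(* phi(x, y) is a formula with parameters from M: its variables are x, y and
   names for the elements of M. *)
Definition kim_divides V (M : set U) (chi : pform V) : Prop :=
  exists n (phi : form L (V + ('I_n + M))) (a : 'I_n -> U),
    let at_ (c : 'I_n -> U) : pform V :=
      inst phi (fun z => match z with inl j => c j | inr m => val m end) in
    chi = at_ a /\
    exists s : nat -> 'I_n -> U,
      inv_morley_seq M a s /\ ~ consistent (range (fun i => at_ (s i))).

(* The implication is read in the monster model: every realization of [pi]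
   satisfies the disjunction. *)
Definition kim_forks V (M : set U) (pi : set (pform V)) : Prop :=
  exists n (psi : 'I_n.+1 -> pform V),
    (forall i, kim_divides M (psi i)) /\
    (forall v : V -> U, realizes v pi -> exists i, holds v (psi i)).

Definition antichain (X : set (seq bool)) : Prop :=
  forall eta nu, X eta -> X nu -> eta != nu -> ~~ prefix eta nu.

Definition has_ATP n m (phi : form L ('I_n + 'I_m)) : Prop :=
  exists a : seq bool -> 'I_m -> U,
    (forall X, antichain X -> consistent [set inst phi (a eta) | eta in X]) /\
    (forall eta nu, prefix eta nu -> eta != nu ->
       ~ consistent [set inst phi (a eta); inst phi (a nu)]).

Definition NATP : Prop := forall n m (phi : form L ('I_n + 'I_m)), ~ has_ATP phi.

End Types.

(* [small K A] is |A| < kappa, where kappa is the cardinality of [K]. *)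
Definition small (K : Type) T (A : set T) : Prop :=
  (A #<= [set: K]) /\ ~ ([set: K] #<= A).

(* Monster model of T: kappa-saturated and strongly kappa-homogeneous for some
   kappa > |L| + aleph_0. *)
Record monster L (K U : Type) (T : set (sentence L)) (S : structure L U) : Prop :=
  Monster {
    monster_models : models S T;
    monster_nat : small K [set: nat];
    monster_fsym : small K [set: fsym L];
    monster_rsym : small K [set: rsym L];
    monster_saturated :
      forall (A : set U) (V : Type) (Gamma : set (pform L U V)),
        small K A -> small K [set: V] -> (forall phi, Gamma phi -> over A phi) ->
        consistent S Gamma -> exists v : V -> U, realizes S v Gamma;
    monster_homogeneous :
      forall (V : Type) (a a' : V -> U),
        small K [set: V] -> tp S a set0 = tp S a' set0 ->
        exists s : U -> U, automorphism S s /\ s \o a = a' }.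

(* Main.v *)
Require Import Defs.
From mathcomp Require Import all_boot all_classical.

Set Implicit Arguments.
Unset Strict Implicit.
Unset Printing Implicit Defensive.

Local Open Scope classical_set_scope.
Local Open Scope card_scope.

(** A global coheir of [tp(b/M)] is the type read off an ultrafilter on the
set [I -> M] of tuples of [M].  Ultrafilters on tuples, or on finite sets of
tuples, of [M] stand for coheirs throughout; a definable condition that holds
of some tuple of the monster model holds of a tuple of [M] ([tarski]), so most
of the argument is about finite sets of points of [M].

The proof has three parts.

(1) In an NATP theory, Kim-dividing is witnessed by a coheir
([kim_divides_coheir]): if [phi(x, a)] divides along a Morley sequence of an
[M]-invariant type, then it divides along some coheir of [tp(a/M)].  Suppose
not.  Call a condition on finite sequences from [M] generic if it follows from
a formula that is true of an initial segment of the Morley sequence.  Consider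
ultrafilters on blocks of [c] points, and ask whether the [phi]-instances
given by the blocks divide along such an ultrafilter.  For [c = 1] some
ultrafilter compatible with the generic conditions does not divide, by the
assumption; for large [c] a block already contains an inconsistent part of the
Morley sequence, so every one divides.  Between two consecutive powers of two,
[b] and [2b], the answer changes: there is a non-dividing ultrafilter [rho] on
blocks of size [b] of which two copies, one above the other, form a dividing
pair.  Stacking many copies of [rho] as the levels of a tree gives, after
replacing each node by the union of finitely many nodes, trees in which
antichains are consistent and comparable nodes inconsistent
([antichain_trees]); by compactness this is the antichain tree property
([trees_ATP]).  To make the answer for [c] well defined, the ultrafilters are
not taken on their own but relative to a system of levels already constructed;
Zorn's lemma repeats a level as often as needed ([repeat_label]).

(2) The broom lemma of Chernikov and Kaplan ([broom]).  Let
[phi_i(x, a_i)], for [i < k], divide along coheirs of [tp(a_i/M)], and let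
[alpha(x, b)] imply [psi(x) \/ \/_i phi_i(x, a_i)], with [psi] over [M].
Then finitely many tuples [e_j] of [M], which can be chosen to satisfy any
given formula of [tp(b/M)], are such that the conjunction of the
[alpha(x, e_j)] implies [psi(x)].

(3) Say that [D(z, y)] is guarded at [b] if [D(z, b)] implies a finite
disjunction of formulas that divide along coheirs.  Such [D] are closed under
disjunction, and by (2) with [psi] false the sets of tuples [m] of [M] with
[theta(m)] and [~ D(c, m)], for [theta] in [tp(b/M)], [D] guarded and [c] in
the monster model, have the finite intersection property: if all [m]
satisfying [theta] satisfied [D(c, m)], then [c] would realize an inconsistent
conjunction of formulas [D(z, e_j)].  An ultrafilter that contains these sets
defines [p] ([coheir_ultra]).  If [b'] realizes [p] over [M] and [B], and
[tp(B/Mb')] implies a disjunction of Kim-dividing formulas, then (1) and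
compactness give a guarded [D] with [D(B, b')] true ([guarded_of_kim_forks]),
while [~ D(B, y)] belongs to [p]. *)

(** * Ultrafilters *)

Record ultra (T : Type) (F : set (set T)) : Prop := Ultra {
  ultraT : F setT;
  ultraI : forall A B, F A -> F B -> F (A `&` B);
  ultraS : forall A B, A `<=` B -> F A -> F B;
  ultra0 : ~ F set0;
  ultraC : forall A, F A \/ F (~` A) }.

Definition push (T U : Type) (f : T -> U) (F : set (set T)) : set (set U) :=
  [set A | F (f @^-1` A)].

Definition at_point (T : Type) (x : T) : set (set T) := [set A | A x].

Lemma ultra_push (T U : Type) (f : T -> U) F : ultra F -> ultra (push f F).
Proof.
case=> hT hI hS h0 hC; split; rewrite /push /=.
- exact: hT.
- by move=> A B; apply: hI.
- by move=> A B AB; apply: hS => x; apply: AB.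
- exact: h0.
- by move=> A; apply: hC.
Qed.

Lemma ultra_at_point (T : Type) (x : T) : ultra (at_point x).
Proof. split; rewrite /at_point //=; [by move=> A B AB; apply: AB|by move=> A; exact: lem]. Qed.

Lemma ultra_extend (T : Type) (B : set (set T)) :
  (exists A, B A) ->
  (forall A A', B A -> B A' -> exists2 A'', B A'' & A'' `<=` A `&` A') ->
  (forall A, B A -> A !=set0) ->
  exists2 F, ultra F & B `<=` F.
Proof.
move=> [A0 BA0] BI B0.
pose F0 : set (set T) := [set X | exists2 A, B A & A `<=` X].
have F0P : ProperFilter F0.
  split; first by move=> [A /B0[x Ax]] /(_ _ Ax).
  split; first by exists A0.
    move=> X Y [A BA AX] [A' BA' A'Y]; have [A'' BA'' sub] := BI _ _ BA BA'.
    by exists A'' => // x /sub[/AX ? /A'Y].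
  by move=> X Y XY [A BA AX]; exists A => //; apply: subset_trans XY.
have [G [GU F0G]] := ultraFilterLemma F0P.
have GP := @ultra_proper _ _ GU.
exists G; last by move=> A BA; apply: F0G; exists A.
split.
- exact: filterT.
- by move=> A A'; exact: filterI.
- by move=> A A'; exact: filterS.
- exact: filter_not_empty.
- by move=> A; exact: in_ultra_setVsetC.
Qed.

Section UltraTheory.
Variables (T : Type) (F : set (set T)).
Hypothesis FU : ultra F.

Lemma ultra_nonempty A : F A -> A !=set0.
Proof.
move=> FA; apply: contrapT => /set0P/negP; rewrite negbK => /eqP A0.
by apply: (ultra0 FU); rewrite -A0.
Qed.

Lemma ultra_setC A : F (~` A) <-> ~ F A.
Proof.
split; last by case: (ultraC FU A).
by move=> FC FA; apply: (ultra0 FU); rewrite -(setICr A); exact: ultraI.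
Qed.

Lemma ultra_all (S : eqType) (s : seq S) (A : S -> set T) :
  (forall i, i \in s -> F (A i)) -> F [set x | forall i, i \in s -> A i x].
Proof.
elim: s => [|i s IH] h; first by apply: ultraS (ultraT FU).
have hi := h i (mem_head _ _).
have hs : F [set x | forall j, j \in s -> A j x].
  by apply: IH => j js; apply: h; rewrite in_cons js orbT.
apply: ultraS (ultraI FU hi hs) => // x [xi xs] j.
by rewrite in_cons => /orP[/eqP->//|/xs].
Qed.

End UltraTheory.

Lemma ultra_incl (T : Type) (F G : set (set T)) :
  ultra F -> ultra G -> F `<=` G -> F = G.
Proof.
move=> FU GU FG; apply/seteqP; split=> // A GA; apply: contrapT => nFA.
by have /FG /(ultra_setC GU) := (ultra_setC FU A).2 nFA; apply.
Qed.

(** * Forests *)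

Fixpoint subs (T : Type) (s : seq T) : seq (seq T) :=
  if s is x :: s' then [seq x :: t | t <- subs s'] ++ subs s' else [:: [::]].

Lemma mem_subs (T : eqType) (s t : seq T) : (t \in subs s) = subseq t s.
Proof.
elim: s t => [|x s IH] t; first by rewrite inE subseq0.
rewrite /= mem_cat IH; case: t => [|y t]; first by rewrite sub0seq orbT.
case: (eqVneq y x) => [->|yx].
  have -> : (x :: t \in [seq x :: u | u <- subs s]) = subseq t s.
    rewrite -IH; apply/mapP/idP => [[u us [->]]//|ts]; by exists t.
  by case: (boolP (subseq t s)) => //= nts; apply/negP => /cons_subseq; apply/negP.
case: (boolP (subseq (y :: t) s)) => _; rewrite ?orbT // orbF.
by apply/negP => /mapP[u _ [yx']]; rewrite yx' eqxx in yx.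
Qed.

Lemma subs_map (T T' : Type) (f : T -> T') (s : seq T) :
  subs [seq f x | x <- s] = [seq [seq f x | x <- t] | t <- subs s].
Proof. by elim: s => [//|x s IH] /=; rewrite map_cat IH -!map_comp. Qed.

Section Forest.
Variables (Omega N : eqType).

(** The type [N] names levels of trees, and a node carries a block: a finite
sequence of points.  A chain lists some nodes along a branch from the root
down, each with the name of its level. *)
Definition chain := seq (N * seq Omega).

Definition vals (c : chain) : seq Omega := flatten (unzip2 c).
Definition names (c : chain) : seq N := unzip1 c.

(** A forest with [n] levels, as the list of its trees, each one a root block
with the forest below it.  The names of the levels are kept apart, in a list
[G] that starts with the level of the roots. *)
Fixpoint forest (n : nat) : Type :=
  if n is n'.+1 then seq (seq Omega * forest n') else unit.

Fixpoint wide (w n : nat) : forest n -> bool :=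
  match n with
  | 0 => fun _ => true
  | n'.+1 => fun F => (size F == w) && all (fun T => wide w T.2) F
  end.

Fixpoint paths (G : seq N) : forest (size G) -> seq chain :=
  match G with
  | [::] => fun _ => [:: [::]]
  | a :: G' => fun F =>
      flatten [seq [seq (a, T.1) :: p | p <- paths T.2] | T <- F]
  end.

(** The families of a forest are the finite sets of chains whose top nodes form
an antichain: in each tree, either a single chain through the root or a family
of the forest below the root.  They are the common generalization of the two
configurations needed at the end, antichains of nodes and sets of pairs of
comparable nodes. *)
Definition tree_fams (a : N) (G : seq N) (fm : forest (size G) -> seq (seq chain))
    (T : seq Omega * forest (size G)) : seq (seq chain) :=
  [seq [:: (a, T.1) :: d] | d <- flatten [seq subs p | p <- paths T.2]] ++ fm T.2.

Fixpoint fams (G : seq N) : forest (size G) -> seq (seq chain) :=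
  match G with
  | [::] => fun _ => [:: [::]]
  | a :: G' => fun F =>
      foldr (fun T Ys => [seq Y ++ Z | Y <- tree_fams a (@fams G') T, Z <- Ys])
            [:: [::]] F
  end.

Definition tfams a G := tree_fams a (@fams G).

Arguments fams : simpl never.
Arguments paths : simpl never.

Lemma fams_cons a (G : seq N) T (F : forest (size (a :: G))) :
  @fams (a :: G) (T :: F) = [seq Y ++ Z | Y <- tfams a T, Z <- @fams (a :: G) F].
Proof. by []. Qed.

Lemma paths_cons a (G : seq N) T (F : forest (size (a :: G))) :
  @paths (a :: G) (T :: F) = [seq (a, T.1) :: p | p <- paths T.2] ++ @paths (a :: G) F.
Proof. by []. Qed.

Lemma tfamsP a (G : seq N) T Y :
  reflect ((exists2 p, p \in @paths G T.2 & exists2 d, subseq d p & Y = [:: (a, T.1) :: d])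
           \/ Y \in fams T.2) (Y \in tfams a T).
Proof.
rewrite /tfams /tree_fams mem_cat; apply: (iffP orP) => -[].
- move=> /mapP[d /flatten_mapP[p pT]]; rewrite mem_subs => dp ->; left.
  by exists p => //; exists d.
- by right.
- case=> p pT [d dp ->]; left; apply/mapP; exists d => //.
  by apply/flatten_mapP; exists p; rewrite ?mem_subs.
- by right.
Qed.

Lemma nil_fams (G : seq N) F : [::] \in @fams G F.
Proof.
elim: G F => [|a G IH] F; first by rewrite inE.
elim: F => [|T F IHF]; first by rewrite inE.
rewrite fams_cons; apply/allpairsP; exists ([::], [::]); split=> //=.
by apply/tfamsP; right.
Qed.

Lemma nil_tfams a (G : seq N) T : [::] \in @tfams a G T.
Proof. by apply/tfamsP; right; exact: nil_fams. Qed.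

Lemma names_paths (G : seq N) F p : p \in @paths G F -> names p = G.
Proof.
elim: G F p => [|a G IH] F p; first by rewrite inE => /eqP->.
elim: F => [//|T F IHF]; rewrite paths_cons mem_cat => /orP[|/IHF//].
by case/mapP=> q qT ->; rewrite /= -(IH _ _ qT).
Qed.

Lemma size_paths (G : seq N) w F : wide w F -> size (@paths G F) = w ^ size G.
Proof.
elim: G F => [//|a G IH] F /= /andP[/eqP sF]; rewrite expnS -{2}sF {sF}.
elim: F => [//|T F IHF] /= /andP[wT wF].
by rewrite size_cat size_map IH // IHF // mulSn.
Qed.

Lemma paths_nonempty (G : seq N) w F : wide w.+1 F -> exists p, p \in @paths G F.
Proof.
move=> wF; have := size_paths wF; case: (paths F) => [|p s _]; last first.
  by exists p; exact: mem_head.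
by move/esym/eqP; rewrite expn_eq0.
Qed.

Lemma path_fams (G : seq N) F p d :
  p \in @paths G F -> subseq d p -> d != [::] -> [:: d] \in fams F.
Proof.
elim: G F p d => [|a G IH] F p d; first by rewrite inE => /eqP-> /eqP->.
elim: F => [//|T F IHF]; rewrite paths_cons mem_cat fams_cons => /orP[|pF dp d0]; last first.
  by apply/allpairsP; exists ([::], [:: d]); split; [exact: nil_tfams|exact: IHF|].
case/mapP=> q qT -> dq d0; apply/allpairsP; exists ([:: d], [::]).
split=> //=; last exact: nil_fams.
apply/tfamsP; case: d dq d0 {IHF} => [//|x d] /=.
case: (eqVneq x (a, T.1)) => [-> dq _|_ dq _].
  by left; exists q => //; exists d.
by right; apply: IH dq _.
Qed.

Lemma names_fams (G : seq N) F Y c : Y \in @fams G F -> c \in Y -> subseq (names c) G.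
Proof.
elim: G F Y c => [|a G IH] F Y c; first by rewrite inE => /eqP->.
elim: F Y => [|T F IHF] Y; first by rewrite inE => /eqP->.
rewrite fams_cons => /allpairsP[[Y1 Y2] /= [/tfamsP Y1T Y2F ->]].
rewrite mem_cat => /orP[|/(IHF _ Y2F)//].
case: Y1T => [[p pT [d dp ->]]|/IH h /h sG].
  rewrite inE => /eqP->; rewrite /= eqxx -(names_paths pT).
  exact: map_subseq.
exact: subseq_trans sG (subseq_cons _ _).
Qed.

(** ** Restriction to a subset of the levels *)

Definition rst (G : seq N) (c : chain) : chain := [seq x <- c | x.1 \in G].

Lemma rst_subseq G c : subseq (rst G c) c.
Proof. by rewrite /rst; exact: filter_subseq. Qed.

Lemma wide_behead w a (G : seq N) (F : forest (size (a :: G))) :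
  wide w.+1 F -> exists T F', F = T :: F' /\ wide w.+1 T.2.
Proof. by case: F => [//|T F] /= /andP[_ /andP[wT _]]; exists T, F. Qed.

Lemma first_tree w a (G : seq N) (F : forest (size (a :: G))) : wide w.+1 F ->
  exists T : seq Omega * forest (size G), [/\ wide w.+1 T.2,
    forall Y, Y \in tfams a T -> Y \in fams F
  & forall p, p \in paths T.2 -> (a, T.1) :: p \in paths F].
Proof.
case/wide_behead=> T [F' [-> wT]]; exists T; split=> //.
- move=> Y YT; rewrite fams_cons; apply/allpairsP; exists (Y, [::]).
  by split; rewrite ?cats0 //; exact: nil_fams.
- by move=> p pT; rewrite paths_cons mem_cat map_f.
Qed.

(** Levels are forgotten by keeping a single subtree at each node of a
forgotten level, so that the width is not affected. *)
Lemma forest_project (G G' : seq N) w (F : forest (size G)) :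
  uniq G -> subseq G' G -> wide w.+1 F ->
  exists F' : forest (size G'),
    [/\ wide w.+1 F', {subset fams F' <= fams F}
      & forall p', p' \in paths F' -> exists2 p, p \in paths F & p' = rst G' p].
Proof.
elim: G G' F => [|a G IH] G' F.
  move=> _; rewrite subseq0 => /eqP -> _; exists tt; split=> //.
  by move=> p' p'0; exists p' => //; move: p'0; rewrite inE => /eqP->.
move=> /= /andP[aG uG] sG wF.
have [aG'|aG'] := boolP (a \in G'); last first.
  have sG' : subseq G' G.
    case: G' sG aG' => [|b G'] /=; first by rewrite sub0seq.
    by rewrite in_cons negb_or eq_sym => + /andP[/negPf ba _]; rewrite ba.
  have [T [F0 [FE wT]]] := wide_behead wF; rewrite {}FE in wF *.
  have [F' [wF' fF' pF']] := IH G' T.2 uG sG' wT.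
  exists F'; split=> //.
    move=> Y /fF' YT; rewrite fams_cons; apply/allpairsP; exists (Y, [::]).
    by split; [apply/tfamsP; right|exact: nil_fams|rewrite cats0].
  move=> p' /pF'[p pT ->]; exists ((a, T.1) :: p); last by rewrite /rst /= (negPf aG').
  by rewrite paths_cons mem_cat map_f.
have {sG} [G0 G'E sG0] : exists2 G0, G' = a :: G0 & subseq G0 G.
  case: G' sG aG' => [//|b G'] /=; case: (eqVneq b a) => [-> ? _|_ sG].
    by exists G'.
  by move=> aG'; rewrite (mem_subseq sG aG') in aG.
rewrite {}G'E {G' aG'}.
move: wF => /andP[/eqP sF wF].
suff [F' [sF' wF' fF' pF']] : exists F' : forest (size (a :: G0)),
    [/\ size F' = size F, all (fun T => wide w.+1 T.2) F',
        {subset fams F' <= @fams (a :: G) F}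
      & forall p', p' \in paths F' ->
          exists2 p, p \in @paths (a :: G) F & p' = rst (a :: G0) p].
  by exists F'; split=> //=; rewrite sF' sF eqxx.
elim: F {sF} wF => [|T F IHF] /=.
  by move=> _; exists ([::] : forest (size (a :: G0))); split=> // Y.
move=> /andP[wT /IHF[F' [sF' wF' fF' pF']]].
have [T' [wT' fT' pT']] := IH G0 T.2 uG sG0 wT.
exists ((T.1, T') :: F'); split; [by rewrite /= sF'|by rewrite /= wT'| |].
  move=> Y; rewrite !fams_cons => /allpairsP[[Y1 Y2] /= [/tfamsP Y1T /fF' Y2F ->]].
  apply/allpairsP; exists (Y1, Y2); split=> //=; apply/tfamsP.
  case: Y1T => [[p /pT'[q qT ->] [d dq ->]]|/fT' ?]; [left|by right].
  by exists q => //; exists d => //; apply: subseq_trans dq (rst_subseq _ _).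
move=> p'; rewrite !paths_cons mem_cat => /orP[|/pF'[p pF ->]]; last first.
  by exists p => //; rewrite mem_cat pF orbT.
case/mapP=> q' /pT'[q qT ->] ->; exists ((a, T.1) :: q).
  by rewrite mem_cat map_f.
rewrite /rst /= mem_head; congr (_ :: _); apply: eq_in_filter => x xq.
rewrite in_cons; case: eqP => //= xa; have : x.1 \in names q by exact: map_f.
by rewrite (names_paths qT) xa (negPf aG).
Qed.

(** ** Colouring the paths of a forest *)

Lemma forest_take (G : seq N) a (F : forest (size (a :: G))) k :
  {subset @fams (a :: G) (take k F) <= @fams (a :: G) F} /\
  {subset @paths (a :: G) (take k F) <= @paths (a :: G) F}.
Proof.
elim: F k => [|T F IHF] [|k] /=; split=> // Y.
- by rewrite inE => /eqP->; exact: nil_fams.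
- have [fF _] := IHF k; rewrite !fams_cons => /allpairsP[[Y1 Y2] /= [Y1T /fF Y2F ->]].
  by apply/allpairsP; exists (Y1, Y2).
- have [_ pF] := IHF k; rewrite !paths_cons !mem_cat => /orP[->//|/pF ->].
  by rewrite orbT.
Qed.

(** A two-colouring of the branches leaves one colour on a subforest of at least
half the width: by induction every tree of the forest has a subtree of one
colour, and one of the two colours is taken by enough trees. *)
Lemma forest_colour (G : seq N) w1 w2 (F : forest (size G)) (P1 P2 : chain -> Prop) :
  wide (w1 + w2) F -> (forall p, p \in paths F -> P1 p \/ P2 p) ->
  (exists F' : forest (size G), [/\ wide w1 F', {subset fams F' <= fams F}
      & forall p, p \in @paths G F' -> p \in paths F /\ P1 p]) \/
  (exists F' : forest (size G), [/\ wide w2 F', {subset fams F' <= fams F}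
      & forall p, p \in @paths G F' -> p \in paths F /\ P2 p]).
Proof.
elim: G F P1 P2 => [|a G IH] F P1 P2.
  move=> _ /(_ _ (mem_head _ _))[] P; [left|right]; exists F; split=> // p pF;
    by split=> //; move: pF; rewrite inE => /eqP->.
move=> /= /andP[/eqP sF wF] cF.
suff [F1 [F2 [sF12 [wF1 fF1 pF1] [wF2 fF2 pF2]]]] :
    exists F1 F2 : forest (size (a :: G)),
    [/\ size F1 + size F2 = size F,
     [/\ all (fun T => wide w1 T.2) F1, {subset @fams (a :: G) F1 <= @fams (a :: G) F}
       & forall p, p \in @paths (a :: G) F1 -> p \in @paths (a :: G) F /\ P1 p]
    & [/\ all (fun T => wide w2 T.2) F2, {subset @fams (a :: G) F2 <= @fams (a :: G) F}
       & forall p, p \in @paths (a :: G) F2 -> p \in @paths (a :: G) F /\ P2 p]].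
  have [w1F|w1F] := leqP w1 (size F1); [left|right].
    have [fF pF] := @forest_take G a F1 w1; exists (take w1 F1 : forest (size (a :: G))); split.
    - rewrite /= size_takel // eqxx /=.
      by move: wF1; rewrite -{1}(cat_take_drop w1 F1) all_cat => /andP[].
    - by move=> Y /fF /fF1.
    - by move=> p /pF /pF1.
  have w2F : w2 <= size F2.
    by rewrite -(leq_add2l w1) -sF -sF12 leq_add2r ltnW.
  have [fF pF] := @forest_take G a F2 w2; exists (take w2 F2 : forest (size (a :: G))); split.
  - rewrite /= size_takel // eqxx /=.
    by move: wF2; rewrite -{1}(cat_take_drop w2 F2) all_cat => /andP[].
  - by move=> Y /fF /fF2.
  - by move=> p /pF /pF2.
elim: F {sF} wF cF => [|T F IHF] /=.
  by move=> _ _; exists [::], [::]; split=> //; split.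
move=> /andP[wT wF] cF.
have [F1 [F2 [sF12 [wF1 fF1 pF1] [wF2 fF2 pF2]]]] := IHF wF
  (fun p pF => cF p (etrans (mem_cat _ _ _) (introT orP (or_intror pF)))).
have addf (F' : forest (size (a :: G))) : {subset @fams (a :: G) F' <= @fams (a :: G) F} ->
    {subset @fams (a :: G) F' <= @fams (a :: G) (T :: F)}.
  move=> fF' Y /fF' YF; rewrite fams_cons; apply/allpairsP; exists ([::], Y).
  by split=> //; exact: nil_tfams.
have addp (F' : forest (size (a :: G))) (P : chain -> Prop) :
   (forall p, p \in @paths (a :: G) F' -> p \in @paths (a :: G) F /\ P p) ->
   (forall p, p \in @paths (a :: G) F' -> p \in @paths (a :: G) (T :: F) /\ P p).
  by move=> pF' p /pF'[pF Pp]; split=> //; rewrite paths_cons mem_cat pF orbT.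
have add w (T' : forest (size G)) (F' : forest (size (a :: G))) (P : chain -> Prop) :
   wide w T' -> {subset @fams G T' <= @fams G T.2} ->
   (forall p, p \in @paths G T' -> p \in paths T.2 /\ P ((a, T.1) :: p)) ->
   all (fun T => wide w T.2) F' -> {subset @fams (a :: G) F' <= @fams (a :: G) F} ->
   (forall p, p \in @paths (a :: G) F' -> p \in @paths (a :: G) F /\ P p) ->
   [/\ all (fun T => wide w T.2) ((T.1, T') :: F'),
     {subset @fams (a :: G) ((T.1, T') :: F') <= @fams (a :: G) (T :: F)}
     & forall p, p \in @paths (a :: G) ((T.1, T') :: F') ->
        p \in @paths (a :: G) (T :: F) /\ P p].
  move=> wT' fT' pT' wF' fF' pF'; split.
  - by rewrite /= wT'.
  - move=> Y; rewrite !fams_cons => /allpairsP[[Y1 Y2] /= [/tfamsP Y1T /fF' Y2F ->]].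
    apply/allpairsP; exists (Y1, Y2); split=> //=; apply/tfamsP.
    by case: Y1T => [[p /pT'[pT _] dY]|/fT' ?]; [left; exists p|right].
  - move=> p; rewrite !paths_cons !mem_cat => /orP[|/pF'[-> ?]]; last by rewrite orbT.
    by case/mapP => q /pT'[qT Pq] ->; rewrite map_f.
have [] := IH T.2 (fun p => P1 ((a, T.1) :: p)) (fun p => P2 ((a, T.1) :: p)) wT.
- move=> p pT; apply: cF; rewrite paths_cons mem_cat map_f //.
- move=> [T' [wT' fT' pT']]; exists ((T.1, T') :: F1), F2; split.
  + by rewrite /= -sF12.
  + exact: add.
  + by split=> //; [exact: addf|exact: addp].
- move=> [T' [wT' fT' pT']]; exists F1, ((T.1, T') :: F2); split.
  + by rewrite /= -sF12 addnS.
  + by split=> //; [exact: addf|exact: addp].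
  + exact: add.
Qed.

End Forest.
Arguments fams : simpl never.
Arguments paths : simpl never.

(** * Systems *)

Section System.
Variables (Omega N : eqType) (P : set (set (seq Omega))).
Hypothesis PT : P setT.
Hypothesis PI : forall A B, P A -> P B -> P (A `&` B).
Hypothesis P_sub : forall A, P A ->
  P [set c | forall d, subseq d c -> A d].

Local Notation chain := (chain Omega N).
Implicit Types (S : set (seq N * set (set chain))) (E : set (seq chain)).
Implicit Types (G : seq N) (V : set (set chain)) (g : N -> seq Omega).

(** A system assigns to certain lists [G] of levels an ultrafilter [V] on the
chains with these levels.  A stable set of families has the empty family as a
member, and a chain chosen generically for any list of levels of the system
can be added to each of its members.  A list [G] is good if every stable set
contains all families of some forest of any given width with levels [G].  The
values of generic chains satisfy the conditions in [P]. *)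
Definition stable S E := E [::] /\ forall Z, E Z ->
  forall G V, S (G, V) -> G != [::] -> V [set c | E (c :: Z)].

Definition good S G := forall w E, stable S E ->
  exists2 F : forest Omega (size G), wide w.+1 F & forall Y, Y \in fams F -> E Y.

Record system S : Prop := System {
  sys_nil : S ([::], at_point [::]);
  sys_uniq : forall G V, S (G, V) -> uniq G;
  sys_ultra : forall G V, S (G, V) -> ultra V;
  sys_names : forall G V, S (G, V) -> V [set c | names c = G];
  sys_P : forall G V A, S (G, V) -> P A -> V [set c | A (vals c)];
  sys_size : forall G V, S (G, V) -> exists d, V [set c | size (vals c) = d];
  sys_sub : forall G V G', S (G, V) -> subseq G' G -> S (G', push (rst G') V);
  sys_fun : forall G V V', S (G, V) -> S (G, V') -> V = V';
  sys_dir : forall G1 V1 G2 V2, S (G1, V1) -> S (G2, V2) ->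
    exists G V, [/\ S (G, V), subseq G1 G & subseq G2 G];
  sys_good : forall G V, S (G, V) -> good S G }.

(** An ultrafilter [rho] on blocks is addable if one can put [rho]-many blocks on
top of the forests that the goodness of the system provides, respecting the
conditions of [P]; [extend_system] turns this into a new top level. *)
Definition addable S (rho : set (set (seq Omega))) := ultra rho /\
  forall R G V w E A, rho R -> S (G, V) -> stable S E -> P A ->
  exists v (F : forest Omega (size G)), [/\ R v, wide w.+1 F,
    (forall Y, Y \in fams F -> E Y) & forall p, p \in paths F -> A (v ++ vals p)].

Lemma stableT S : system S -> stable S setT.
Proof. by move=> sS; split=> // Z _ G V /(sys_ultra sS) U _; apply: ultraS (ultraT U). Qed.

Lemma stableI S E E' : system S -> stable S E -> stable S E' -> stable S (E `&` E').
Proof.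
move=> sS [E0 Es] [E'0 E's]; split=> // Z [EZ E'Z] G V SGV G0.
exact: (ultraI (sys_ultra sS SGV) (Es _ EZ _ _ SGV G0) (E's _ E'Z _ _ SGV G0)).
Qed.

(** This is how goodness is used to put the branches of a forest into a
[V]-large set of chains. *)
Lemma stable_level S G V A : system S -> S (G, V) -> V A ->
  stable S [set Y | forall c, c \in Y -> names c = G -> A c].
Proof.
move=> sS SG VA; split=> // Z EZ G' V' SG' _ /=; have UV' := sys_ultra sS SG'.
have := sys_names sS SG'; have [GG'|GG'] := eqVneq G' G.
  rewrite GG' in SG' UV' *; rewrite (sys_fun sS SG' SG) in UV' *.
  move=> _; apply: ultraS VA => // c Ac c'.
  by rewrite in_cons => /orP[/eqP->//|/EZ].
apply: (ultraS UV') => c /= nc c'.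
rewrite in_cons => /orP[/eqP->|/EZ//]; rewrite nc => G'G.
by rewrite G'G eqxx in GG'.
Qed.

Lemma stable_shift S E (Zs : seq (seq chain)) :
  (forall G V, S (G, V) -> ultra V) -> stable S E ->
  (forall Z, Z \in Zs -> E Z) ->
  stable S [set Y | E Y /\ forall Z, Z \in Zs -> E (Y ++ Z)].
Proof.
move=> sS [E0 Es] EZs; split; first by split.
move=> Y [EY EYZ] G V SGV G0; have U := sS _ _ SGV.
apply: (ultraI U (Es _ EY _ _ SGV G0)).
by apply: (ultra_all U) => Z ZZs; exact: (Es _ (EYZ Z ZZs) _ _ SGV G0).
Qed.

Lemma subseq_vals (d c : chain) : subseq d c -> subseq (vals d) (vals c).
Proof.
rewrite /vals; elim: c d => [|x c IH] d; first by rewrite subseq0 => /eqP->.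
case: d => [|y d] /=; first by rewrite sub0seq.
case: eqP => [->|_] /IH sdc; first by rewrite cat_subseq.
by apply: subseq_trans sdc _; exact: suffix_subseq.
Qed.

(** Conditions that involve two different lists of levels are compared in a
forest over a common list of levels, of the sum of the two widths: the
branches are two-coloured and the other levels are forgotten. *)
Lemma common_refinement S G1 V1 G2 V2 w1 w2 E1 E2 : system S ->
  S (G1, V1) -> S (G2, V2) -> stable S E1 -> stable S E2 ->
  exists G V, [/\ S (G, V), subseq G1 G, subseq G2 G
   & forall (F : forest Omega (size G)) (P1 P2 : chain -> Prop),
     wide (w1.+1 + w2.+1) F -> (forall Y, Y \in fams F -> E1 Y /\ E2 Y) ->
     (forall p, p \in paths F -> P1 p \/ P2 p) ->
     (exists F' : forest Omega (size G1),
        [/\ wide w1.+1 F', (forall Y, Y \in fams F' -> E1 Y) &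
            forall p', p' \in paths F' -> exists p,
             [/\ p \in paths F, P1 p & p' = rst G1 p]]) \/
     (exists F' : forest Omega (size G2),
        [/\ wide w2.+1 F', (forall Y, Y \in fams F' -> E2 Y) &
            forall p', p' \in paths F' -> exists p,
             [/\ p \in paths F, P2 p & p' = rst G2 p]])].
Proof.
move=> sS S1 S2 st1 st2.
have [G [V [SG s1 s2]]] := sys_dir sS S1 S2; exists G, V; split=> // F P1 P2 wF fF cF.
have uG := sys_uniq sS SG.
have [|] := forest_colour wF cF => -[F' [wF' fF' pF']]; [left|right].
- have [F1 [wF1 fF1 pF1]] := forest_project uG s1 wF'; exists F1; split=> //.
    by move=> Y /fF1/fF'/fF[].
  by move=> p' /pF1[p /pF'[pF P1p ->]]; exists p.
- have [F1 [wF1 fF1 pF1]] := forest_project uG s2 wF'; exists F1; split=> //.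
    by move=> Y /fF1/fF'/fF[].
  by move=> p' /pF1[p /pF'[pF P1p ->]]; exists p.
Qed.

Definition ev G g : chain := [seq (a, g a) | a <- G].

Lemma names_ev G g : names (ev G g) = G.
Proof. by rewrite /names /ev /unzip1 -map_comp map_id. Qed.

Lemma rst_ev G G' g : uniq G -> subseq G' G -> rst G' (ev G g) = ev G' g.
Proof.
move=> uG sG; rewrite /rst /ev filter_map; congr map.
by symmetry; exact/(subseq_uniqP uG).
Qed.

Lemma ev_ex (b : N) G v p : b \notin G -> uniq G -> names p = G ->
  exists2 g, g b = v & ev G g = p.
Proof.
elim: G p => [|a G IH] p.
  by case: p => // _ _ _; exists (fun=> v).
case: p => [//|[a' u] p] /=; rewrite in_cons negb_or => /andP[ba bG] /andP[aG uG] [-> pG].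
have [g gb gp] := IH p bG uG pG.
exists (fun x => if x == a then u else g x); first by rewrite (negPf ba).
rewrite eqxx; congr (_ :: _); rewrite -gp; apply/eq_in_map => x xG.
by case: eqP => // xa; rewrite -xa xG in aG.
Qed.

Section Extend.
Variables (S : set (seq N * set (set chain))) (rho : set (set (seq Omega))) (b : N).
Hypothesis sS : system S.
Hypothesis Hrho : addable S rho.
Hypothesis rho_size : exists d, rho [set v | size v = d].
Hypothesis bS : forall G V, S (G, V) -> b \notin G.

(** Simultaneous choices [g] of a block for every level, of which [b] is new.  A
set of choices is thin if, under some condition on the new block and on a
forest over the old levels, it never contains a choice for every branch of
that forest.  The thin sets form a proper ideal, and an ultrafilter disjoint
from this ideal provides all ultrafilters of the extended system at once. *)
Definition thin (B : set (N -> seq Omega)) := exists G V w E R A,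
  [/\ S (G, V), stable S E, rho R, P A &
   forall v (F : forest Omega (size G)), R v -> wide w.+1 F ->
     (forall Y, Y \in fams F -> E Y) ->
     (forall p, p \in paths F -> A (v ++ vals p)) ->
     ~ forall p, p \in paths F -> exists g, [/\ B g, g b = v & ev G g = p]].

Lemma thinU B1 B2 : thin B1 -> thin B2 -> thin (B1 `|` B2).
Proof.
move=> [G1 [V1 [w1 [E1 [R1 [A1 [S1 st1 r1 PA1 t1]]]]]]].
move=> [G2 [V2 [w2 [E2 [R2 [A2 [S2 st2 r2 PA2 t2]]]]]]].
have [G [V [SG s1 s2 ref]]] := common_refinement w1 w2 sS S1 S2 st1 st2.
have uG := sys_uniq sS SG.
exists G, V, (w1 + w2.+1), (E1 `&` E2), (R1 `&` R2),
  [set c | forall d, subseq d c -> (A1 `&` A2) d]; split=> //.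
- exact: stableI.
- by apply: ultraI r1 r2; case: Hrho.
- by apply/P_sub/PI.
move=> v F [R1v R2v] wF fF AF cF.
have sv p G' : subseq (v ++ vals (rst G' p)) (v ++ vals p).
  by apply: cat_subseq => //; apply: subseq_vals; exact: rst_subseq.
have [p pF||] := ref F (fun p => exists g, [/\ B1 g, g b = v & ev G g = p])
          (fun p => exists g, [/\ B2 g, g b = v & ev G g = p]) wF fF.
- by have [g [[Bg|Bg] gb gp]] := cF p pF; [left|right]; exists g.
- move=> [F' [wF' fF' pF']]; apply: (t1 v F') => // p' /pF'.
    by move=> [p [pF _ ->]]; have [] := AF p pF _ (sv p G1).
  move=> [p [pF [g [Bg gb gp]] ->]]; exists g; split=> //.
  by rewrite -gp rst_ev.
- move=> [F' [wF' fF' pF']]; apply: (t2 v F') => // p' /pF'.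
    by move=> [p [pF _ ->]]; have [] := AF p pF _ (sv p G2).
  move=> [p [pF [g [Bg gb gp]] ->]]; exists g; split=> //.
  by rewrite -gp rst_ev.
Qed.

Lemma thinT : ~ thin setT.
Proof.
move=> [G [V [w [E [R [A [SG st r PA t]]]]]]].
have [v [F [Rv wF fF AF]]] := Hrho.2 _ _ _ w _ _ r SG st PA.
apply: (t v F) => // p pF.
by have [g gb gp] := ev_ex v (bS SG) (sys_uniq sS SG) (names_paths pF); exists g.
Qed.

Lemma extend_ultra : exists2 U, ultra U & forall B, thin (~` B) -> U B.
Proof.
have thin0 : thin set0.
  exists [::], (at_point [::]), 0, setT, setT, setT; split=> //.
  - exact: sys_nil.
  - exact: stableT.
  - by case: Hrho => /ultraT.
  move=> v F _ wF _ _ cF; have [p pF] := paths_nonempty wF.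
  by have [g []] := cF p pF.
have [||B|U UU TU] := @ultra_extend _ [set B | thin (~` B)].
- by exists setT; rewrite /= setCT.
- move=> B1 B2 t1 t2; exists (B1 `&` B2) => //=.
  by rewrite setCI; exact: thinU.
- move=> /= tB; apply: contrapT => /set0P/negP; rewrite negbK => /eqP B0.
  by apply: thinT; rewrite -setC0 -B0.
- by exists U => // B tB; exact: TU.
Qed.

(** Goodness at the new level: for a stable set, the choices [g] such that the
chain of [g] and all its subchains through the new level are members form a
large set, hence not a thin one, and this yields one tree whose families are
members.  Further trees are added one at a time, with the stable set shifted
by the families already obtained. *)
Lemma extend_system : exists S', [/\ system S', S `<=` S',
   (exists2 V, S' ([:: b], V) & push (@vals Omega N) V = rho) &
   forall G V, S' (G, V) -> S (G, V) \/ exists2 G', G = b :: G' & exists V', S (G', V')].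
Proof.
have [U UU TU] := extend_ultra.
have rU : ultra rho by case: Hrho.
have UG G V : S (G, V) -> push (ev G) U = V.
  move=> SG; symmetry; apply: ultra_incl.
  - exact: sys_ultra SG.
  - exact: ultra_push.
  move=> A VA; apply: TU.
  exists G, V, 0, [set Y : seq chain | forall c, c \in Y -> names c = G -> A c],
    setT, setT; split=> //; last 1 first.
  - move=> v F _ wF fF _ cF; have [p pF] := paths_nonempty wF.
    have [g [/= ng gb gp]] := cF p pF.
    case: (eqVneq G [::]) => [G0|G0].
      have := ultra_nonempty (sys_ultra sS SG)
        (ultraI (sys_ultra sS SG) VA (sys_names sS SG)).
      move=> [c [Ac /= nc]]; apply: ng; rewrite gp.
      have nil (c' : chain) : names c' = G -> c' = [::] by rewrite G0; case: c'.
      by rewrite (nil _ (names_paths pF)) -(nil _ nc).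
    have p0 : p != [::] by move: G0; rewrite -(names_paths pF); case: (p).
    apply: ng; rewrite /= gp; apply: (fF [:: p] _) => /=.
    + exact: path_fams pF (subseq_refl p) p0.
    + exact: mem_head.
    + exact: names_paths pF.
  - exact: stable_level sS SG VA.
  - exact: ultraT.
have Ub R : rho R -> U [set g | R (g b)].
  move=> rR; apply: TU.
  exists [::], (at_point [::]), 0, setT, R, setT; split=> //.
  - exact: sys_nil.
  - exact: stableT.
  move=> v F Rv wF _ _ cF; have [p pF] := paths_nonempty wF.
  by have [g [/= ng gb gp]] := cF p pF; apply: ng; rewrite gb.
pose S' : set (seq N * set (set chain)) :=
  [set GV | S GV \/ exists G V, S (G, V) /\ GV = (b :: G, push (ev (b :: G)) U)].
have SS' : S `<=` S' by move=> GV SGV; left.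
have S'E G V : S' (G, V) -> V = push (ev G) U /\ uniq G.
  case=> [SG|[G1 [V1 [SG [-> ->]]]]]; first by rewrite (UG _ _ SG) (sys_uniq sS SG).
  by rewrite /= (bS SG) (sys_uniq sS SG).
have S'b G V : S (G, V) -> S' (b :: G, push (ev (b :: G)) U).
  by move=> SG; right; exists G, V.
have push_rst G G' : uniq G -> subseq G' G -> push (rst G') (push (ev G) U) = push (ev G') U.
  move=> uG sG; rewrite /push; apply/seteqP; split=> A /=;
    by apply: ultraS => // g; rewrite /preimage /= rst_ev.
have sub_ultra G V : S' (G, V) -> ultra V.
  by move/S'E=> [-> _]; exact: ultra_push.
have st_S E : stable S' E -> stable S E.
  by case=> E0 Es; split=> // Z EZ G V SG; apply: Es EZ _ _ (SS' _ SG).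
have S'sys : system S'.
  split.
  - by left; exact: sys_nil.
  - by move=> G V /S'E[].
  - by move=> G V /S'E[-> _]; exact: ultra_push.
  - move=> G V /S'E[-> _]; apply: (ultraS UU) (ultraT UU) => g _ /=.
    exact: names_ev.
  - move=> G V A [SG|[G1 [V1 [SG [_ ->]]]]] PA; first exact: (sys_P sS SG PA).
    apply: TU; exists G1, V1, 0, setT, setT, A; split=> //.
    + exact: stableT.
    + exact: ultraT.
    move=> v F _ wF _ AF cF; have [p pF] := paths_nonempty wF.
    by have [g [/= ng gb gp]] := cF p pF; apply: ng; rewrite /= gb gp; exact: AF.
  - move=> G V [SG|[G1 [V1 [SG [_ ->]]]]]; first exact: (sys_size sS SG).
    have [d1 r1] := rho_size; have [d2 Vd] := sys_size sS SG.
    rewrite -(UG _ _ SG) in Vd; exists (d1 + d2).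
    apply: (ultraS UU) (ultraI UU (Ub _ r1) Vd) => g [/= <- <-].
    by rewrite /vals /= size_cat.
  - move=> G V G' SG sG; have [VE uG] := S'E _ _ SG.
    rewrite VE push_rst //; case: SG => [SG|[G1 [V1 [SG [GE _]]]]].
      rewrite -(push_rst G G') // -VE; left; exact: (sys_sub sS SG sG).
    subst G; case: G' sG => [|a G'].
      move=> _; rewrite -(push_rst G1 [::]) ?sub0seq ?(sys_uniq sS SG) //.
      by rewrite (UG _ _ SG); left; apply: (sys_sub sS SG); exact: sub0seq.
    rewrite /=; case: eqP => [-> sG|_ sG].
      apply: (S'b _ (push (rst G') V1)); exact: (sys_sub sS SG).
    rewrite -(push_rst G1 (a :: G')) ?(sys_uniq sS SG) //.
    by rewrite (UG _ _ SG); left; apply: (sys_sub sS SG).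
  - by move=> G V V' /S'E[-> _] /S'E[-> _].
  - have dir G1 V1 G2 V2 : S (G1, V1) -> S (G2, V2) -> exists G,
      [/\ S' (b :: G, push (ev (b :: G)) U), subseq G1 G & subseq G2 G].
      move=> S1 S2; have [G [V [SG s1 s2]]] := sys_dir sS S1 S2.
      by exists G; split=> //; exact: S'b SG.
    have core G V : S' (G, V) -> exists G1 V1, S (G1, V1) /\ subseq G (b :: G1).
      case=> [SG|[G1 [V1 [SG [-> _]]]]]; last by exists G1, V1.
      by exists G, V; split=> //; exact: subseq_cons.
    move=> G1 V1 G2 V2 /core[G1' [V1' [S1 s1]]] /core[G2' [V2' [S2 s2]]].
    have [G [SG s1' s2']] := dir _ _ _ _ S1 S2.
    exists (b :: G), (push (ev (b :: G)) U); split=> //.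
      by apply: subseq_trans s1 _; rewrite /= eqxx.
    by apply: subseq_trans s2 _; rewrite /= eqxx.
  - move=> G V [SG|[G1 [V1 [SG [-> _]]]]].
      by move=> w E /st_S stE; exact: (sys_good sS SG).
    move=> w E0 stE0.
    have one E : stable S' E -> exists2 T : seq Omega * forest Omega (size G1),
        wide w.+1 T.2 & forall Y, Y \in tfams b T -> E Y.
      move=> stE; pose B : set (N -> seq Omega) :=
        [set g | forall d, d \in subs (ev G1 g) -> E [:: (b, g b) :: d]].
      have UB : U B.
        have : U [set g | forall G', G' \in subs G1 -> E [:: ev (b :: G') g]].
          apply: (ultra_all UU) => G'; rewrite mem_subs => sG.
          exact: (stE.2 _ stE.1 _ _ (S'b _ _ (sys_sub sS SG sG))).
        apply: (ultraS UU) => g EG d; rewrite subs_map => /mapP[G' G's ->].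
        exact: EG.
      have nB : ~ thin B.
        move=> tB; have : U (~` B) by apply: TU; rewrite setCK.
        by move/(ultra_setC UU); apply.
      apply: contrapT => nT; apply: nB.
      exists G1, V1, w, E, setT, setT; split=> //.
      - exact: st_S.
      - exact: ultraT.
      move=> v F _ wF fF _ cF; apply: nT; exists (v, F) => // Y /tfamsP[|/fF//].
      move=> [p pF [d dp ->]]; have [g [Bg gb gp]] := cF p pF.
      by rewrite -gb; apply: Bg; rewrite gp mem_subs.
    suff [F [sF wF fF]] : exists F : forest Omega (size (b :: G1)), [/\ size F = w.+1,
        all (fun T => wide w.+1 T.2) F & forall Y, Y \in fams F -> E0 Y].
      by exists F => //=; rewrite sF eqxx.
    elim: {1}w.+1 => [|n [F [sF wF fF]]].
      exists ([::] : forest Omega (size (b :: G1))); split=> // Y.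
      by rewrite inE => /eqP->; exact: stE0.1.
    have stE := stable_shift sub_ultra stE0 fF; have [T wT fT] := one _ stE.
    exists (T :: F : forest Omega (size (b :: G1))); split.
    - by rewrite /= sF.
    - by rewrite /= wT.
    - by move=> Y; rewrite fams_cons => /allpairsP[[Y1 Y2] /= [/fT[_ h] ? ->]]; exact: h.
exists S'; split=> //.
- exists (push (ev [:: b]) U); first by apply: (S'b _ (at_point [::])); exact: sys_nil.
  symmetry; apply: ultra_incl => //; first by apply/ultra_push/ultra_push.
  move=> R /Ub; apply: (ultraS UU) => g Rg.
  by rewrite /preimage /vals /= cats0.
- move=> G V [SG|[G1 [V1 [SG [-> ->]]]]]; first by left.
  by right; exists G1 => //; exists V1.
Qed.
End Extend.
End System.

(** * Repeated levels *)

Section Names.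
Variables (Omega : eqType) (P : set (set (seq Omega))).
Hypothesis PT : P setT.
Hypothesis PI : forall A B, P A -> P B -> P (A `&` B).
Hypothesis P_sub : forall A, P A ->
  P [set c | forall d, subseq d c -> A d].

(** The name of a level records a stage, the ultrafilter that the level realizes,
and an index that distinguishes the levels with the same ultrafilter; since
there is only a set of such names, a maximal system exists. *)
Definition label : eqType := {classic set (set (seq Omega))}.
Definition name : eqType := (nat * (label * nat))%type.

Local Notation chain := (chain Omega name).
Implicit Types (S : set (seq name * set (set chain))) (G : seq name) (V : set (set chain)).

Definition below tau S := forall G V, S (G, V) -> all (fun x : name => x.1 < tau) G.

(** A system obtained from [S0], whose stages are less than [tau], by putting on
top levels of stage [tau] with labels in [Lab]. *)
Definition run tau S0 (Lab : set (set (set (seq Omega)))) S :=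
  [/\ system P S, S0 `<=` S,
     forall G V, S (G, V) -> all (fun x : name => x.1 < tau) G -> S0 (G, V),
     forall G V, S (G, V) -> exists G1 G0, [/\ G = G1 ++ G0,
       all (fun x : name => x.1 == tau) G1 & all (fun x : name => x.1 < tau) G0]
   & forall rho i V, S ([:: (tau, (rho : label, i))], V) ->
       Lab rho /\ push (@vals Omega name) V = rho].

Lemma run_base tau S0 Lab : system P S0 -> below tau S0 -> run tau S0 Lab S0.
Proof.
move=> sS bS; split=> //.
- by move=> G V /bS bG; exists [::], G.
- by move=> rho i V /bS /=; rewrite ltnn.
Qed.

Lemma run_bigcup tau S0 Lab (C : set (set (seq name * set (set chain)))) :
  C !=set0 -> (forall X, C X -> run tau S0 Lab X) -> total_on C subset ->
  run tau S0 Lab (\bigcup_(X in C) X).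
Proof.
move=> [X0 CX0] runC totC.
have com GV GV' : (\bigcup_(X in C) X) GV -> (\bigcup_(X in C) X) GV' ->
    exists X, [/\ C X, X GV & X GV'].
  move=> [X CX XGV] [X' CX' X'GV]; have [XX|XX] := totC _ _ CX CX'.
    by exists X'; split=> //; exact: XX.
  by exists X; split=> //; exact: XX.
have up X : C X -> X `<=` \bigcup_(X in C) X by move=> CX GV XGV; exists X.
split; first split.
- by exists X0 => //; have [s _ _ _ _] := runC _ CX0; exact: sys_nil s.
- by move=> G V [X CX XG]; have [s _ _ _ _] := runC _ CX; exact: (sys_uniq s XG).
- by move=> G V [X CX XG]; have [s _ _ _ _] := runC _ CX; exact: (sys_ultra s XG).
- by move=> G V [X CX XG]; have [s _ _ _ _] := runC _ CX; exact: (sys_names s XG).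
- by move=> G V A [X CX XG]; have [s _ _ _ _] := runC _ CX; exact: (sys_P s XG).
- by move=> G V [X CX XG]; have [s _ _ _ _] := runC _ CX; exact: (sys_size s XG).
- move=> G V G' [X CX XG] sG; have [s _ _ _ _] := runC _ CX.
  by exists X => //; exact: (sys_sub s XG).
- move=> G V V' X1 X2; have [X [CX XG XG']] := com _ _ X1 X2.
  by have [s _ _ _ _] := runC _ CX; exact: (sys_fun s XG XG').
- move=> G1 V1 G2 V2 X1 X2; have [X [CX XG XG']] := com _ _ X1 X2.
  have [s _ _ _ _] := runC _ CX; have [G [V [XGV s1 s2]]] := sys_dir s XG XG'.
  by exists G, V; split=> //; exists X.
- move=> G V [X CX XG]; have [s _ _ _ _] := runC _ CX.
  move=> w E [E0 Es]; apply: (sys_good s XG); split=> // Z EZ G' V' XG'.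
  by apply: Es EZ _ _ _; exists X.
- by move=> GV S0GV; exists X0 => //; have [_ h _ _ _] := runC _ CX0; exact: h.
- by move=> G V [X CX XG]; have [_ _ h _ _] := runC _ CX; exact: h XG.
- by move=> G V [X CX XG]; have [_ _ _ h _] := runC _ CX; exact: h XG.
- by move=> rho i V [X CX XG]; have [_ _ _ _ h] := runC _ CX; exact: h XG.
Qed.

(** A maximal system has an addable label [rho]; a copy of [rho] that it does not
contain could be added to it, against maximality.  So it contains them all. *)
Lemma repeat_label tau S0 (Lab : set (set (set (seq Omega)))) :
  system P S0 -> below tau S0 ->
  (forall rho, Lab rho -> exists d, rho [set v | size v = d]) ->
  (forall S tau', system P S -> below tau' S -> exists2 rho, Lab rho & addable P S rho) ->
  exists S (rho : label), [/\ run tau S0 Lab S, Lab rho &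
    forall i, exists V, S ([:: (tau, (rho, i))], V)].
Proof.
move=> sS0 bS0 sizeL addL.
pose Q X := X = set0 \/ run tau S0 Lab X.
have [|X [QX maxX]] := @Zorn_bigcup _ Q.
  move=> C CQ totC.
  have [[X0 [CX0 nX0]]|noC] := pselect (exists X, C X /\ X <> set0); last first.
    left; apply/seteqP; split=> // GV [X CX XGV]; apply: noC; exists X; split=> // X0.
    by rewrite X0 in XGV.
  right; pose C' := [set X | C X /\ X <> set0].
  have -> : \bigcup_(X in C) X = \bigcup_(X in C') X.
    apply/seteqP; split=> GV [X CX XGV]; exists X => //; last by case: CX.
    by split=> // X0'; rewrite X0' in XGV.
  apply: run_bigcup; first by exists X0.
    by move=> X [/CQ[]].
  by move=> X X' [CX _] [CX' _]; exact: totC.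
have runX : run tau S0 Lab X.
  case: QX => [X0|//]; have := maxX S0; rewrite X0 => h.
  exfalso; apply: h; last by right; exact: run_base.
  split; first by move=> ?.
  by move=> /(_ _ (sys_nil sS0)).
have [sX S0X lowX ordX labX] := runX.
have bX : below tau.+1 X.
  move=> G V /ordX[G1 [G0 [-> G1t G0t]]]; rewrite all_cat; apply/andP; split.
    by apply: sub_all G1t => x /eqP->.
  by apply: sub_all G0t => x; exact: ltnW.
have [rho Lrho addr] := addL X tau.+1 sX bX.
exists X, (rho : label); split=> // i; apply: contrapT => nV.
pose b : name := (tau, (rho : label, i)).
have fresh G V : X (G, V) -> b \notin G.
  move=> XG; apply/negP; rewrite -sub1seq => sb; apply: nV.
  by exists (push (rst [:: b]) V); exact: (sys_sub sX XG).
have [X' [sX' XX' [Vb X'b Vrho] X'E]] := extend_system PT PI P_sub sX addr (sizeL _ Lrho) fresh.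
apply: (maxX X').
  split=> // /(_ _ X'b) Xb; apply: nV; by exists Vb.
right; split=> //.
- by move=> GV /S0X /XX'.
- move=> G V X'G lG; case: (X'E _ _ X'G) => [XG|[G' GE _]]; first exact: lowX.
  by move: lG; rewrite GE /= ltnn.
- move=> G V X'G; case: (X'E _ _ X'G) => [|[G' GE [V' XG']]]; first exact: ordX.
  have [G1 [G0 [G'E G1t G0t]]] := ordX _ _ XG'.
  by exists (b :: G1), G0; rewrite GE G'E /= eqxx G1t.
- move=> rho' i' V X'V; case: (X'E _ _ X'V) => [|[G' [rE iE GE] _]]; first exact: labX.
  rewrite rE iE in X'V *; rewrite (sys_fun sX' X'V X'b); split=> //.
Qed.
End Names.

(** * Flattened lists *)

Section Flatten.
Variables (Omega : eqType) (T : Type) (f : T -> seq Omega).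

Lemma mem_flatten_nth x0 (l : seq T) z : z \in flatten [seq f x | x <- l] ->
  exists2 k, k < size l & z \in f (nth x0 l k).
Proof.
elim: l => [//|x l IH] /=; rewrite mem_cat => /orP[zx|/IH[k kl zk]].
  by exists 0.
by exists k.+1.
Qed.

Lemma flatten_nth_mem x0 (l : seq T) z k : k < size l -> z \in f (nth x0 l k) ->
  z \in flatten [seq f x | x <- l].
Proof.
elim: l k => [//|x l IH] [_ zx|k kl zk] /=; rewrite mem_cat ?zx //.
by rewrite (IH k kl zk) orbT.
Qed.

Lemma size_flatten_nth x0 (l : seq T) b :
  (forall k, k < size l -> size (f (nth x0 l k)) = b) ->
  size (flatten [seq f x | x <- l]) = size l * b.
Proof.
elim: l => [//|x l IH] h /=; rewrite size_cat mulSn (h 0) // IH // => k kl.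
exact: (h k.+1).
Qed.
End Flatten.

Lemma size_flatten_le (T : eqType) (l : seq (seq T)) m :
  (forall x, x \in l -> size x <= m) -> size (flatten l) <= size l * m.
Proof.
elim: l => [//|x l IH] h /=; rewrite size_cat mulSn leq_add ?h ?mem_head //.
by apply: IH => y yl; rewrite h // in_cons yl orbT.
Qed.

(** * Iterated ultrafilter quantifiers *)

Section Iterate.
Variables (Omega : eqType) (Cons : seq Omega -> Prop).
Hypothesis Cons_sub : forall l l' : seq Omega, {subset l' <= l} -> Cons l -> Cons l'.

(** [often rho n C Z] says that [C] holds of [Z] extended by [n] successive
generic choices from [rho], that is, by a Morley sequence of length [n] in the
coheir [rho]. *)
Fixpoint often (T : Type) (rho : set (set T)) n (C : seq T -> Prop) (Z : seq T) : Prop :=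
  if n is m.+1 then rho [set v | often rho m C (v :: Z)] else C Z.

Lemma often_not (T : Type) (rho : set (set T)) n C Z : ultra rho ->
  ~ often rho n C Z -> often rho n (fun Y => ~ C Y) Z.
Proof.
move=> U; elim: n Z => [//|n IH] Z /= /(ultra_setC U).
by apply: (ultraS U) => v /= /IH.
Qed.

Definition nondividing n (rho : set (set (seq Omega))) :=
  often rho n (fun Z => Cons (flatten Z)) [::].

Lemma often_Cons rho n Z : ultra rho ->
  often rho n (fun Z => Cons (flatten Z)) Z -> Cons (flatten Z).
Proof.
move=> U; elim: n Z => [//|n IH] Z /= /(ultra_nonempty U)[v /IH].
by apply: Cons_sub => x xZ; rewrite mem_cat xZ orbT.
Qed.
End Iterate.

(** * Trees *)

Section Nodes.
Variables (Omega N : eqType).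
Local Notation chain := (chain Omega N).

Fixpoint node (n : nat) : seq Omega * forest Omega n -> seq bool -> seq Omega :=
  match n with
  | 0 => fun T _ => T.1
  | n'.+1 => fun T s =>
      if s is x :: s' then
        (fun F : seq (seq Omega * forest Omega n') =>
          if F is T0 :: T1 :: _ then node (if x then T1 else T0) s' else [::]) T.2
      else T.1
  end.

Lemma children w n (F : forest Omega n.+1) : wide w.+2 F ->
  exists T0 T1 F', [/\ F = T0 :: T1 :: F', wide w.+2 T0.2 & wide w.+2 T1.2].
Proof.
case: F => [//|T0 [//|T1 F']] /= /andP[_ /and3P[w0 w1 _]].
by exists T0, T1, F'.
Qed.

Lemma child_fams a (G : seq N) T0 T1 F' (x : bool) Y :
  Y \in @tfams Omega N a G (if x then T1 else T0) ->
  Y \in fams (T0 :: T1 :: F' : forest Omega (size (a :: G))).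
Proof.
case: x => YT; rewrite fams_cons; apply/allpairsP.
  exists ([::], Y); split=> //; first exact: nil_tfams.
  rewrite fams_cons; apply/allpairsP; exists (Y, [::]); split; rewrite ?cats0 //.
  exact: nil_fams.
by exists (Y, [::]); split; rewrite ?cats0 //; exact: nil_fams.
Qed.

Lemma child_paths a (G : seq N) T0 T1 F' (x : bool) p :
  p \in @paths Omega N G (if x then T1 else T0).2 ->
  (a, (if x then T1 else T0).1) :: p \in
     paths (T0 :: T1 :: F' : forest Omega (size (a :: G))).
Proof. by case: x => pT; rewrite !paths_cons !mem_cat map_f ?orbT. Qed.

Lemma node_path w a (G : seq N) (T : seq Omega * forest Omega (size G)) s :
  wide w.+2 T.2 -> size s <= size G ->
  exists2 p, p \in paths T.2 &
    subseq [:: (nth a (a :: G) (size s), node T s)] ((a, T.1) :: p).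
Proof.
elim: G a T s => [|b G IH] a T [|x s] //=.
- by exists [::]; rewrite ?eqxx.
- move=> wT _; have [p pT] := @paths_nonempty _ _ (b :: G) w.+1 T.2 wT; exists p => //.
  by rewrite /= eqxx sub0seq.
move=> wT sG; have [T0 [T1 [F' [TE w0 w1]]]] := children wT.
have [||p pT sp] := IH b (if x then T1 else T0) s _ _ => //; first by case: (x).
exists ((b, (if x then T1 else T0).1) :: p).
  by rewrite TE; exact: child_paths.
rewrite TE; case: ifP => _; first by rewrite sub0seq.
by rewrite (set_nth_default b) // ltnS.
Qed.

Lemma fam_pair w a (G : seq N) (T : seq Omega * forest Omega (size G)) s s' :
  wide w.+2 T.2 -> size s' <= size G -> prefix s s' -> s != s' ->
  let x := nth a (a :: G) (size s) in let y := nth a (a :: G) (size s') in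
  subseq [:: x; y] (a :: G) /\
  [:: [:: (x, node T s); (y, node T s')]] \in tfams a T.
Proof.
elim: G a T s s' => [|b G IH] a T s [|z s'] wT //=.
- by case: s.
- by case: s.
move=> sG; have [T0 [T1 [F' [TE w0 w1]]]] := children wT.
case: s => [|x s] /=.
  move=> _ _; have [||p pT sp] := @node_path w b G (if z then T1 else T0) s' _ _ => //.
    by case: (z).
  have pT' : (b, (if z then T1 else T0).1) :: p \in @paths Omega N (b :: G) T.2.
    by rewrite TE; exact: child_paths.
  rewrite (set_nth_default b) ?ltnS //; split.
    rewrite eqxx.
    have := map_subseq fst sp; rewrite /= -[map fst p]/(names p) (names_paths pT).
    by case: ifP.
  apply/tfamsP; left; exists ((b, (if z then T1 else T0).1) :: p) => //.
  exists [:: (nth b (b :: G) (size s'), node (if z then T1 else T0) s')] => //.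
  by rewrite TE.
rewrite eqseq_cons; case: eqP => // -> /= ps ss.
have [||||sub Y] := IH b (if z then T1 else T0) s s' _ _ _ _ => //; first by case: (z).
have lts : size s < size s'.
  rewrite ltn_neqAle (size_prefix ps) andbT; apply/negP => /eqP ess.
  by move: ps ss; rewrite prefixE ess take_size => /eqP->; rewrite eqxx.
rewrite !(set_nth_default b) ?ltnS ?(leq_trans (ltnW lts)) //; split.
  exact: subseq_trans sub (subseq_cons (b :: G) a).
apply/tfamsP; right; rewrite TE; exact: child_fams Y.
Qed.

Definition incomparable (Xs : seq (seq bool)) :=
  forall s s', s \in Xs -> s' \in Xs -> s != s' -> ~~ prefix s s'.

(** An antichain of strings of length at most [n] has at most [2 ^ n] elements,
so the bound on the size of the family is uniform in the antichain. *)
Lemma fam_antichain w a (G : seq N) (T : seq Omega * forest Omega (size G)) Xs :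
  wide w.+2 T.2 -> (forall s, s \in Xs -> size s <= size G) -> incomparable Xs ->
  exists Y, [/\ Y \in tfams a T, size Y <= 2 ^ size G,
    forall c, c \in Y -> exists2 x, x \in a :: G & names c = [:: x]
  & forall s, s \in Xs -> node T s \in [seq vals c | c <- Y]].
Proof.
elim: G a T Xs => [|b G IH] a T Xs wT sG incX; have [rX|rX] := boolP ([::] \in Xs).
- exists [:: [:: (a, T.1)]]; split=> //.
    by apply/tfamsP; left; exists [::] => //; exists [::].
    by move=> c; rewrite inE => /eqP->; exists a; rewrite ?mem_head.
  by move=> s /sG; rewrite leqn0 size_eq0 => /eqP->; rewrite /= /vals /= cats0 mem_head.
- exists [::]; split=> //.
  by move=> s sX; have := sG s sX; rewrite leqn0 size_eq0 => /eqP s0; rewrite -s0 sX in rX.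
- exists [:: [:: (a, T.1)]]; split=> //.
  + have [p pT] := @paths_nonempty _ _ (b :: G) _ T.2 wT.
    by apply/tfamsP; left; exists p => //; exists [::]; rewrite ?sub0seq.
  + by rewrite expn_gt0.
  + by move=> c; rewrite inE => /eqP->; exists a; rewrite ?mem_head.
  move=> s sX; case: (eqVneq [::] s) => [<-|s0].
    by rewrite /= /vals /= cats0 mem_head.
  by have := incX _ _ rX sX s0; rewrite prefix0s.
have [T0 [T1 [F' [TE w0 w1]]]] := children wT.
pose sub (x : bool) := [seq behead s | s <- Xs & ohead s == Some x].
have subP x s : s \in sub x -> (x :: s) \in Xs.
  case/mapP=> -[|y s']; rewrite mem_filter => /andP[] //= /eqP[->] sX ->; exact: sX.
have IHx x : exists Y, [/\ Y \in tfams b (if x then T1 else T0), size Y <= 2 ^ size G,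
    forall c, c \in Y -> exists2 x, x \in b :: G & names c = [:: x]
  & forall s, s \in sub x -> node (if x then T1 else T0) s \in [seq vals c | c <- Y]].
  apply: IH; first by case: (x).
    by move=> s /subP /sG.
  move=> s s' /subP sX /subP s'X ss; have := incX _ _ sX s'X.
  by rewrite eqseq_cons /= !eqxx; apply.
have [Y0 [Y0T sY0 nY0 vY0]] := IHx false; have [Y1 [Y1T sY1 nY1 vY1]] := IHx true.
exists (Y0 ++ Y1); split.
- apply/tfamsP; right; rewrite TE fams_cons; apply/allpairsP; exists (Y0, Y1).
  split=> //; rewrite fams_cons; apply/allpairsP; exists (Y1, [::]).
  by split; rewrite ?cats0 //; exact: nil_fams.
- by rewrite size_cat expnS mul2n -addnn leq_add.
- by move=> c; rewrite mem_cat => /orP[/nY0|/nY1] [x xG ->]; exists x => //;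
    rewrite in_cons xG orbT.
- move=> [|x s] sX; first by rewrite sX in rX.
  have sx : s \in sub x by apply/mapP; exists (x :: s); rewrite // mem_filter eqxx sX.
  rewrite map_cat mem_cat /= TE.
  by case: x sX sx => sX sx; [rewrite (vY1 _ sx) orbT|rewrite (vY0 _ sx)].
Qed.

Lemma fams_columns a (G : seq N) w (F : seq (seq Omega * forest Omega (size G)))
    (Q : seq Omega * forest Omega (size G) -> seq chain -> Prop) :
  (forall T, wide w T.2 -> exists2 Y, Y \in tfams a T & Q T Y) ->
  all (fun T => wide w T.2) F ->
  exists Ys, [/\ flatten Ys \in @fams Omega N (a :: G) F, size Ys = size F &
    forall T0 k, k < size F -> Q (nth T0 F k) (nth [::] Ys k)].
Proof.
move=> hQ; elim: F => [_|T F IHF]; first by exists [::].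
rewrite [all _ _]/= => /andP[/hQ[Y YT QY] /IHF[Ys [YsF sYs QYs]]].
exists (Y :: Ys); split=> [||T0 [|k] //=]; last exact: QYs.
  by rewrite fams_cons; apply/allpairsP; exists (Y, flatten Ys).
by rewrite /= sYs.
Qed.
End Nodes.

(** * Finite antichain trees *)

Section Combinatorics.
Variables (Omega : eqType) (P : set (set (seq Omega))) (Cons : seq Omega -> Prop).
Hypothesis PT : P setT.
Hypothesis PI : forall A B, P A -> P B -> P (A `&` B).
Hypothesis P_sub : forall A, P A ->
  P [set c | forall d, subseq d c -> A d].
Hypothesis P_ext : forall A N d, P A -> exists2 A', P A' &
  forall C : seq (seq Omega), size C <= N ->
    (forall c, c \in C -> size c = d /\ A' c) ->
    exists y, forall c, c \in C -> A (y :: c).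
Hypothesis Cons_sub : forall l l' : seq Omega, {subset l' <= l} -> Cons l -> Cons l'.

Local Notation name := (name Omega).
Local Notation chain := (chain Omega name).
Implicit Types (S : set (seq name * set (set chain))) (G : seq name) (V : set (set chain)).

Lemma addable_P S rho A : system P S -> addable P S rho -> P A -> rho A.
Proof.
move=> sS [U add] PA; apply: contrapT => /(ultra_setC U) nA.
have [v [F [nAv wF _ AF]]] := add _ _ _ 0 _ _ nA (sys_nil sS) (stableT sS) PA.
have [p pF] := paths_nonempty wF; have := AF p pF.
by move: pF; rewrite inE => /eqP->; rewrite /vals /= cats0.
Qed.

Lemma sys_forest S G V (A : set chain) w E : system P S -> S (G, V) -> V A ->
  stable S E -> exists F : forest Omega (size G), [/\ wide w.+1 F,
   forall Y, Y \in fams F -> E Y & forall p, p \in paths F -> A p].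
Proof.
move=> sS SG VA stE.
pose E' : set (seq chain) := [set Y | forall c, c \in Y -> names c = G -> A c].
have stE' : stable S E' := stable_level sS SG VA.
have [F wF fF] := sys_good sS SG w (stableI sS stE stE').
exists F; split=> // [Y /fF[]//|p pF].
have [p0|p0] := eqVneq p [::].
  have [c [Ac /= nc]] := ultra_nonempty (sys_ultra sS SG)
    (ultraI (sys_ultra sS SG) VA (sys_names sS SG)).
  have G0 : G = [::] by rewrite -(names_paths pF) p0.
  suff -> : p = c by [].
  by rewrite p0; case: (c) nc; rewrite G0.
have [_ h] := fF _ (path_fams pF (subseq_refl p) p0).
by apply: h; [exact: mem_head|exact: names_paths pF].
Qed.

(** A single point can always be put on top of a good forest: a generic condition
on sequences follows from one on shorter sequences, whose finitely many
realizations given by the branches have a common one-point extension. *)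
Lemma add_one S : system P S -> exists2 rho, addable P S rho & rho [set v | size v = 1].
Proof.
move=> sS.
pose D G w E A : set (seq Omega) := [set v | exists y (F : forest Omega (size G)),
  [/\ v = [:: y], wide w.+1 F, forall Y, Y \in fams F -> E Y
   & forall p, p \in paths F -> A (y :: vals p)]].
pose B : set (set (seq Omega)) := [set X | exists G V w E A,
  [/\ S (G, V), stable S E, P A & X = D G w E A]].
have [||_ [G [V [w [E [A [SG stE PA ->]]]]]]|rho U Br] := @ultra_extend _ B.
- exists (D [::] 0 setT setT), [::], (at_point [::]), 0, setT, setT; split=> //.
  + exact: (sys_nil sS).
  + exact: (stableT sS).
- move=> _ _ [G1 [V1 [w1 [E1 [A1 [S1 st1 PA1 ->]]]]]] [G2 [V2 [w2 [E2 [A2 [S2 st2 PA2 ->]]]]]].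
  have [G [V [SG s1 s2 ref]]] := common_refinement w1 w2 sS S1 S2 st1 st2.
  exists (D G (w1 + w2.+1) (E1 `&` E2) [set c | forall d, subseq d c -> (A1 `&` A2) d]).
    exists G, V, (w1 + w2.+1), (E1 `&` E2), [set c | forall d, subseq d c -> (A1 `&` A2) d].
    by split=> //; [exact: (stableI sS)|apply: P_sub; exact: PI].
  move=> _ [y [F [-> wF fF AF]]]; split; exists y.
    have [||] := ref F (fun=> True) (fun=> False) wF fF; first by left.
      move=> [F' [wF' fF' pF']]; exists F'; split=> // p' /pF'[p [pF _ ->]].
      by have [] := AF p pF (y :: vals (rst G1 p)) _; rewrite //= eqxx;
        apply/subseq_vals/rst_subseq.
    by move=> [F' [/paths_nonempty[p' pF]]] _ /(_ _ pF)[p []].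
  have [||] := ref F (fun=> False) (fun=> True) wF fF; first by right.
    by move=> [F' [/paths_nonempty[p' pF]]] _ /(_ _ pF)[p []].
  move=> [F' [wF' fF' pF']]; exists F'; split=> // p' /pF'[p [pF _ ->]].
  by have [] := AF p pF (y :: vals (rst G2 p)) _; rewrite //= eqxx;
    apply/subseq_vals/rst_subseq.
- have [d Vd] := sys_size sS SG.
  have [A' PA' extA'] := P_ext (w.+1 ^ size G) d PA.
  have VA' := ultraI (sys_ultra sS SG) Vd (sys_P sS SG PA').
  have [F [wF fF pF]] := sys_forest w sS SG VA' stE.
  have [||y hy] := extA' [seq vals p | p <- paths F].
  + by rewrite size_map (size_paths wF).
  + by move=> _ /mapP[p /pF[/= ? ?] ->].
  by exists [:: y], y, F; split=> // p pF'; apply: hy; exact: map_f.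
have BD G V w E A : S (G, V) -> stable S E -> P A -> rho (D G w E A).
  by move=> SG stE PA; apply: Br; exists G, V, w, E, A.
exists rho.
  split=> // R G V w E A rR SG stE PA.
  have [v [Rv [y [F [vE wF fF pF]]]]] := ultra_nonempty U (ultraI U rR (BD _ _ w _ _ SG stE PA)).
  by exists v, F; split=> // p /pF; rewrite vE.
apply: (ultraS U) (BD _ _ 0 _ _ (sys_nil sS) (stableT sS) PT) => v [y [F [-> _ _ _]]].
by [].
Qed.

(** A size that is not closed has, over every system and for every [t], an
addable ultrafilter that does not divide within [t] steps: exactly what it
takes to repeat a label with [repeat_label].  A closed one provides a system
and a bound [t] beyond which nothing of that size survives. *)
Definition closed c := exists tau S t, [/\ system P S, below tau S &
  forall rho, addable P S rho -> rho [set v | size v = c] -> ~ nondividing Cons t rho].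

Definition tree_pattern d n (a : seq bool -> seq Omega) :=
  [/\ forall s, size s <= n -> size (a s) = d,
   forall Xs, (forall s, s \in Xs -> size s <= n) -> incomparable Xs ->
     Cons (flatten [seq a s | s <- Xs])
   & forall s s', size s' <= n -> prefix s s' -> s != s' -> ~ Cons (a s ++ a s')].

Section Step.
Variables (tau : nat) (S0 : set (seq name * set (set chain))) (b t T : nat).
Variables (Lab : set (set (set (seq Omega)))).
Hypothesis bS0 : below tau S0.
Hypothesis S0closed : forall rho, addable P S0 rho ->
  rho [set v | size v = b + b] -> ~ nondividing Cons t rho.
Hypothesis Lab_size : forall rho, Lab rho -> rho [set v | size v = b].
Hypothesis Lab_ND : forall rho, Lab rho -> nondividing Cons T rho.
Variables (S : set (seq name * set (set chain))) (rho : label Omega).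
Hypothesis runS : run P tau S0 Lab S.
Hypothesis Lrho : Lab rho.
Hypothesis repS : forall i, exists V, S ([:: (tau, (rho, i))], V).

Let sS : system P S. Proof. by case: runS. Qed.

Definition copy (x : name) := exists i, x = (tau, (rho, i)).

Lemma copy_push x V : copy x -> S ([:: x], V) -> push (@vals Omega name) V = rho.
Proof. by move=> [i ->] SV; have [_ _ _ _ h] := runS; have [] := h _ _ _ SV. Qed.

Lemma copy_size x G V : copy x -> S (G, V) -> x \in G ->
  V [set c | size (vals (rst [:: x] c)) = b].
Proof.
move=> cx SG; rewrite -sub1seq => xG; have Sx := sys_sub sS SG xG.
have := Lab_size Lrho; rewrite -(copy_push cx Sx).
by apply: ultraS (sys_ultra sS SG) _ _ _.
Qed.

Lemma copies m : exists G V, [/\ S (G, V), size G = m & forall x, x \in G -> copy x].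
Proof.
pose nm i : name := (tau, (rho, i)).
have [G [V [SG nG]]] : exists G V, S (G, V) /\ forall i, i < m -> nm i \in G.
  elim: m => [|m [G [V [SG nG]]]].
    by exists [::], (at_point [::]); split=> //; exact: sys_nil sS.
  have [V' Sm] := repS m; have [G' [V1 [SG' s1 s2]]] := sys_dir sS SG Sm.
  exists G', V1; split=> // i; rewrite ltnS leq_eqVlt => /orP[/eqP->|/nG iG].
    by rewrite -sub1seq.
  exact: (mem_subseq s1).
pose ns := [seq nm i | i <- iota 0 m].
have uns : uniq ns by rewrite map_inj_uniq ?iota_uniq // => i j [].
exists [seq x <- G | x \in ns], (push (rst [seq x <- G | x \in ns]) V).
split; first by apply: (sys_sub sS SG); exact: filter_subseq.
- have : perm_eq [seq x <- G | x \in ns] ns.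
    apply: uniq_perm => //; first by apply: filter_uniq; exact: (sys_uniq sS SG).
    move=> x; rewrite mem_filter; case: (boolP (x \in ns)) => //= /mapP[i].
    by rewrite mem_iota /= add0n => im ->; exact: nG.
  by move/perm_size->; rewrite size_map size_iota.
- by move=> x; rewrite mem_filter => /andP[/mapP[i _ ->] _]; exists i.
Qed.

(** The union of a node of one copy of [rho] and a node of another copy below it is
a block of size [b + b] that is addable to the old system: both copies are
above all old levels, so that a forest over the two copies and the old levels
has, below its first root and the first child of that root, a forest over the
old levels. *)
Lemma pair_addable x y V : copy x -> copy y -> S ([:: x; y], V) ->
  addable P S0 (push (@vals Omega name) V) /\
  push (@vals Omega name) V [set v | size v = b + b].
Proof.
move=> cx cy Sxy; have UV := sys_ultra sS Sxy; split; last first.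
  apply: (ultraS UV) (ultraI UV (sys_names sS Sxy)
    (ultraI UV (copy_size cx Sxy (mem_head _ _)) (copy_size cy Sxy _))); last first.
    by rewrite !inE eqxx orbT.
  have := sys_uniq sS Sxy; rewrite /= inE andbT => xy.
  move=> [|[x' u] [|[y' v] [|? ?]]] [//= [-> ->]].
  rewrite /rst /= !mem_seq1 !eqxx eq_sym (negPf xy) /vals /= !cats0 => -[su sv].
  by rewrite size_cat su sv.
split; first exact: ultra_push.
move=> R G V0 w E A rR S0G stE PA.
have [_ S0S lowS ordS _] := runS.
pose low (c : chain) := all (fun x : name => x.1 < tau) (names c).
pose E' : set (seq chain) := [set Y | E [seq c <- Y | low c] /\
  forall c, c \in Y -> A (vals c) /\ (names c = [:: x; y] -> R (vals c))].
have stE' : stable S E'.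
  split; first by split=> //; exact: stE.1.
  move=> Z [EZ AZ] G' V' SG' G'0; have UV' := sys_ultra sS SG'.
  have V1 : V' [set c | E [seq c <- c :: Z | low c]].
    have [lG'|lG'] := boolP (all (fun x : name => x.1 < tau) G').
      have := stE.2 _ EZ _ _ (lowS _ _ SG' lG') G'0.
      move/(ultraI UV' (sys_names sS SG')); apply: (ultraS UV') => c [/= nc].
      by rewrite /low nc lG'.
    apply: (ultraS UV') (sys_names sS SG') => c /= nc.
    by rewrite {1}/low nc (negPf lG').
  have V2 : V' [set c | names c = [:: x; y] -> R (vals c)].
    have [GE|GE] := eqVneq G' [:: x; y].
      rewrite GE in SG'; rewrite (sys_fun sS SG' Sxy).
      by apply: (ultraS UV) rR => c Rc _.
    apply: (ultraS UV') (sys_names sS SG') => c /= -> G'E.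
    by rewrite G'E eqxx in GE.
  apply: (ultraS UV') (ultraI UV' V1 (ultraI UV' (sys_P sS SG' PA) V2)).
  move=> c [/= E1 [E2 E3]]; split=> // c'; rewrite in_cons => /orP[/eqP->//|/AZ//].
have [H [VH [SH s1 s2]]] := sys_dir sS Sxy (S0S _ S0G).
have [H1 [H0 [HE tH1 lH0]]] := ordS _ _ SH.
have tx z : copy z -> z.1 = tau by move=> [i ->].
have sH1 : [seq z <- H | z.1 == tau] = H1.
  rewrite HE filter_cat (all_filterP tH1) -[RHS]cats0; congr cat.
  apply/eqP; rewrite -(negbK (_ == _)) -has_filter; apply/hasPn => z /(allP lH0).
  by rewrite ltn_neqAle => /andP[].
have sH0 : [seq z <- H | z.1 < tau] = H0.
  rewrite HE filter_cat (all_filterP lH0) -[RHS]cat0s; congr cat.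
  apply/eqP; rewrite -(negbK (_ == _)) -has_filter; apply/hasPn => z /(allP tH1).
  by move=> /eqP->; rewrite ltnn.
have sH : subseq [:: x, y & G] H.
  rewrite HE; apply: (@cat_subseq _ [:: x; y] G).
    by rewrite -sH1 subseq_filter /= (tx _ cx) (tx _ cy) eqxx.
  by rewrite -sH0 subseq_filter s2 andbT; exact: bS0 S0G.
have [F wF fF] := sys_good sS (sys_sub sS SH sH) w stE'.
have [T1 [wT1 fT1 _]] := first_tree wF.
have [T2 [wT2 fT2 pT2]] := first_tree wT1.
have {}fF Y : Y \in tfams x T1 -> E' Y by move/fT1; exact: fF.
case: T1 wT1 fT1 fT2 pT2 fF => u F1; case: T2 wT2 => v F2 wF2 _ _ fT pT fF.
have fd p d : p \in paths F2 -> subseq d p ->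
    forall c, c = [:: (x, u), (y, v) & d] -> A (vals c) /\ (names c = [:: x; y] -> R (vals c)).
  move=> pF dp c ->; have [|_ h] := fF [:: [:: (x, u), (y, v) & d]].
    apply/tfamsP; left; exists ((y, v) :: p); first exact: pT.
    by exists ((y, v) :: d); rewrite //= eqxx.
  by apply: h; exact: mem_head.
exists (u ++ v), F2; split=> //.
- have [p pF] := paths_nonempty wF2.
  have [_ /(_ (erefl _))] := fd p [::] pF (sub0seq _) _ (erefl _).
  by rewrite /vals /= cats0.
- move=> Y YF; have [] := fF Y.
    by apply/tfamsP; right; apply: fT; apply/tfamsP; right.
  move=> EY _; move: EY; rewrite (_ : [seq c <- Y | low c] = Y) //.
  apply/all_filterP/allP => c cY; have sc := names_fams YF cY.
  by apply/allP => z /(mem_subseq sc) zG; exact: (allP (bS0 S0G)).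
- by move=> p pF; have [] := fd p p pF (subseq_refl p) _ (erefl _); rewrite /vals /= catA.
Qed.

(** The stable set [E] expresses that up to [T] generic blocks of copies are
consistent together and that [t] generic pairs of comparable copies are
inconsistent.  In a wide forest all of whose families are in [E], take [t]
trees side by side and attach to the string [s] the union of their nodes
at [s].  An antichain of strings involves at most [t * 2 ^ n] blocks, and two
comparable strings involve [t] pairs, one in each tree. *)
Lemma step_tree n : t * 2 ^ n <= T -> exists a, tree_pattern (t * b) n a.
Proof.
move=> tT; have [G0 [V0 [SG0 sG0 cG0]]] := copies n.+1.
case: G0 SG0 sG0 cG0 => [//|r G] SG [sG] cG.
have Urho : ultra rho.
  have cr := cG r (mem_head _ _).
  have Sr : S ([:: r], push (rst [:: r]) V0).
    by apply: (sys_sub sS SG); rewrite sub1seq mem_head.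
  by rewrite -(copy_push cr Sr); exact: ultra_push (sys_ultra sS Sr).
pose E : set (seq chain) := [set Y |
  [/\ (forall c, c \in Y -> exists2 x, copy x & names c = [:: x]) -> size Y <= T ->
      often rho (T - size Y) (fun Z => Cons (flatten Z)) [seq vals c | c <- Y],
   forall x y V, copy x -> copy y -> S ([:: x; y], V) ->
      (forall c, c \in Y -> names c = [:: x; y]) -> size Y <= t ->
      often (push (@vals Omega name) V) (t - size Y) (fun Z => ~ Cons (flatten Z))
        [seq vals c | c <- Y]
   & forall c x, c \in Y -> copy x -> names c = [:: x] -> size (vals c) = b]].
have stE : stable S E.
  split.
    split=> //.
    - by move=> _ _; rewrite subn0; exact: Lab_ND Lrho.
    - move=> x y V cx cy Sxy _ _; rewrite subn0; apply: often_not.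
        exact: ultra_push (sys_ultra sS Sxy).
      by have [add sz] := pair_addable cx cy Sxy; exact: S0closed.
  move=> Z [E1 E2 E3] G' V' SG' G'0; have UV' := sys_ultra sS SG'.
  have V1 : V' [set c | (forall c', c' \in c :: Z -> exists2 x, copy x & names c' = [:: x]) ->
      size (c :: Z) <= T -> often rho (T - size (c :: Z)) (fun Z => Cons (flatten Z))
         [seq vals c' | c' <- c :: Z]].
    have [[hZ sZ]|nZ] := pselect ((forall c, c \in Z -> exists2 x, copy x & names c = [:: x])
       /\ size Z < T); last first.
      apply: (ultraS UV') (ultraT UV') => c _ hc sc; exfalso; apply: nZ; split=> // c' c'Z.
      by apply: hc; rewrite in_cons c'Z orbT.
    have := E1 hZ (ltnW sZ); rewrite -(subnSK sZ) => /= orho.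
    have [[x cx G'x]|nx] := pselect (exists2 x, copy x & G' = [:: x]).
      rewrite G'x in SG'; rewrite -(copy_push cx SG') in orho.
      by apply: (ultraS UV') orho => c oc _ _; rewrite -(copy_push cx SG').
    apply: (ultraS UV') (sys_names sS SG') => c /= nc hc _; exfalso; apply: nx.
    by have [x cx ncx] := hc c (mem_head _ _); exists x => //; rewrite -nc.
  have V2 : V' [set c | forall x y V, copy x -> copy y -> S ([:: x; y], V) ->
      (forall c', c' \in c :: Z -> names c' = [:: x; y]) -> size (c :: Z) <= t ->
      often (push (@vals Omega name) V) (t - size (c :: Z)) (fun Z => ~ Cons (flatten Z))
        [seq vals c' | c' <- c :: Z]].
    have [[x [y [cx cy G'E]]]|nx] :=
        pselect (exists x y, [/\ copy x, copy y & G' = [:: x; y]]); last first.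
      apply: (ultraS UV') (sys_names sS SG') => c /= nc x y V cx cy _ hc.
      by exfalso; apply: nx; exists x, y; rewrite -nc (hc c (mem_head _ _)).
    rewrite G'E in SG'.
    have [[hZ sZ]|nZ] := pselect ((forall c, c \in Z -> names c = [:: x; y])
       /\ size Z < t); last first.
      apply: (ultraS UV') (sys_names sS SG') => c /= nc x' y' V _ _ _ hc sc.
      exfalso; apply: nZ; split=> // c' c'Z; rewrite -nc (hc c (mem_head _ _)).
      by apply: hc; rewrite in_cons c'Z orbT.
    have := E2 x y V' cx cy SG' hZ (ltnW sZ); rewrite -(subnSK sZ) => /= orho.
    apply: (ultraS UV') (ultraI UV' (sys_names sS SG') orho) => c [/= nc oc] x' y' V _ _ SV hc _.
    have xy : [:: x'; y'] = [:: x; y] by rewrite -nc (hc c (mem_head _ _)).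
    by rewrite xy in SV; rewrite (sys_fun sS SV SG').
  have V3 : V' [set c | forall x, copy x -> names c = [:: x] -> size (vals c) = b].
    have [[x cx G'x]|nx] := pselect (exists2 x, copy x & G' = [:: x]).
      rewrite G'x in SG'; have rb := Lab_size Lrho; rewrite -(copy_push cx SG') in rb.
      by apply: (ultraS UV') rb => c /= cb.
    apply: (ultraS UV') (sys_names sS SG') => c /= nc x cx ncx; exfalso; apply: nx.
    by exists x => //; rewrite -nc.
  apply: (ultraS UV') (ultraI UV' V1 (ultraI UV' V2 V3)) => c [h1 [h2 h3]].
  split=> // c' x; rewrite in_cons => /orP[/eqP->|c'Z]; first exact: h3.
  exact: E3 c'Z.
have [F wF fF] := sys_good sS SG t.+1 stE.
have wF' := wF; rewrite /= in wF'; case/andP: wF' => /eqP sF aF.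
have sFt : size (take t F) = t by rewrite size_takel // sF ltnW.
have {}aF : all (fun T => wide t.+2 T.2) (take t F).
  by move: aF; rewrite -{1}(cat_take_drop t F) all_cat => /andP[].
have {}fF Y : Y \in @fams _ _ (r :: G) (take t F) -> E Y.
  by move=> YF; apply: fF; have [+ _] := @forest_take _ _ G r F t; apply.
pose a s := flatten [seq node C s | C <- take t F].
have C0 : seq Omega * forest Omega (size G) by case: (F) sF => [//|C _ _]; exact: C.
have ant Xs : (forall s, s \in Xs -> size s <= n) -> incomparable Xs ->
    exists Ys, [/\ E (flatten Ys), size Ys = t,
      forall Y, Y \in Ys -> size Y <= 2 ^ n /\
        forall c, c \in Y -> exists2 x, copy x & names c = [:: x]
    & forall k, k < t -> forall s, s \in Xs ->
        node (nth C0 (take t F) k) s \in [seq vals c | c <- nth [::] Ys k]].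
  move=> sX iX.
  have [|Ys [YsF sYs QYs]] := @fams_columns _ _ r G t.+2 (take t F) (fun C Y =>
      [/\ size Y <= 2 ^ n, forall c, c \in Y -> exists2 x, copy x & names c = [:: x]
       & forall s, s \in Xs -> node C s \in [seq vals c | c <- Y]]) _ aF.
    move=> C wC; have [|Y [YC sY nY vY]] := @fam_antichain _ _ t r G C Xs wC _ iX.
      by move=> s; rewrite sG; exact: sX.
    exists Y => //; split; rewrite -?sG //.
    by move=> c /nY[x xG ->]; exists x => //; exact: cG.
  rewrite sFt in sYs QYs; exists Ys; split=> //; first exact: fF.
    move=> Y /(nthP [::])[k]; rewrite sYs => kt <-.
    by have [] := QYs C0 k kt.
  by move=> k kt; have [] := QYs C0 k kt.
have nodeb s k : size s <= n -> k < t -> size (node (nth C0 (take t F) k) s) = b.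
  move=> sn kt; have [||Ys [[_ _ E3] sYs nYs vYs]] := ant [:: s].
  - by move=> s'; rewrite inE => /eqP->.
  - by move=> s1 s2; rewrite !inE => /eqP-> /eqP->; rewrite eqxx.
  have /mapP[c cY ->] := vYs k kt s (mem_head _ _).
  have kY : nth [::] Ys k \in Ys by rewrite mem_nth ?sYs.
  have [_ /(_ _ cY)[x cx nc]] := nYs _ kY; apply: E3 cx nc.
  by apply/flattenP; exists (nth [::] Ys k).
have mem_a z s : z \in a s -> exists2 k, k < t & z \in node (nth C0 (take t F) k) s.
  by move/(mem_flatten_nth C0); rewrite sFt.
exists a; split.
- move=> s sn; rewrite -{1}sFt; apply: (size_flatten_nth (x0 := C0)) => k.
  by rewrite sFt; exact: nodeb.
- move=> Xs sX iX; have [Ys [[E1 _ _] sYs nYs vYs]] := ant Xs sX iX.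
  have /(often_Cons Cons_sub Urho) : often rho (T - size (flatten Ys))
      (fun Z => Cons (flatten Z)) [seq vals c | c <- flatten Ys].
    apply: E1; first by move=> c /flattenP[Y /nYs[_ h] /h].
    apply: leq_trans tT; rewrite -sYs; apply: size_flatten_le => Y /nYs[].
    by [].
  apply: Cons_sub => z /flatten_mapP[s sXs /mem_a[k kt zk]].
  have /mapP[c cY nE] := vYs k kt s sXs.
  apply/flattenP; exists (vals c); last by rewrite -nE.
  apply: map_f; apply/flattenP; exists (nth [::] Ys k) => //.
  by rewrite mem_nth ?sYs.
- move=> s s' sn ps ss.
  pose x := nth r (r :: G) (size s); pose y := nth r (r :: G) (size s').
  have sub_xy : subseq [:: x; y] (r :: G).
    have [C1 [wC1 _ _]] := first_tree wF.
    by have [] := @fam_pair _ _ t r G C1 s s' wC1; rewrite ?sG.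
  have [cx cy] : copy x /\ copy y.
    by split; apply: cG; apply: (mem_subseq sub_xy); rewrite !inE eqxx ?orbT.
  have [|Ys [YsF sYs QYs]] := @fams_columns _ _ r G t.+2 (take t F) (fun C Y =>
      Y = [:: [:: (x, node C s); (y, node C s')]]) _ aF.
    move=> C wC; exists [:: [:: (x, node C s); (y, node C s')]] => //.
    by have [] := @fam_pair _ _ t r G C s s' wC; rewrite ?sG.
  rewrite sFt in sYs QYs.
  have inYs c : c \in flatten Ys -> exists2 k, k < t &
      c = [:: (x, node (nth C0 (take t F) k) s); (y, node (nth C0 (take t F) k) s')].
    case/flattenP=> Y /(nthP [::])[k]; rewrite sYs => kt <-.
    by rewrite (QYs C0 k kt) inE => /eqP->; exists k.
  have [_ E2 _] := fF _ YsF.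
  have st : size (flatten Ys) = t.
    rewrite -[RHS]muln1 -sYs -[X in flatten X]map_id.
    by apply: (size_flatten_nth (x0 := [::])) => k; rewrite sYs => kt; rewrite (QYs C0 k kt).
  have := E2 x y _ cx cy (sys_sub sS SG sub_xy).
  rewrite st subnn /= => h Cass; apply: h => //.
    by move=> c /inYs[k _ ->].
  apply: Cons_sub Cass => z /flatten_mapP[c /inYs[k kt ->]].
  rewrite /vals /= cats0 !mem_cat => zk; apply/orP.
  have in_a s1 : z \in node (nth C0 (take t F) k) s1 -> z \in a s1.
    by apply: (@flatten_nth_mem _ _ _ C0); rewrite sFt.
  by case/orP: zk => /in_a; [left|right].
Qed.
End Step.

Hypothesis P_nil : forall A, P A -> A [::].
Hypothesis P_div : exists k, P [set c | size c = k -> ~ Cons c].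
Hypothesis coheir_nondividing : forall rho, ultra rho -> (forall A, P A -> rho A) ->
  rho [set v | size v = 1] -> forall T, nondividing Cons T rho.

Lemma not_closed1 : ~ closed 1.
Proof.
move=> [tau [S [t [sS _ clS]]]]; have [rho add r1] := add_one sS.
apply: (clS rho add r1); apply: coheir_nondividing => //; first by case: add.
by move=> A; exact: (addable_P sS add).
Qed.

(** Over the system with no levels: a block of size [2 ^ k] has more than [k]
points, and [k] points of a generic block are already inconsistent. *)
Lemma closed_large : exists i, closed (2 ^ i).
Proof.
have [k Pk] := P_div; exists k, 0, [set ([::], at_point [::])], 1; split.
- split.
  + by [].
  + by move=> G V [-> _].
  + by move=> G V [_ ->]; exact: ultra_at_point.
  + by move=> G V [-> ->].
  + by move=> G V A [_ ->] PA; exact: P_nil.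
  + by move=> G V [_ ->]; exists 0.
  + by move=> G V G' [-> ->]; rewrite subseq0 => /eqP->.
  + by move=> G V V' [_ ->] [_ ->].
  + by move=> G1 V1 G2 V2 [-> _] [-> _]; exists [::], (at_point [::]).
  + by move=> G V [-> _] w E [E0 _]; exists tt => // Y; rewrite inE => /eqP->.
- by move=> G V [-> _].
move=> rho add sz ND; have U : ultra rho by case: add.
have rR : rho [set v | Cons (flatten [:: v]) /\ size v = 2 ^ k] := ultraI U ND sz.
have stT : stable ([set ([::], at_point [::])] : set (seq name * set (set chain))) setT.
  by split=> // Z _ G V [-> _].
have [v [F [[Cv sv] _ _ pF]]] :=
  add.2 _ [::] (at_point [::]) 0 _ _ rR (erefl _) stT (P_sub Pk).
rewrite /= cats0 in Cv.
apply: (pF [::] (mem_head _ _) (take k v)).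
- by rewrite /vals /= cats0; exact: take_subseq.
- by rewrite size_takel // sv ltnW // ltn_expl.
by apply: Cons_sub Cv => x /mem_take.
Qed.

(** The number [i] is such that blocks of size [2 ^ i] can be non-dividing over
every system while blocks of twice that size all divide over some system. *)
Theorem antichain_trees : exists d, forall n, exists a, tree_pattern d n a.
Proof.
have [i [nci ci]] : exists i, ~ closed (2 ^ i) /\ closed (2 ^ i + 2 ^ i).
  have [i ci] := closed_large; elim: i ci => [|i IH] ci; first by case: not_closed1.
  have [/IH//|nci] := pselect (closed (2 ^ i)).
  by exists i; split=> //; rewrite addnn -mul2n -expnS.
have [tau [S0 [t [sS0 bS0 clS0]]]] := ci.
exists (t * 2 ^ i) => n; pose T := t * 2 ^ n.
pose Lab : set (set (set (seq Omega))) :=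
  [set rho | rho [set v | size v = 2 ^ i] /\ nondividing Cons T rho].
have [||S [rho [runS Lrho repS]]] := repeat_label PT PI P_sub (Lab := Lab) sS0 bS0.
- by move=> rho [sz _]; exists (2 ^ i).
- move=> S tau' sS bS; apply: contrapT => nrho; apply: nci.
  exists tau', S, T; split=> // rho add sz ND; apply: nrho.
  by exists rho.
by apply: (step_tree bS0 clS0 _ _ runS Lrho repS (leqnn _)) => r [].
Qed.
End Combinatorics.

(** * Definable relations *)

Definition upd (V U : Type) (v : V -> U) (x : V) (d : U) : V -> U :=
  fun y => if `[< y = x >] then d else v y.

Definition copair (V W U : Type) (v : V -> U) (w : W -> U) (z : V + W) : U :=
  match z with inl x => v x | inr y => w y end.

Definition oext (V U : Type) (v : V -> U) (d : U) (o : option V) : U :=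
  if o is Some x then v x else d.

Section Syntax.
Variable L : language.

Lemma eval_map U (S : structure L U) V W (g : V -> W) (v : W -> U) (t : term L V) :
  eval S v (term_map g t) = eval S (v \o g) t.
Proof. by elim: t => //= f args IH; congr fint; apply/funext => i. Qed.

Lemma sat_map U (S : structure L U) V (phi : form L V) :
  forall W (g : V -> W) (v : W -> U), sat S v (form_map g phi) <-> sat S (v \o g) phi.
Proof.
elim: phi => {V} [V|V t u|V r args|V phi IH psi IH'|V phi IH] W g v //=.
- by rewrite !eval_map.
- by rewrite (_ : (fun i => _) = (fun i => eval S (v \o g) (args i))) //;
    apply/funext => i; rewrite eval_map.
- by rewrite IH IH'.
- suff E d : (fun o => if o is Some x then v x else d) \o omap g =
       (fun o => if o is Some x then (v \o g) x else d).
    by split=> h d; have := h d; rewrite ?IH E.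
  by apply/funext => -[].
Qed.

Lemma eval_support V (t : term L V) : exists s : seq {classic V},
  forall U (S : structure L U) v v', (forall x, x \in s -> v x = v' x) ->
    eval S v t = eval S v' t.
Proof.
elim: t => [x|f args IH].
  by exists [:: x] => U S v v' /(_ x); apply; rewrite mem_head.
have [s sP] := choice IH; exists (flatten [seq s i | i <- enum 'I_(farity f)]).
move=> U S v v' vv /=; congr fint; apply/funext => i; apply: sP => x xs; apply: vv.
by apply/flatten_mapP; exists i; rewrite ?mem_enum.
Qed.

Lemma sat_support V (phi : form L V) : exists s : seq {classic V},
  forall U (S : structure L U) v v', (forall x, x \in s -> v x = v' x) ->
    sat S v phi <-> sat S v' phi.
Proof.
elim: phi => {V} [V|V t u|V r args|V phi [s sP] psi [s' sP']|V phi [s sP]].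
- by exists [::].
- have [s sP] := eval_support t; have [s' sP'] := eval_support u.
  exists (s ++ s') => U S v v' vv /=; rewrite (sP U S v v') ?(sP' U S v v') //.
    by move=> x xs; apply: vv; rewrite mem_cat xs orbT.
  by move=> x xs; apply: vv; rewrite mem_cat xs.
- have [s sP] := choice (fun i => eval_support (args i)).
  exists (flatten [seq s i | i <- enum 'I_(rarity r)]) => U S v v' vv /=.
  rewrite (_ : (fun i => _) = (fun i => eval S v' (args i))) //.
  apply/funext => i; apply: sP => x xs; apply: vv.
  by apply/flatten_mapP; exists i; rewrite ?mem_enum.
- exists (s ++ s') => U S v v' vv /=; rewrite (sP U S v v') ?(sP' U S v v') //.
    by move=> x xs; apply: vv; rewrite mem_cat xs orbT.
  by move=> x xs; apply: vv; rewrite mem_cat xs.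
- exists (flatten [seq (if o is Some x then [:: (x : {classic V})] else [::])
     | o : {classic option V} <- s]) => U S v v' vv /=.
  have E d : sat S (fun o => if o is Some x then v x else d) phi <->
             sat S (fun o => if o is Some x then v' x else d) phi.
    apply: sP => -[x|//] xs; apply: vv.
    by apply/flatten_mapP; exists (Some x : {classic option V}); rewrite //= mem_head.
  by split=> h d; apply/E.
Qed.
End Syntax.

Section Definable.
Variables (L : language) (U : Type) (S : structure L U) (M : set U).

Definition params V (v : V -> U) (z : V + M) : U :=
  match z with inl x => v x | inr m => val m end.

(** Definability is stated for predicates on valuations rather than for formulas,
so that formulas never have to be written out. *)
Definition dfn V (D : (V -> U) -> Prop) : Prop :=
  exists psi : form L (V + M), forall v, D v <-> sat S (params v) psi.

Implicit Types V W : Type.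

Lemma dfn_ext V (D D' : (V -> U) -> Prop) : (forall v, D v <-> D' v) -> dfn D -> dfn D'.
Proof. by move=> DD [psi psiP]; exists psi => v; rewrite -DD. Qed.

Lemma dfn_imp V (D D' : (V -> U) -> Prop) : dfn D -> dfn D' -> dfn (fun v => D v -> D' v).
Proof.
move=> [psi psiP] [psi' psiP']; exists (Imp psi psi') => v /=.
by rewrite -psiP -psiP'.
Qed.

Lemma dfn_false V : dfn (fun _ : V -> U => False).
Proof. by exists Bot. Qed.

Lemma dfn_not V (D : (V -> U) -> Prop) : dfn D -> dfn (fun v => ~ D v).
Proof. by move=> h; exact: (dfn_imp h (dfn_false V)). Qed.

Lemma dfn_and V (D D' : (V -> U) -> Prop) : dfn D -> dfn D' -> dfn (fun v => D v /\ D' v).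
Proof.
move=> h h'; apply: (@dfn_ext _ (fun v => ~ (D v -> ~ D' v))).
  move=> v; split=> [h0|[Dv D'v] h0]; last exact: h0.
  by split; apply: contrapT => n; apply: h0 => Dv //; case: n.
exact: (dfn_not (dfn_imp h (dfn_not h'))).
Qed.

Lemma dfn_or V (D D' : (V -> U) -> Prop) : dfn D -> dfn D' -> dfn (fun v => D v \/ D' v).
Proof.
move=> h h'; apply: (@dfn_ext _ (fun v => ~ D v -> D' v)); last first.
  exact: (dfn_imp (dfn_not h) h').
move=> v; split=> [h0|[//|//]]; have [|/h0] := pselect (D v); by [left|right].
Qed.

Lemma dfn_true V : dfn (fun _ : V -> U => True).
Proof. by apply: (dfn_ext _ (dfn_not (dfn_false V))) => v; split=> // _ []. Qed.

Lemma dfn_subst V W (g : V -> W + M) (D : (V -> U) -> Prop) :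
  dfn D -> dfn (fun w : W -> U => D (params w \o g)).
Proof.
move=> [psi psiP]; pose g' (z : V + M) := match z with inl x => g x | inr m => inr m end.
exists (form_map g' psi) => w; rewrite psiP sat_map.
by rewrite (_ : params _ = params w \o g') //; apply/funext => -[].
Qed.

Lemma dfn_reindex V W (g : V -> W) (D : (V -> U) -> Prop) :
  dfn D -> dfn (fun w : W -> U => D (w \o g)).
Proof. by move=> h; exact: (@dfn_subst _ _ (fun x => inl (g x))). Qed.

Lemma dfn_all1 V (D : (option V -> U) -> Prop) :
  dfn D -> dfn (fun v => forall d, D (oext v d)).
Proof.
move=> [psi psiP].
pose g (z : option V + M) : option (V + M) :=
  match z with inl (Some x) => Some (inl x) | inl None => None | inr m => Some (inr m) end.
exists (All (form_map g psi)) => v /=.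
have E d : params (oext v d) = (fun o => if o is Some x then params v x else d) \o g.
  by apply/funext => -[[]|].
by split=> h d; move: (h d); rewrite sat_map psiP E.
Qed.

Lemma dfn_upd V (D : (V -> U) -> Prop) x : dfn D -> dfn (fun v => exists d, D (upd v x d)).
Proof.
move=> hD; pose g (y : V) := if `[< y = x >] then None else Some y.
apply: (@dfn_ext _ (fun v => ~ forall d, ~ D (oext v d \o g))).
  have E v d : oext v d \o g = upd v x d.
    by apply/funext => y; rewrite /g /upd /=; case: asboolP.
  move=> v; split=> [/existsNP[d /contrapT]|[d Dd] /(_ d)]; rewrite E //.
  by exists d.
exact: (dfn_not (dfn_all1 (dfn_not (dfn_reindex g hD)))).
Qed.

Definition agree_off V (s : seq {classic V}) (v v' : V -> U) :=
  forall x, x \notin s -> v x = v' x.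

Lemma dfn_list V (s : seq {classic V}) (D : (V -> U) -> Prop) :
  dfn D -> dfn (fun v => exists v', agree_off s v v' /\ D v').
Proof.
elim: s => [|x s IH] hD.
  apply: dfn_ext hD => v; split=> [Dv|[v' [vv Dv']]]; first by exists v.
  by rewrite (_ : v = v') //; apply/funext => y; exact: vv.
apply: dfn_ext (dfn_upd x (IH hD)) => v; split=> [[d [v' [vv Dv']]]|[v' [vv Dv']]].
  exists v'; split=> // y; rewrite in_cons negb_or => /andP[/eqP yx /vv <-].
  by rewrite /upd; case: asboolP.
exists (v' x), v'; split=> // y ys; rewrite /upd; case: asboolP => [->//|yx].
by apply: vv; rewrite in_cons negb_or ys andbT; apply/eqP.
Qed.

Lemma dfn_support V (D : (V -> U) -> Prop) : dfn D ->
  exists s : seq {classic V}, forall v v', (forall x, x \in s -> v x = v' x) -> D v <-> D v'.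
Proof.
move=> [psi psiP]; have [s sP] := sat_support psi.
exists (flatten [seq (if z is inl x then [:: (x : {classic V})] else [::])
     | z : {classic V + M} <- s]) => v v' vv; rewrite !psiP; apply: sP => -[x|//] xs /=.
by apply: vv; apply/flatten_mapP; exists (inl x : {classic V + M}); rewrite //= mem_head.
Qed.

Section Exists.
Variable m0 : M.

(** The quantifier is over a possibly infinite tuple; only the finitely many
variables in the support of the formula matter, and the others receive the
value [m0]. *)
Lemma dfn_exists V W (D : (V + W -> U) -> Prop) :
  dfn D -> dfn (fun v => exists w, D (copair v w)).
Proof.
move=> hD; have [s sP] := dfn_support hD.
pose sW : seq {classic V + W} := [seq z <- s | if z is inr _ then true else false].
pose g (z : V + W) : V + M := match z with inl x => inl x | inr _ => inr m0 end.
apply: dfn_ext (dfn_subst g (dfn_list sW hD)) => v; split.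
  move=> [u [vu Du]]; exists (fun y => u (inr y)); move: Du; apply: iffLR; apply: sP.
  move=> [x|//] _ /=; rewrite -vu //; apply/negP; rewrite mem_filter => /andP[]//.
move=> [w Dw].
pose u (z : V + W) := if (z : {classic V + W}) \in sW then copair v w z else params v (g z).
exists u; split; first by move=> z zs; rewrite /u (negPf zs).
move: Dw; apply: iffLR; apply: sP => z zs; rewrite /u.
case: ifP => //; rewrite mem_filter zs andbT; by case: (z).
Qed.

Lemma dfn_forall V W (D : (V + W -> U) -> Prop) :
  dfn D -> dfn (fun v => forall w, D (copair v w)).
Proof.
move=> hD; apply: (@dfn_ext _ (fun v => ~ exists w, ~ D (copair v w))).
  by move=> v; split=> [h w|h [w]//]; apply: contrapT => nD; apply: h; exists w.
exact: (dfn_not (dfn_exists (dfn_not hD))).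
Qed.
End Exists.

Lemma dfn_conj V (T : eqType) (s : seq T) (D : T -> (V -> U) -> Prop) :
  (forall i, i \in s -> dfn (D i)) -> dfn (fun v => forall i, i \in s -> D i v).
Proof.
elim: s => [|i s IH] h; first by apply: dfn_ext (dfn_true V).
have hi := h i (mem_head _ _); have hs : forall j, j \in s -> dfn (D j).
  by move=> j js; apply: h; rewrite in_cons js orbT.
apply: dfn_ext (dfn_and hi (IH hs)) => v; split=> [[Di Ds] j|Ds].
  by rewrite in_cons => /orP[/eqP->//|/Ds].
by split=> [|j js]; apply: Ds; rewrite in_cons ?eqxx ?js ?orbT.
Qed.

(** ** Elementary submodels *)

Section Elementary.
Hypothesis hMS : elementary_submodel S M.

Lemma elementary_any : exists N : structure L M,
  forall V (phi : form L V) (v : V -> M), inhabited M ->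
  sat N v phi <-> sat S (fun x => val (v x)) phi.
Proof.
have [N NS] := hMS; exists N => V phi v [m0].
have [s sP] := sat_support phi.
pose g (x : V) : 'I_(size s).+1 := inord (index (x : {classic V}) s).
pose v' (i : 'I_(size s).+1) : M := nth m0 [seq v x | x <- s] i.
have gv x : (x : {classic V}) \in s -> v' (g x) = v x.
  move=> xs; rewrite /v' /g inordK; last by rewrite ltnS index_size.
  by rewrite (nth_map x) ?index_mem // nth_index.
have -> : sat N v phi <-> sat N v' (form_map g phi).
  by rewrite sat_map; apply: sP => x xs /=; rewrite gv.
by rewrite NS sat_map; apply: sP => x xs /=; rewrite gv.
Qed.
End Elementary.
End Definable.

Section Tarski.
Variables (L : language) (U : Type) (S : structure L U) (M : set U).
Hypothesis hMS : elementary_submodel S M.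
Hypothesis U0 : inhabited U.

Lemma submodel_inhabited : inhabited M.
Proof.
have [N NS] := hMS; apply: contrapT => M0; have [u] := U0.
have v : 'I_0 -> M by case.
have [h _] := NS 0 (All Bot) v; apply: (h _ u) => m /=.
by apply: M0.
Qed.

Lemma tarski1 V (D : (option V -> U) -> Prop) (v : V -> M) : dfn S M D ->
  (exists d, D (oext (fun x => val (v x)) d)) ->
  exists m : M, D (oext (fun x => val (v x)) (val m)).
Proof.
move=> [psi psiP] [d Dd].
have [N NP] := elementary_any hMS; have M0 := submodel_inhabited.
pose g (z : option V + M) : option (V + M) :=
  match z with inl (Some x) => Some (inl x) | inl None => None | inr m => Some (inr m) end.
pose v' (z : V + M) : M := match z with inl x => v x | inr m => m end.
have E u : params (oext (fun x => val (v x)) u) =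
    (fun o => if o is Some x then val (v' x) else u) \o g.
  by apply/funext => -[[]|].
have := NP _ (All (Not (form_map g psi))) v' M0.
move=> [NS _]; apply: contrapT => nm.
suff /NS /= /(_ d) : sat N v' (All (Not (form_map g psi))).
  by rewrite sat_map -E -psiP; apply.
move=> m /=.
have := NP _ (form_map g psi) (fun o => if o is Some x then v' x else m) M0.
move=> -> ; rewrite sat_map => h; apply: nm; exists m; rewrite psiP E.
move: h; apply: iffLR.
rewrite (_ : (fun x => val _) = (fun o => if o is Some x then val (v' x) else val m)) //.
by apply/funext => -[].
Qed.

(** The Tarski-Vaught test for infinite tuples: the variables of the support are
moved into [M] one at a time. *)
Lemma tarski V (D : (V -> U) -> Prop) : dfn S M D -> (exists v, D v) ->
  exists v : V -> M, D (fun x => val (v x)).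
Proof.
move=> hD [v Dv]; have [s sP] := dfn_support hD; have [m0] := submodel_inhabited.
have main (t : seq {classic V}) (w : V -> M) :
    (exists v', agree_off t (fun x => val (w x)) v' /\ D v') ->
    exists w' : V -> M, D (fun x => val (w' x)).
  elim: t w => [|x t IH] w [v' [wv Dv']].
    exists w; rewrite (_ : (fun x => _) = v') //; apply/funext => x.
    exact: wv.
  pose E (u : V -> U) := exists v', agree_off t u v' /\ D v'.
  have hE : dfn S M E := dfn_list t hD.
  pose g (y : V) := if `[< y = x >] then None else Some y.
  have gE (u : V -> U) d : oext u d \o g = upd u x d.
    by apply/funext => y; rewrite /g /upd /=; case: asboolP.
  have ex_d : exists d, E (oext (fun y => val (w y)) d \o g).
    exists (v' x); rewrite gE; exists v'; split=> // y yt; rewrite /upd; case: asboolP => [->//|yx].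
    by apply: wv; rewrite in_cons negb_or yt andbT; apply/eqP.
  have [m] := tarski1 (dfn_reindex g hE) ex_d.
  rewrite gE => Em; apply: (IH (upd w x m)).
  by move: Em; congr E; apply/funext => y; rewrite /upd; case: asboolP.
apply: (main s (fun=> m0)).
exists (fun x => if (x : {classic V}) \in s then v x else val m0); split.
  by move=> x xs; rewrite (negPf xs).
by move: Dv; apply: iffLR; apply: sP => x ->.
Qed.
End Tarski.

(** * Saturation *)

Section Saturation.
Variables (L : language) (K U : Type) (T : set (sentence L)) (S : structure L U).
Hypothesis hS : monster K T S.

Lemma small_le (A B : Type) (X : set A) (Y : set B) :
  small K Y -> X #<= Y -> small K X.
Proof.
move=> [YK KY] XY; split; first exact: card_le_trans XY YK.
by move=> KX; apply: KY; exact: card_le_trans KX XY.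
Qed.

Lemma small_count (W : countType) : small K [set: W].
Proof.
apply: small_le (monster_nat hS) _; apply/pcard_leP.
by apply/injfunPex => /=; exists pickle => // x y _ _ /(pcan_inj pickleK).
Qed.

Lemma holds_inst V J (phi : form L (V + J)) (a : J -> U) (v : V -> U) :
  holds S v (inst phi a) <-> sat S (copair v a) phi.
Proof.
rewrite /holds /inst sat_map.
by rewrite (_ : _ \o _ = copair v a) //; apply/funext => -[].
Qed.

Lemma term_map_comp V W X (g : V -> W) (h : W -> X) (t : term L V) :
  term_map h (term_map g t) = term_map (h \o g) t.
Proof. by elim: t => //= f args IH; congr App; apply/funext. Qed.

Lemma form_map_comp V (phi : form L V) : forall W X (g : V -> W) (h : W -> X),
  form_map h (form_map g phi) = form_map (h \o g) phi.
Proof.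
elim: phi => {V} [V|V t u|V r args|V phi IH psi IH'|V phi IH] W X g h //=.
- by rewrite !term_map_comp.
- by congr Rel; apply/funext => i; rewrite term_map_comp.
- by rewrite IH IH'.
- by rewrite IH; congr (All (form_map _ _)); apply/funext => -[].
Qed.

Lemma overP V (A : set U) (phi : pform L U V) : Defs.over A phi -> dfn S A (fun v => holds S v phi).
Proof.
move=> [psi ->]; exists psi => v; rewrite holds_inst.
by rewrite (_ : copair _ _ = params v) //; apply/funext => -[].
Qed.

Lemma dfn_over V (A : set U) (D : (V -> U) -> Prop) : dfn S A D ->
  exists2 phi, Defs.over A phi & forall v, holds S v phi <-> D v.
Proof.
move=> [psi psiP]; exists (inst psi (fun u : A => val u)); first by exists psi.
move=> v; rewrite holds_inst psiP.
by rewrite (_ : copair _ _ = params v) //; apply/funext => -[].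
Qed.

Lemma compactness V (A : set U) (F : set ((V -> U) -> Prop)) :
  small K A -> small K [set: V] -> (forall D, F D -> dfn S A D) ->
  (forall s : seq {classic (V -> U) -> Prop}, (forall D, D \in s -> F D) ->
     exists v, forall D, D \in s -> (D : (V -> U) -> Prop) v) ->
  exists v, forall D, F D -> D v.
Proof.
move=> sA sV hF finF.
pose Gamma : set (pform L U V) :=
  [set phi | Defs.over A phi /\ F (fun v : V -> U => holds S v phi)].
have [||v vG] := monster_saturated hS sA sV (Gamma := Gamma).
- by move=> phi [].
- move=> G0 /(@finite_seqP {classic pform L U V})[s sE] G0G.
  pose h (phi : {classic pform L U V}) : {classic (V -> U) -> Prop} :=
    fun v : V -> U => holds S v phi.
  have [|v vs] := finF (map h s).
    by move=> _ /mapP[phi phis ->]; apply: (G0G phi _).2; rewrite sE.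
  exists v; split=> // phi; rewrite sE => phis.
  exact: (vs _ (map_f h phis)).
exists v => D FD; have [phi ophi phiD] := dfn_over (hF D FD).
have E : (fun v : V -> U => holds S v phi) = D by apply/funext => w; apply/propext.
by rewrite -E; apply: vG; split=> //; rewrite E.
Qed.
End Saturation.

(** * Invariant types and Morley sequences *)

Section Invariant.
Variables (L : language) (U : Type) (S : structure L U) (M : set U) (m0 : M).

Lemma dfn_inst V X (E : (V + X -> U) -> Prop) : dfn S M E ->
  exists k (theta : form L (V + 'I_k)) (h : 'I_k -> X + M),
    forall v u, holds S v (inst theta (params u \o h)) <-> E (copair v u).
Proof.
move=> [psi psiP]; have [s sP] := sat_support psi.
pose g (z : (V + X) + M) : V + 'I_(size s).+1 :=
  if z is inl (inl x) then inl x else inr (inord (index (z : {classic (V + X) + M}) s)).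
pose h (i : 'I_(size s).+1) : X + M := match nth (inr m0) s i with
  | inl (inl _) => inr m0 | inl (inr x) => inl x | inr m => inr m end.
exists (size s).+1, (form_map g psi), h => v u.
rewrite holds_inst sat_map psiP; apply: sP => z zs.
have hz : nth (inr m0) s (inord (index z s) : 'I_(size s).+1) = z.
  rewrite inordK ?ltnS ?index_size //.
  exact: (@nth_index {classic (V + X) + M} (inr m0) z s zs).
by case: z zs hz => [[x|x]|m] zs hz //=; rewrite /h hz.
Qed.

Variables (n : nat) (p : set (pform L U 'I_n)).
Hypothesis hp : global_invariant S M p.

Definition in_type X (E : ('I_n + X -> U) -> Prop) (u : X -> U) :=
  exists phi, p phi /\ forall v, holds S v phi <-> E (copair v u).

Definition same_type X (u u' : X -> U) := forall E, dfn S M E -> E u -> E u'.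

Lemma same_typeC X (u u' : X -> U) : same_type u u' -> same_type u' u.
Proof.
move=> uu E hE Eu'; apply: contrapT => nEu.
exact: (uu _ (dfn_not hE) nEu).
Qed.

Lemma in_type_transfer X (E : ('I_n + X -> U) -> Prop) (u u' : X -> U) (A : set U) x :
  dfn S M E -> same_type u u' -> range u `<=` A ->
  realizes S x (restr p (M `|` A)) -> E (copair x u) -> in_type E u'.
Proof.
move=> hE uu uA xp Ex; have [k [theta [h hP]]] := dfn_inst hE.
have ov : Defs.over (M `|` A) (inst theta (params u \o h)).
  have bA i : (M `|` A) ((params u \o h) i).
    rewrite /=; case: (h i) => [y|m] /=; first by right; apply: uA; exists y.
    by left; exact: (set_mem (valP m)).
  exists (form_map (fun z => match z with inl x => inl x
     | inr i => inr (exist (fun y => y \in (M `|` A)) _ (mem_set (bA i))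
                      : set_type (M `|` A)) end) theta).
  rewrite /inst form_map_comp; congr (form_map _ theta).
  by apply/funext => -[].
have [[con com] inv] := hp.
have pu : p (inst theta (params u \o h)).
  have [//|np] := com (inst theta (params u \o h)).
  have /= := xp (Not (inst theta (params u \o h))).
  suff: Defs.over (M `|` A) (Not (inst theta (params u \o h))).
    move=> nov /(_ (conj np nov)) nh; exfalso; apply: nh.
    exact: (iffRL (hP _ _)).
  have [psi ->] := ov; exists (Not psi); by [].
exists (inst theta (params u' \o h)); split=> //.
apply/(inv _ theta (params u \o h)) => //; apply/seteqP; split=> phi [ophi hphi]; split=> //.
- exact: (uu _ (dfn_subst h (overP S ophi)) hphi).
- exact: (same_typeC uu (dfn_subst h (overP S ophi)) hphi).
Qed.

Lemma in_type_realized X (N : nat) (E : 'I_N -> ('I_n + X -> U) -> Prop) (u : 'I_N -> X -> U) :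
  (forall i, in_type (E i) (u i)) -> exists v, forall i, E i (copair v (u i)).
Proof.
move=> h; have [phi phiP] := choice h; have [[con _] _] := hp.
have [||v [_ vphi]] := con (range phi).
- exact: finite_image.
- by move=> _ [i _ <-]; case: (phiP i).
exists v => i; have [_ hv] := phiP i; apply/hv; apply: vphi; by exists i.
Qed.

Variable s : nat -> 'I_n -> U.
Hypothesis hs : forall i, realizes S (s i)
  (restr p (M `|` \bigcup_(j in [set j | (j < i)%N]) range (s j))).

Definition tuple_at d (J : seq nat) (z : 'I_d * 'I_n) : U := s (nth 0 J z.1) z.2.

(** Morley sequences are listed with the most recent element first. *)
Fixpoint down d : seq nat := if d is d'.+1 then d' :: down d' else [::].

Definition split_head d (z : 'I_d.+1 * 'I_n) : 'I_n + 'I_d * 'I_n :=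
  if unlift ord0 z.1 is Some i then inr (i, z.2) else inl z.2.

Lemma tuple_at_cons d j J :
  @tuple_at d.+1 (j :: J) = copair (s j) (@tuple_at d J) \o @split_head d.
Proof.
apply/funext => -[i x]; rewrite /tuple_at /split_head /=.
by case: (unliftP ord0 i) => [i' ->|->].
Qed.

Lemma range_tuple_at d j J : size J = d -> all (fun i => i < j) J ->
  range (@tuple_at d J) `<=` \bigcup_(i in [set i | (i < j)%N]) range (s i).
Proof.
move=> <- Jj _ [[i x] _ <-]; exists (nth 0 J i); last by exists x.
exact: (all_nthP 0 Jj).
Qed.

Lemma size_down d : size (down d) = d.
Proof. by elim: d => //= d ->. Qed.

Lemma down_lt d : all (fun i => i < d) (down d).
Proof. by elim: d => //= d IH; rewrite ltnSn; apply: sub_all IH => i /ltnW. Qed.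

Lemma morley_indiscernible d J : size J = d -> sorted gtn J ->
  same_type (@tuple_at d J) (@tuple_at d (down d)).
Proof.
elim: d J => [|d IH] [|j J] //=.
  by move=> _ _ E _; congr E; apply/funext => -[[]].
move=> [sJ] pJ E hE; rewrite !tuple_at_cons => EJ.
have tJ := IH J sJ (path_sorted pJ).
have gtn_tr : transitive gtn by move=> a b c /= ba ca; exact: ltn_trans ca ba.
have rJ := range_tuple_at sJ (order_path_min gtn_tr pJ).
pose E' w := E (w \o @split_head d).
have hE' : dfn S M E' := dfn_reindex _ hE.
apply: contrapT => nE.
have [phi [p1 h1]] := in_type_transfer hE' tJ rJ (@hs j) EJ.
have refl : same_type (@tuple_at d (down d)) (@tuple_at d (down d)) by move=> ? _.
have [phi' [p2 h2]] := in_type_transfer (dfn_not hE') refl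
  (range_tuple_at (size_down d) (down_lt d)) (@hs d) nE.
have [[con _] _] := hp.
have [||v [_ vphi]] := con [set phi; phi'].
- exact: finite_set2.
- by move=> ? [->|->].
have /h1 Ev : holds S v phi by apply: vphi; left.
by have /h2 : holds S v phi' by apply: vphi; right.
Qed.
End Invariant.

(** * Coheirs witness dividing along an invariant type *)

Section Witness.
Variables (L : language) (K U : Type) (T : set (sentence L)) (S : structure L U).
Hypothesis hS : monster K T S.
Variables (M : set U) (m0 : M).
Hypothesis hM : small K M.
Hypothesis hMS : elementary_submodel S M.
Variables (V : Type) (n : nat) (D : (V + 'I_n -> U) -> Prop).
Hypothesis hD : dfn S M D.
Variables (p : set (pform L U 'I_n)) (s : nat -> 'I_n -> U).
Hypothesis hp : global_invariant S M p.
Hypothesis hs : forall i, realizes S (s i)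
  (restr p (M `|` \bigcup_(j in [set j | (j < i)%N]) range (s j))).

Definition points : eqType := {classic 'I_n -> M}.
Definition pval (y : 'I_n -> M) (i : 'I_n) : U := val (y i).
Let y0 : points := fun=> m0.

Definition point_at d (c : seq points) (z : 'I_d * 'I_n) : M := nth y0 c z.1 z.2.
Let pts d c z : U := val (@point_at d c z).

(** The conditions that the formulas true of initial segments of the Morley
sequence impose on sequences from [M], most recent point first. *)
Definition generic (A : set (seq points)) := forall d,
  exists E, [/\ dfn S M E, E (tuple_at s (down d)) &
    forall c, size c = d -> E (@pts d c) -> A c].

Definition compatible (l : seq points) := exists v, forall y, y \in l -> D (copair v (pval y)).

Lemma U_inhabited : inhabited U.
Proof. exact: (inhabits (val m0)). Qed.

Lemma genericT : generic setT.
Proof. by move=> d; exists (fun=> True); split=> //; exact: dfn_true. Qed.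

Lemma genericI A B : generic A -> generic B -> generic (A `&` B).
Proof.
move=> gA gB d; have [E [hE Es EA]] := gA d; have [E' [hE' Es' EB]] := gB d.
exists (fun u => E u /\ E' u); split=> //; first exact: (dfn_and hE hE').
by move=> c sc [Ec E'c]; split; [exact: EA|exact: EB].
Qed.

Lemma generic_nil A : generic A -> A [::].
Proof.
move=> /(_ 0)[E [_ Es EA]]; apply: EA => //.
by move: Es; congr E; apply/funext => -[[]].
Qed.

Lemma generic_at d E : dfn S M E -> E (tuple_at s (down d)) ->
  generic [set c | size c = d -> E (@pts d c)].
Proof.
move=> hE Es d'; have [dd|dd] := eqVneq d' d; last first.
  exists (fun=> True); split=> //; first exact: dfn_true.
  by move=> c sc _ /= sc'; rewrite -sc' sc eqxx in dd.
by subst d'; exists E; split=> // c sc Ec _.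
Qed.

Lemma sorted_down d : sorted gtn (down d).
Proof.
case: d => //= d; rewrite path_min_sorted ?down_lt //.
by elim: d => //= -[|d] //= IH; rewrite ltnSn.
Qed.

(** By indiscernibility every increasing subsequence of an initial segment has
the type of a shorter initial segment. *)
Lemma generic_sub A : generic A -> generic [set c | forall e, subseq e c -> A e].
Proof.
move=> gA d; pose E d := sval (cid (gA d)); pose EP d := svalP (cid (gA d)).
pose g (idx : seq nat) (z : 'I_(size idx) * 'I_n) : 'I_d * 'I_n + M :=
  if insub (nth 0 idx z.1) is Some i then inl (i, z.2) else inr m0.
exists (fun u => forall idx, idx \in subs (iota 0 d) -> E (size idx) (params u \o @g idx)).
have gE idx (z : 'I_(size idx) * 'I_n) : idx \in subs (iota 0 d) ->
    exists2 i : 'I_d, nth 0 idx z.1 = i & g _ z = inl (i, z.2).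
  rewrite mem_subs => /mem_subseq sub; rewrite /g; case: insubP => [i _ iE|].
    by exists i.
  have : nth 0 idx z.1 \in iota 0 d by apply: sub; apply: mem_nth.
  by rewrite mem_iota /= => ->.
split.
- apply: dfn_conj => idx _; apply: dfn_subst; by have [] := EP (size idx).
- move=> idx sidx; have [hE Es _] := EP (size idx).
  pose J := [seq nth 0 (down d) i | i <- idx].
  have -> : params (tuple_at s (down d)) \o @g idx = tuple_at s J :> ('I_(size idx) * 'I_n -> U).
    apply/funext => z /=; have [i iE ->] := gE _ z sidx.
    by rewrite /= /tuple_at (nth_map 0) // iE.
  have sJ : size J = size idx by rewrite size_map.
  suff dJ : sorted gtn J.
    exact: (same_typeC (morley_indiscernible m0 hp hs sJ dJ)).
  apply: (subseq_sorted _ _ (sorted_down d)); first by move=> a b c /= ba /ltn_trans; apply.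
  rewrite -[X in subseq _ X](mkseq_nth 0) size_down /mkseq.
  by apply: map_subseq; rewrite -mem_subs.
- move=> c sc hc e; rewrite -mem_subs -[X in subs X](mkseq_nth y0) sc /mkseq subs_map.
  move=> /mapP[idx sidx ->]; have [_ _ EA] := EP (size idx).
  apply: EA; first by rewrite size_map.
  move: (hc _ sidx); congr (E _); apply/funext => z /=.
  have [i iE ->] := gE _ z sidx.
  by rewrite /pts /point_at /= (nth_map 0) // iE.
Qed.

Lemma small_fin (W : finType) : small K [set: W].
Proof. exact: (small_count hS). Qed.

(** Tuples [u_i] of the type of an initial segment have a common next element:
[E(y, u_i)] is in the invariant type [p] for all [i].  By saturation the type
of the initial segment can be replaced with one of its formulas. *)
Lemma generic_extend_formula d N (E : ('I_n + 'I_d * 'I_n -> U) -> Prop) :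
  dfn S M E -> E (copair (s d) (tuple_at s (down d))) ->
  exists E', [/\ dfn S M E', E' (tuple_at s (down d)) &
    forall u : 'I_N -> 'I_d * 'I_n -> U, (forall i, E' (u i)) ->
      exists y, forall i, E (copair y (u i))].
Proof.
move=> hE Es; apply: contrapT => nE'.
pose W := ('I_N * ('I_d * 'I_n))%type.
pose row (u : W -> U) (i : 'I_N) : 'I_d * 'I_n -> U := fun z => u (i, z).
pose no_y (u : W -> U) := ~ exists y, forall i, E (copair y (row u i)).
pose F : set ((W -> U) -> Prop) := [set X | (exists i E', [/\ dfn S M E',
   E' (tuple_at s (down d)) & X = (fun u => E' (row u i))]) \/ X = no_y].
have hno : dfn S M no_y.
  apply: dfn_not.
  pose G (i : 'I_N) (z : 'I_n + 'I_d * 'I_n) : W + 'I_n :=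
    match z with inl x => inr x | inr z => inl (i, z) end.
  have hG : dfn S M (fun t : W + 'I_n -> U => forall i, i \in enum 'I_N -> E (t \o G i)).
    by apply: dfn_conj => i _; exact: dfn_reindex.
  apply: dfn_ext (dfn_exists m0 hG) => u; split=> -[y hy]; exists y => i.
    have := hy i; rewrite mem_enum => /(_ isT); congr E; by apply/funext => -[].
  by move=> _; have := hy i; congr E; apply/funext => -[].
have hF X : F X -> dfn S M X.
  by move=> [[i [E' [hE' _ ->]]]|->//]; exact: (dfn_reindex (fun z => (i, z)) hE').
have finF (t : seq {classic (W -> U) -> Prop}) : (forall X, X \in t -> F X) ->
    exists u, forall X, X \in t -> (X : (W -> U) -> Prop) u.
  move=> tF.
  have /choice[e eP] : forall X : {classic (W -> U) -> Prop}, exists E', F X ->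
      [/\ dfn S M E', E' (tuple_at s (down d)) &
       forall u, (forall i, E' (row u i)) -> no_y u -> (X : (W -> U) -> Prop) u].
    move=> X; have [FX|nFX] := pselect (F X); last by exists (fun=> True).
    case: FX => [[i [E' [hE' E's ->]]]|->].
      by exists E' => _; split=> // u Eu _; exact: Eu.
    by exists (fun=> True) => _; split=> //; exact: dfn_true.
  pose E' v := forall X, X \in t -> e X v.
  have hE' : dfn S M E' by apply: dfn_conj => X /tF/eP[].
  have E's : E' (tuple_at s (down d)) by move=> X /tF/eP[].
  have [u [uE nu]] : exists u : 'I_N -> 'I_d * 'I_n -> U, (forall i, E' (u i)) /\
       ~ exists y, forall i, E (copair y (u i)).
    apply: contrapT => nu; apply: nE'; exists E'; split=> // u uE.
    by apply: contrapT => ny; apply: nu; exists u.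
  exists (fun z => u z.1 z.2) => X Xt; have [_ _ h] := eP _ (tF _ Xt).
  by apply: h => // i; exact: uE Xt.
have [u uF] := compactness hS hM (small_fin _) hF finF.
have nyu : no_y u by apply: uF; right.
apply: nyu; apply: (in_type_realized hp (E := fun=> E)) => i.
have st : same_type S M (tuple_at s (down d)) (row u i).
  by move=> E' hE' E's; apply: (uF (fun u => E' (row u i))); left; exists i, E'.
exact: (in_type_transfer m0 hp hE st (range_tuple_at (size_down d) (down_lt d)) (@hs d) Es).
Qed.

Lemma generic_extend A N d : generic A -> exists2 A', generic A' &
  forall C : seq (seq points), size C <= N ->
    (forall c, c \in C -> size c = d /\ A' c) ->
    exists y : points, forall c, c \in C -> A (y :: c).
Proof.
move=> gA; have [E [hE Es EA]] := gA d.+1.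
rewrite /= tuple_at_cons in Es.
have hE1 := dfn_reindex (@split_head n d) hE.
have [E' [hE' E's E'E]] := generic_extend_formula N hE1 Es.
exists [set c | size c = d -> E' (@pts d c)]; first exact: generic_at.
case=> [|c0 C] sC hC; first by exists y0.
pose c (i : 'I_N) := nth c0 (c0 :: C) i.
have cC (i : 'I_N) : size (c i) = d /\ E' (@pts d (c i)).
  have iC : c i \in c0 :: C.
    have [iC|iC] := ltnP i (size (c0 :: C)); first exact: mem_nth.
    by rewrite /c nth_default // mem_head.
  by have [sc h] := hC _ iC; split=> //; exact: h.
have [y1 hy1] := E'E (fun i => @pts d (c i)) (fun i => (cC i).2).
pose g (i : 'I_N) (z : 'I_n + 'I_d * 'I_n) : 'I_n + M :=
  match z with inl x => inl x | inr z => inr (@point_at d (c i) z) end.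
have gE i (y : 'I_n -> U) : copair y (@pts d (c i)) = params y \o g i.
  by apply/funext => -[].
pose R (y : 'I_n -> U) := forall i, i \in enum 'I_N -> E ((params y \o g i) \o @split_head n d).
have hR : dfn S M R by apply: dfn_conj => i _; exact: (dfn_subst (g i) hE1).
have [|y Ry] := tarski hMS U_inhabited hR.
  by exists y1 => i _; rewrite -gE; exact: hy1.
exists y => c' c'C; have iN : index c' (c0 :: C) < N.
  by apply: leq_trans sC; rewrite index_mem.
have [sc' _] := hC _ c'C; apply: EA; first by rewrite /= sc'.
move: (Ry (Ordinal iN)); rewrite mem_enum => /(_ isT); rewrite -gE /c nth_index //.
congr E; apply/funext => -[i x]; rewrite /pts /point_at /split_head /=.
by case: (unliftP ord0 i) => [i' ->|->].
Qed.

(** ** The pattern of a dividing formula *)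

Lemma compatible_sub (l l' : seq points) : {subset l' <= l} -> compatible l -> compatible l'.
Proof. by move=> ll [v vl]; exists v => y /ll/vl. Qed.

Hypothesis inconsistent : exists k, ~ exists v, forall i, i < k -> D (copair v (s i)).

Lemma nth_down d i : i < d -> nth 0 (down d) i = d - i.+1.
Proof.
elim: d i => [//|d IH] [|i] /= id; first by rewrite subn1.
by rewrite IH // subSS.
Qed.

Lemma generic_dividing : exists k, generic [set c | size c = k -> ~ compatible c].
Proof.
have [k nk] := inconsistent; exists k.
pose G (i : 'I_k) (z : V + 'I_n) : 'I_k * 'I_n + V :=
  match z with inl x => inr x | inr x => inl (i, x) end.
have hG : dfn S M (fun t : 'I_k * 'I_n + V -> U => forall i, i \in enum 'I_k -> D (t \o G i)).
  by apply: dfn_conj => i _; exact: dfn_reindex.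
have hE := dfn_not (dfn_exists m0 hG).
have GE i (u : 'I_k * 'I_n -> U) v : copair u v \o G i = copair v (fun x => u (i, x)).
  by apply/funext => -[].
have Es : ~ exists v, forall i, i \in enum 'I_k -> D (copair (tuple_at s (down k)) v \o G i).
  move=> [v hv]; apply: nk; exists v => i ik.
  have ri : k - i.+1 < k by rewrite ltn_subrL (leq_ltn_trans _ ik).
  have := hv (Ordinal ri); rewrite mem_enum => /(_ isT); rewrite GE.
  congr (D (copair v _)); apply/funext => x; rewrite /tuple_at /= nth_down //.
  by rewrite subnSK // subKn // ltnW.
move=> d; have [E [hE' E's EA]] := generic_at hE Es d; exists E; split=> //.
move=> c sc Ec /= sk [v hv]; apply: (EA c sc Ec sk); exists v => i _; rewrite GE.
by apply: (hv (nth y0 c i)); rewrite mem_nth ?sk.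
Qed.

Definition coheir_divides (a : 'I_n -> U) := exists q t,
  [/\ ultra q, forall E, dfn S M E -> E a -> q [set y : points | E (pval y)]
  & ~ often q t compatible [::]].

Variable a : 'I_n -> U.
Hypothesis tp_a : tp S a M `<=` p.

Lemma first_point E : dfn S M E -> E a -> E (s 0).
Proof.
move=> hE Ea; have [phi ophi phiE] := dfn_over hE.
have pphi : p phi by apply: tp_a; split=> //; exact/phiE.
apply/phiE; apply: (@hs 0); split=> //.
have [psi ->] := ophi; exists (form_map (fun z => match z with inl x => inl x
  | inr m => inr (exist (fun y => y \in (M `|` \bigcup_(j in [set j | (j < 0)%N]) range (s j)))
      (val m) (mem_set (or_introl (set_mem (valP m))))) end) psi).
by rewrite /inst form_map_comp; congr (form_map _ psi); apply/funext => -[].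
Qed.

(** The first points of the generic sequences have the type of [a], so that an
ultrafilter on them is a coheir of [tp(a/M)]. *)
Lemma nondividing_label rho : (forall q t, ultra q ->
    (forall E, dfn S M E -> E a -> q [set y : points | E (pval y)]) -> often q t compatible [::]) ->
  ultra rho -> (forall A, generic A -> rho A) -> rho [set v : seq points | size v = 1] ->
  forall t, nondividing compatible t rho.
Proof.
move=> nd Ur gr r1 t; pose q := push (head y0) rho.
have Uq : ultra q := ultra_push (head y0) Ur.
have : often q t compatible [::].
  apply: nd => // E hE Ea; rewrite /q /push /=.
  pose E1 (u : 'I_1 * 'I_n -> U) := E (fun x => u (ord0, x)).
  have hE1 : dfn S M E1 := dfn_reindex (fun x => (ord0, x)) hE.
  have E1s : E1 (tuple_at s (down 1)) by exact: (first_point hE Ea).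
  apply: (ultraS Ur) (ultraI Ur r1 (gr _ (generic_at hE1 E1s))) => v [/= sv /(_ sv)].
  by rewrite /E1 /pts /point_at /= nth0.
rewrite /nondividing -[X in often q t compatible X]/(flatten (Nil (seq points))).
elim: t (Nil _) => [//|t IH] Z /= qZ.
apply: (ultraS Ur) (ultraI Ur r1 qZ) => v [/= sv].
by case: v sv => [//|y [|//]] _ /= /(IH ([:: y] :: Z)).
Qed.
End Witness.

(** * From finite antichain trees to the antichain tree property *)

Section ATP.
Variables (L : language) (K U : Type) (T : set (sentence L)) (S : structure L U).
Hypothesis hS : monster K T S.
Variables (M : set U) (m0 : M).
Hypothesis hM : small K M.
Variables (V : Type) (n : nat) (D : (V + 'I_n -> U) -> Prop).
Hypothesis hD : dfn S M D.
Variable d : nat.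
Hypothesis trees : forall N, exists a, @tree_pattern (points M n) (compatible D) d N a.

Let W : countType := ('I_d * 'I_n)%type.

Definition block (t : V + W -> U) := forall i, i \in enum 'I_d ->
  D (t \o (fun z : V + 'I_n => match z with inl x => inl x | inr x => inr (i, x) end)).

Lemma block_dfn : dfn S M block.
Proof. by apply: dfn_conj => i _; exact: dfn_reindex. Qed.

Lemma blockP v (Y : W -> U) :
  block (copair v Y) <-> forall i, D (copair v (fun x => Y (i, x))).
Proof.
have E i : copair v Y \o (fun z : V + 'I_n => match z with inl x => inl x | inr x => inr (i, x) end)
    = copair v (fun x => Y (i, x)) by apply/funext => -[].
by split=> h i; [have := h i; rewrite mem_enum E; exact|rewrite E].
Qed.

(** The antichain tree property concerns formulas in finitely many variables,
whereas the variables of [D] form a tuple indexed by [V]; only those in the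
support are kept, and the parameters from [M] become variables too. *)
Lemma finite_variables : exists k (phi : form L ('I_k + 'I_k)) (yt : (W -> U) -> 'I_k -> U),
  forall (J : Type) (Y : J -> W -> U),
   (exists x, forall j, block (copair x (Y j))) <->
   (exists x, forall j, holds S x (inst phi (yt (Y j)))).
Proof.
have [psi psiP] := block_dfn; have [s sP] := sat_support psi.
pose idx (z : (V + W) + M) : 'I_(size s).+1 :=
  inord (index (z : {classic (V + W) + M}) s).
pose g z : 'I_(size s).+1 + 'I_(size s).+1 :=
  if z is inl (inl _) then inl (idx z) else inr (idx z).
pose yt (Y : W -> U) (i : 'I_(size s).+1) : U := match nth (inr m0) s i with
  | inl (inl _) => val m0 | inl (inr w) => Y w | inr m => val m end.
pose xt (x : V -> U) (i : 'I_(size s).+1) : U :=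
  if nth (inr m0) s i is inl (inl v) then x v else val m0.
pose ext (x : 'I_(size s).+1 -> U) v := x (idx (inl (inl v))).
have idxK z : (z : {classic (V + W) + M}) \in s -> nth (inr m0) s (idx z) = z.
  move=> zs; rewrite inordK ?ltnS ?index_size //.
  exact: (@nth_index {classic (V + W) + M} (inr m0) z s zs).
have c1 x Y : holds S x (inst (form_map g psi) (yt Y)) <-> block (copair (ext x) Y).
  rewrite holds_inst sat_map psiP; apply: sP => -[[v|w]|m] zs //=.
  - by rewrite /yt idxK.
  - by rewrite /yt idxK.
have c2 x Y : block (copair x Y) -> block (copair (ext (xt x)) Y).
  rewrite !psiP; apply: iffLR; apply: sP => -[[v|w]|m] zs //=.
  by rewrite /ext /xt idxK.
exists (size s).+1, (form_map g psi), yt => J Y; split=> [[x xY]|[x xY]].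
  by exists (xt x) => j; apply/c1/c2.
by exists (ext x) => j; exact/c1.
Qed.

Let WT : countType := (seq bool * W)%type.
Definition row (Y : WT -> U) (s : seq bool) : W -> U := fun w => Y (s, w).

Definition ant_ok (Xs : seq (seq bool)) (Y : WT -> U) :=
  exists x, forall s, s \in Xs -> block (copair x (row Y s)).
Definition pair_ok (s s' : seq bool) (Y : WT -> U) :=
  ~ exists x, block (copair x (row Y s)) /\ block (copair x (row Y s')).

Lemma ant_ok_dfn Xs : dfn S M (ant_ok Xs).
Proof.
pose G (s : seq bool) (z : V + W) : WT + V :=
  match z with inl x => inr x | inr w => inl (s, w) end.
have hG : dfn S M (fun t : WT + V -> U => forall s, s \in Xs -> block (t \o G s)).
  by apply: dfn_conj => s _; apply: dfn_reindex block_dfn.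
have E Y x s : copair Y x \o G s = copair x (row Y s) by apply/funext => -[].
by apply: dfn_ext (dfn_exists m0 hG) => Y; split=> -[x hx]; exists x => s /hx; rewrite E.
Qed.

Lemma pair_ok_dfn s s' : dfn S M (pair_ok s s').
Proof.
apply: dfn_ext (dfn_not (ant_ok_dfn [:: s; s'])) => Y; split=> h [x hx]; apply: h; exists x.
  by move=> u; rewrite !inE => /orP[]/eqP->; case: hx.
by split; apply: hx; rewrite !inE eqxx ?orbT.
Qed.

Let y0 : points M n := fun=> m0.
Definition tree_points (a : seq bool -> seq (points M n)) (z : WT) : U :=
  val (nth y0 (a z.1) z.2.1 z.2.2).

Lemma tree_block N a x s : tree_pattern (compatible D) d N a -> size s <= N ->
  block (copair x (row (tree_points a) s)) <->
  forall y, y \in a s -> D (copair x (pval y)).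
Proof.
move=> [sza _ _] sN; rewrite blockP; split=> h.
  move=> y /(nthP y0)[i]; rewrite sza // => id <-.
  exact: (h (Ordinal id)).
by move=> i; apply: (h (nth y0 (a s) i)); rewrite mem_nth ?sza.
Qed.

Lemma tree_ant N a Xs : tree_pattern (compatible D) d N a ->
  (forall s, s \in Xs -> size s <= N) -> incomparable Xs -> ant_ok Xs (tree_points a).
Proof.
move=> ta sX iX; have [_ anta _] := ta; have [v hv] := anta Xs sX iX.
exists v => s sXs; apply/(tree_block _ ta (sX _ sXs)) => y ys; apply: hv.
by apply/flatten_mapP; exists s.
Qed.

Lemma tree_pair N a s s' : tree_pattern (compatible D) d N a ->
  size s' <= N -> prefix s s' -> s != s' -> pair_ok s s' (tree_points a).
Proof.
move=> ta sN ps ss [x [hs hs']]; have [_ _ paira] := ta.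
apply: (paira _ _ sN ps ss); exists x => y.
have sN' := leq_trans (size_prefix ps) sN.
by rewrite mem_cat => /orP[/((tree_block x ta sN').1 hs)|/((tree_block x ta sN).1 hs')].
Qed.

Lemma big_tree : exists Y, (forall Xs, incomparable Xs -> ant_ok Xs Y) /\
  forall s s', prefix s s' -> s != s' -> pair_ok s s' Y.
Proof.
pose F : set ((WT -> U) -> Prop) := [set X | (exists2 Xs, incomparable Xs & X = ant_ok Xs)
  \/ (exists s s', [/\ prefix s s', s != s' & X = pair_ok s s'])].
have hF X : F X -> dfn S M X.
  by case=> [[Xs _ ->]|[s [s' [_ _ ->]]]]; [exact: ant_ok_dfn|exact: pair_ok_dfn].
have finF (t : seq {classic (WT -> U) -> Prop}) : (forall X, X \in t -> F X) ->
    exists Y, forall X, X \in t -> (X : (WT -> U) -> Prop) Y.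
  move=> tF; suff [N hN] : exists N, forall a, tree_pattern (compatible D) d N a ->
      forall X, X \in t -> (X : (WT -> U) -> Prop) (tree_points a).
    by have [a ta] := trees N; exists (tree_points a); exact: hN.
  have /choice[b bP] : forall X : {classic (WT -> U) -> Prop}, exists m, F X ->
      forall N a, m <= N -> tree_pattern (compatible D) d N a ->
        (X : (WT -> U) -> Prop) (tree_points a).
    move=> X; have [FX|nFX] := pselect (F X); last by exists 0.
    case: FX => [[Xs iX ->]|[s [s' [ps ss ->]]]].
      exists (\max_(s <- Xs) size s) => _ N a mN ta; apply: (tree_ant ta _ iX) => s sX.
      by apply: leq_trans mN; exact: leq_bigmax_seq.
    by exists (size s') => _ N a mN ta; exact: (tree_pair ta).
  exists (\max_(X <- t) b X) => a ta X Xt; apply: bP (tF _ Xt) _ _ _ ta.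
  exact: leq_bigmax_seq.
have [Y YF] := compactness hS hM (small_count hS WT) hF finF.
exists Y; split=> [Xs iX|s s' ps ss]; apply: YF; [left|right]; first by exists Xs.
by exists s, s'.
Qed.

Lemma trees_ATP : ~ NATP S.
Proof.
have [k [phi [yt phiP]]] := finite_variables; have [Y [antY pairY]] := big_tree.
move=> /(_ k k phi); apply; exists (fun s => yt (row Y s)); split.
- move=> X aX G0 /(@finite_seqP {classic pform L U 'I_k})[l lE] GX.
  have /choice[e eP] : forall psi : {classic pform L U 'I_k}, exists s, psi \in l ->
      X s /\ psi = inst phi (yt (row Y s)).
    move=> psi; have [pl|pl] := boolP (psi \in l); last by exists [::].
    have [|s Xs sE] := GX psi; first by rewrite lE.
    by exists s.
  have [|x xP] := antY (map e l).
    move=> _ _ /mapP[psi pl ->] /mapP[psi' pl' ->].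
    by apply: aX; [exact: (eP _ pl).1|exact: (eP _ pl').1].
  have [fw _] := phiP {psi : {classic pform L U 'I_k} | psi \in l} (fun z => row Y (e (sval z))).
  have [|x' x'P] := fw.
    by exists x => -[psi pl]; apply: xP; exact: map_f.
  exists x'; split=> // psi; rewrite lE => pl.
  have [_ {1}->] := eP _ pl; exact: (x'P (exist _ psi pl)).
- move=> s s' ps ss con; apply: (pairY s s' ps ss).
  have [||x [_ xP]] := con [set inst phi (yt (row Y s)); inst phi (yt (row Y s'))].
  + exact: finite_set2.
  + by [].
  have [_ bw] := phiP bool (fun z => if z then row Y s else row Y s').
  have [|x' x'P] := bw.
    by exists x => -[]; apply: xP; [left|right].
  by exists x'; split; [exact: (x'P true)|exact: (x'P false)].
Qed.
End ATP.

(** * Kim-dividing is witnessed by coheirs *)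

Section KimDividing.
Variables (L : language) (K U : Type) (T : set (sentence L)) (S : structure L U).
Hypothesis hS : monster K T S.
Hypothesis hNATP : NATP S.
Variables (M : set U) (m0 : M).
Hypothesis hM : small K M.
Hypothesis hMS : elementary_submodel S M.

Definition coheir_dividing V (chi : (V -> U) -> Prop) :=
  exists n (D : (V + 'I_n -> U) -> Prop) (a : 'I_n -> U),
  [/\ dfn S M D, forall v, chi v <-> D (copair v a) & coheir_divides S M D a].

Lemma kim_divides_coheir V (chi : pform L U V) :
  kim_divides S M chi -> coheir_dividing (fun v => holds S v chi).
Proof.
move=> [n [phi [a [-> [s [[p [hp ap sp]] ncon]]]]]].
pose g (z : V + ('I_n + M)) : (V + 'I_n) + M := match z with
  | inl x => inl (inl x) | inr (inl j) => inl (inr j) | inr (inr m) => inr m end.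
pose D (t : V + 'I_n -> U) := sat S (params t) (form_map g phi).
have hD : dfn S M D by exists (form_map g phi).
pose at_ (c : 'I_n -> U) : pform L U V :=
  inst phi (fun z => match z with inl j => c j | inr m => val m end).
have atP c v : holds S v (at_ c) <-> D (copair v c).
  rewrite holds_inst /D sat_map (_ : copair v _ = params (copair v c) \o g) //.
  by apply/funext => -[x|[j|m]].
have inc : exists k, ~ exists v, forall i, i < k -> D (copair v (s i)).
  apply: contrapT => nk; apply: ncon => G0 /(@finite_seqP {classic pform L U V})[l lE] G0s.
  have /choice[e eP] : forall psi : {classic pform L U V}, exists i, psi \in l -> psi = at_ (s i).
    move=> psi; have [pl|pl] := boolP (psi \in l); last by exists 0.
    have [|i _ iE] := G0s psi; first by rewrite lE.
    by exists i.
  pose k := (\max_(psi <- l) e psi).+1.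
  have [v hv] : exists v, forall i, i < k -> D (copair v (s i)).
    by apply: contrapT => nv; apply: nk; exists k.
  exists v; split=> // psi; rewrite lE => pl.
  have /= pl' : (psi : {classic pform L U V}) \in l by [].
  rewrite (eP _ pl'); apply/atP; apply: hv; rewrite ltnS.
  exact: (leq_bigmax_seq _ pl').
exists n, D, a; split=> //; first by move=> v; exact: atP.
apply: contrapT => nq.
have [d trees] : exists d, forall N, exists b, @tree_pattern (points M n) (compatible D) d N b.
  apply: (@antichain_trees (points M n) (generic S m0 s) (compatible D)).
  - exact: genericT.
  - exact: genericI.
  - exact: (generic_sub hp sp).
  - move=> A N e; exact: (generic_extend hS hM hMS hp sp).
  - exact: compatible_sub.
  - exact: generic_nil.
  - exact: (generic_dividing m0 hD inc).
  move=> rho; apply: (nondividing_label sp ap) => q t Uq qa.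
  by apply: contrapT => nqt; apply: nq; exists q, t.
exact: (trees_ATP hS m0 hM hD trees).
Qed.
End KimDividing.

(** * Finitely many coheir-dividing formulas *)

Section Broom.
Variables (L : language) (U : Type) (S : structure L U) (M : set U) (m0 : M).
Hypothesis hMS : elementary_submodel S M.

Let U0 : inhabited U. Proof. exact: (inhabits (val m0)). Qed.

Lemma dfn_pull V W (g : V -> W + M) (h : (W -> U) -> V -> U) (D : (V -> U) -> Prop) :
  (forall w z, h w z = params w (g z)) -> dfn S M D -> dfn S M (fun w => D (h w)).
Proof.
move=> hg hD; apply: dfn_ext (dfn_subst g hD) => w.
by rewrite (_ : h w = params w \o g) //; apply/funext => z; exact: hg.
Qed.

Lemma dfn_disj V (T : eqType) (s : seq T) (D : T -> (V -> U) -> Prop) :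
  (forall i, i \in s -> dfn S M (D i)) ->
  dfn S M (fun v => exists2 i, i \in s & D i v).
Proof.
move=> h; apply: dfn_ext (dfn_not (dfn_conj (fun i si => dfn_not (h i si)))) => v.
split=> [nD|[i si Di] nD]; last exact: nD Di.
by apply: contrapT => nE; apply: nD => i si Di; apply: nE; exists i.
Qed.

Lemma dfn_conj_fin V (I : finType) (D : I -> (V -> U) -> Prop) :
  (forall i, dfn S M (D i)) -> dfn S M (fun v => forall i, D i v).
Proof.
move=> h; apply: dfn_ext (dfn_conj (s := enum I) (fun i _ => h i)) => v.
by split=> hv i; [apply: hv; rewrite mem_enum|].
Qed.

Variable X : Type.

(** A formula over [M] with an ultrafilter along which it divides, in the number
of steps [length_of]; the parameters that complete it vary separately. *)
Record colour := Colour {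
  arity_of : nat;
  formula_of : (X + 'I_arity_of -> U) -> Prop;
  coheir_of : set (set (points M arity_of));
  length_of : nat }.

Arguments formula_of : clear implicits.
Arguments coheir_of : clear implicits.

Definition dividing_colour c := [/\ dfn S M (formula_of c), ultra (coheir_of c)
  & ~ often (coheir_of c) (length_of c) (compatible (formula_of c)) [::]].

Fixpoint cvars (cs : seq colour) : finType :=
  if cs is c :: cs' then ('I_(arity_of c) + cvars cs')%type else void.

Fixpoint some_colour (cs : seq colour) : (X -> U) -> (cvars cs -> U) -> Prop :=
  match cs with
  | [::] => fun _ _ => False
  | c :: cs' => fun x a => formula_of c (copair x (a \o inl)) \/ some_colour x (a \o inr)
  end.

Definition emb V (g : V -> M) (x : V) : U := val (g x).

Fixpoint marginals (cs : seq colour) : set (set (cvars cs -> M)) -> Prop :=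
  match cs with
  | [::] => fun _ => True
  | c :: cs' => fun tau =>
      (forall E, dfn S M E -> coheir_of c [set y | E (pval y)] ->
         tau [set a : 'I_(arity_of c) + cvars cs' -> M | E (emb (a \o inl))]) /\
      marginals (push (fun a : 'I_(arity_of c) + cvars cs' -> M => a \o inr) tau)
  end.

Lemma marginals_mono cs (tau rho : set (set (cvars cs -> M))) :
  (forall E, dfn S M E -> tau [set a | E (emb a)] -> rho [set a | E (emb a)]) ->
  marginals tau -> marginals rho.
Proof.
elim: cs tau rho => [//|c cs IH] tau rho tr /= [t1 t2]; split.
  move=> E hE qE; apply: (tr (fun a => E (a \o inl))); first exact: dfn_reindex.
  exact: t1.
apply: IH t2 => E hE tE; apply: (tr (fun a => E (a \o inr))) => //.
exact: dfn_reindex.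
Qed.

Fixpoint dividing_colours (cs : seq colour) : Prop :=
  if cs is c :: cs' then dividing_colour c /\ dividing_colours cs' else True.

Fixpoint matches (cs : seq colour) : (cvars cs -> U) -> Prop :=
  match cs with
  | [::] => fun _ => True
  | c :: cs' => fun a : 'I_(arity_of c) + cvars cs' -> U =>
      (forall E, dfn S M E -> E (a \o inl) -> coheir_of c [set y | E (pval y)]) /\
      matches (a \o inr)
  end.

Lemma matches_marginals (cs : seq colour) (a : cvars cs -> U) (tau : set (set (cvars cs -> M))) :
  dividing_colours cs -> matches a -> 
  (forall E, dfn S M E -> E a -> tau [set g | E (emb g)]) -> marginals tau.
Proof.
elim: cs a tau => [//|c cs IH] a tau /= [[_ Uq _] dcs] [ma mcs] ta; split.
  move=> E hE qE; apply: (ta (fun a => E (a \o inl))); first exact: dfn_reindex.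
  apply: contrapT => nE; apply: (ultra0 Uq).
  apply: (ultraS Uq) (ultraI Uq qE (ma _ (dfn_not hE) nE)).
  by move=> y [].
apply: (IH (a \o inr)) => // E hE Ea.
exact: (ta (fun a => E (a \o inr)) (dfn_reindex inr hE) Ea).
Qed.

Lemma matches_same_type (cs : seq colour) (a a' : cvars cs -> U) :
  same_type S M a a' -> matches a -> matches a'.
Proof.
elim: cs a a' => [//|c cs IH] a a' aa /= [ma mcs]; split.
  move=> E hE Ea'; apply: ma => //.
  exact: (same_typeC aa (dfn_reindex inl hE) Ea').
by apply: IH mcs => E hE Ea; exact: (aa (fun a => E (a \o inr)) (dfn_reindex inr hE) Ea).
Qed.

Lemma some_colour_dfn cs V (h : (V -> U) -> X -> U) (g : X -> V + M)
    (k : (V -> U) -> cvars cs -> U) (f : cvars cs -> V + M) :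
  dividing_colours cs ->
  (forall v z, h v z = params v (g z)) -> (forall v z, k v z = params v (f z)) ->
  dfn S M (fun v => some_colour (h v) (k v)).
Proof.
elim: cs k f => [|c cs IH] k f /=; first by move=> _ _ _; exact: dfn_false.
move=> [[hc _ _] dc] hg kf; apply: dfn_or.
  apply: (@dfn_pull _ _ (fun z => match z with inl x => g x | inr z => f (inl z) end)
    _ _ _ hc) => v [x|z] /=; [exact: hg|exact: kf].
by apply: (IH _ (f \o inr)) => // v z; exact: kf.
Qed.

(** The tuples [e i] depend on the ultrafilter [tau], but their number depends on
the colours alone.  This uniformity is what makes the induction possible: the
broom for the remaining colours is applied to different formulas at each copy
of the first one. *)
Definition broom_conclusion (cs : seq colour) (I : finType) := forall (W : Type)
    (tau : set (set (W + cvars cs -> M))) (alpha : (X + W -> U) -> Prop)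
    (psi : (X -> U) -> Prop) (D : (W + cvars cs -> U) -> Prop),
  ultra tau -> marginals (push (fun g : W + cvars cs -> M => g \o inr) tau) ->
  dfn S M alpha -> dfn S M psi -> dfn S M D -> tau [set g | D (emb g)] ->
  (forall g, D g -> forall x, alpha (copair x (g \o inl)) ->
     psi x \/ some_colour x (g \o inr)) ->
  exists e : I -> W -> M,
    (forall i, exists a, D (copair (emb (e i)) a)) /\
    forall x, (forall i, alpha (copair x (emb (e i)))) -> psi x.

(** The type of [(b, a)] is combined with the given coheir of the parameters of the
first colour: the coheir and the marginal of [tau] have the same definable
members, and the other variables are then found in [M] because [M] is an
elementary submodel. *)
Lemma amalgam c cs W (tau : set (set (W + cvars (c :: cs) -> M))) :
  dividing_colour c -> ultra tau ->
  marginals (push (fun g : W + cvars (c :: cs) -> M => g \o inr) tau) ->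
  exists rho, [/\ ultra rho,
    forall E, dfn S M E -> tau [set g | E (emb g)] -> rho [set g | E (emb g)]
  & forall A, coheir_of c A -> rho [set g : W + cvars (c :: cs) -> M | A (g \o inr \o inl)]].
Proof.
move=> [_ Uq _] Ut [mt _].
pose B : set (set (W + cvars (c :: cs) -> M)) := [set Z | exists E A,
  [/\ dfn S M E, tau [set g | E (emb g)], coheir_of c A &
    Z = [set g | E (emb g) /\ A (g \o inr \o inl)]]].
have [||_ [E [A [hE tE qA ->]]]|rho Ur Br] := @ultra_extend _ B.
- exists [set g | True /\ True], (fun=> True), setT; split=> //.
  + exact: dfn_true.
  + exact: ultraT Ut.
  + exact: ultraT Uq.
- move=> _ _ [E [A [hE tE qA ->]]] [E' [A' [hE' tE' qA' ->]]].
  exists [set g | (E (emb g) /\ E' (emb g)) /\ (A (g \o inr \o inl) /\ A' (g \o inr \o inl))].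
    exists (fun g => E g /\ E' g), (A `&` A'); split=> //.
    + exact: (dfn_and hE hE').
    + exact: (ultraI Ut tE tE').
    + exact: (ultraI Uq qA qA').
  by move=> g [[Eg E'g] [Ag A'g]].
- pose V := ('I_(arity_of c) + (W + cvars cs))%type.
  pose h (g : V -> U) (z : W + cvars (c :: cs)) : U := match z with
    | inl w => g (inr (inl w)) | inr (inl y) => g (inl y) | inr (inr z) => g (inr (inr z)) end.
  have hE1 : dfn S M (fun g => E (h g)).
    apply: (@dfn_pull _ _ (fun z : W + cvars (c :: cs) => inl match z with
      | inl w => inr (inl w) | inr (inl y) => inl y | inr (inr z) => inr (inr z) end) _ _ _ hE).
    by move=> w [|[]].
  have hE2 := dfn_exists m0 hE1.
  have qE2 : coheir_of c [set y | exists w, E (h (copair (pval y) w))].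
    apply: contrapT => /(ultra_setC Uq) nq.
    have := mt _ (dfn_not hE2) nq; rewrite /push /= => tn.
    apply: (ultra0 Ut); apply: (ultraS Ut) (ultraI Ut tn tE) => g [/= n Eg].
    apply: n; exists (fun z => match z with
      | inl w => emb g (inl w) | inr z => emb g (inr (inr z)) end).
    by move: Eg; congr E; apply/funext => -[w|[y|z]].
  have [y [Ay [w Ew]]] := ultra_nonempty Uq (ultraI Uq qA qE2).
  have hE3 : dfn S M (fun w : W + cvars cs -> U => E (h (copair (pval y) w))).
    apply: (@dfn_pull _ _ (fun z : W + cvars (c :: cs) => match z with
      | inl w => inl (inl w) | inr (inl x) => inr (y x) | inr (inr z) => inl (inr z) end) _ _ _ hE).
    by move=> u [|[]].
  have [|w' Ew'] := tarski hMS U0 hE3; first by exists w.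
  exists (fun z => match z with inl w => w' (inl w) | inr (inl x) => y x
     | inr (inr z) => w' (inr z) end); split; last first.
    by move: Ay; congr A; apply/funext.
  by move: Ew'; congr E; apply/funext => -[|[]].
exists rho; split=> //.
- move=> E hE tE.
  have : rho [set g : W + cvars (c :: cs) -> M |
      E (emb g) /\ setT (g \o inr \o inl : points M (arity_of c))].
    by apply: Br; exists E, setT; split=> //; exact: ultraT Uq.
  by apply: (ultraS Ur) => g [].
- move=> A qA; have : rho [set g : W + cvars (c :: cs) -> M | True /\ A (g \o inr \o inl)].
    by apply: Br; exists (fun=> True), A; split=> //; [exact: dfn_true|exact: ultraT Ut].
  by apply: (ultraS Ur) => g [].
Qed.

Section Step.
Variables (c : colour) (cs : seq colour) (I : finType).
Hypothesis dc : dividing_colour c.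
Hypothesis dcs : dividing_colours cs.
Hypothesis IH : broom_conclusion cs I.
Variables (W : Type) (tau : set (set (W + cvars (c :: cs) -> M))).
Variables (alpha : (X + W -> U) -> Prop) (psi : (X -> U) -> Prop).
Variable D : (W + cvars (c :: cs) -> U) -> Prop.
Hypothesis Ut : ultra tau.
Hypothesis mt : marginals (push (fun g : W + cvars (c :: cs) -> M => g \o inr) tau).
Hypothesis halpha : dfn S M alpha.
Hypothesis hpsi : dfn S M psi.
Hypothesis hD : dfn S M D.
Hypothesis tD : tau [set g | D (emb g)].
Hypothesis Dcolour : forall g, D g -> forall x, alpha (copair x (g \o inl)) ->
  psi x \/ @some_colour (c :: cs) x (g \o inr).

Definition base : eqType := {classic W + cvars (c :: cs) -> M}.

Fixpoint copy_index l : finType :=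
  if l is l'.+1 then (I * option (copy_index l'))%type else void.

Definition proj (e : W -> U) := exists a, D (copair e a).

Definition point (g : base) : points M (arity_of c) := g \o inr \o inl.
Definition rest (g : base) : cvars cs -> U := emb g \o inr \o inr.

(** In a valuation that satisfies the conjunction of the [alpha] for the copies
[Gs] and avoids [psi] and the remaining colours, each copy has the first
colour.  The copies run through a Morley sequence in the coheir of that
colour, of which [Gs] is a part; once it is long enough to be inconsistent,
this is impossible.  While it is not, a new copy [d] is chosen generically:
the tuples [e d] work for [d :: Gs], and the broom for the remaining colours
removes from the conclusion the instances of these colours at [d]. *)
Lemma broom_copies l (Gs : seq base) :
  (forall g, g \in Gs -> D (emb g)) ->
  often (coheir_of c) l (fun Z => ~ compatible (formula_of c) Z) (map point Gs) ->
  exists e : copy_index l -> W -> M, (forall j, proj (emb (e j))) /\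
    forall x, (forall j, alpha (copair x (emb (e j)))) ->
      (forall g, g \in Gs -> alpha (copair x (emb g \o inl))) ->
      psi x \/ exists2 g, g \in Gs & some_colour x (rest g).
Proof.
elim: l Gs => [|l IHl] Gs DG /=.
  move=> nc; exists (fun j : void => match j with end); split=> [[]|x _ aG].
  apply: contrapT => /not_orP[npsi nG]; apply: nc; exists x => _ /mapP[g gG ->].
  have [//|[//|sg]] := Dcolour (DG g gG) (aG g gG).
  by exfalso; apply: nG; exists g.
move=> qG; have [rho [Ur rt rq]] := amalgam dc Ut mt.
have /choice[e eP] : forall d : base, exists e : copy_index l -> W -> M,
    D (emb d) -> often (coheir_of c) l (fun Z => ~ compatible (formula_of c) Z)
       (map point (d :: Gs)) ->
    (forall j, proj (emb (e j))) /\
    forall x, (forall j, alpha (copair x (emb (e j)))) ->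
      (forall g, g \in d :: Gs -> alpha (copair x (emb g \o inl))) ->
      psi x \/ exists2 g, g \in d :: Gs & some_colour x (rest g).
  move=> d; have [[Dd od]|nd] := pselect (D (emb d) /\
     often (coheir_of c) l (fun Z => ~ compatible (formula_of c) Z) (map point (d :: Gs))).
    have [|e eP] := IHl (d :: Gs) _ od; last by exists e.
    by move=> g; rewrite in_cons => /orP[/eqP->|/DG].
  by exists (fun _ _ => m0) => Dd od; exfalso; apply: nd.
pose W' := (W + copy_index l * W)%type.
pose h (d : base) (z : W' + cvars cs) : M := match z with
  | inl (inl w) => d (inl w) | inl (inr (j, w)) => e d j w | inr z => d (inr (inr z)) end.
pose tau' := push h rho.
pose alpha' (t : X + W' -> U) := [/\ alpha (copair (t \o inl) (t \o inr \o inl)),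
  forall j, alpha (copair (t \o inl) (fun w => t (inr (inr (j, w))))) &
  forall g, g \in Gs -> alpha (copair (t \o inl) (emb g \o inl))].
pose psi' x := psi x \/ exists2 g, g \in Gs & some_colour x (rest g).
pose D' (t : W' + cvars cs -> U) := [/\ proj (t \o inl \o inl),
  forall j, proj (fun w => t (inl (inr (j, w)))) &
  forall x, alpha' (copair x (t \o inl)) -> psi' x \/ some_colour x (t \o inr)].
have halpha' : dfn S M alpha'.
  have h1 : dfn S M (fun t : X + W' -> U => alpha (copair (t \o inl) (t \o inr \o inl))).
    apply: (@dfn_pull _ _ (fun z : X + W => match z with
      | inl x => inl (inl x) | inr w => inl (inr (inl w)) end) _ _ _ halpha).
    by move=> t [].
  have h2 : dfn S M (fun t : X + W' -> U => forall j,
      alpha (copair (t \o inl) (fun w => t (inr (inr (j, w)))))).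
    apply: dfn_conj_fin => j; apply: (@dfn_pull _ _ (fun z : X + W => match z with
      | inl x => inl (inl x) | inr w => inl (inr (inr (j, w))) end) _ _ _ halpha).
    by move=> t [].
  have h3 : dfn S M (fun t : X + W' -> U => forall g, g \in Gs ->
      alpha (copair (t \o inl) (emb g \o inl))).
    apply: dfn_conj => g _; apply: (@dfn_pull _ _ (fun z : X + W => match z with
      | inl x => inl (inl x) | inr w => inr (g (inl w)) end) _ _ _ halpha).
    by move=> t [].
  by apply: dfn_ext (dfn_and h1 (dfn_and h2 h3)) => t; split=> [[? [? ?]]|[]].
have hpsi' : dfn S M psi'.
  apply: dfn_or hpsi _; apply: dfn_disj => g _.
  by apply: (@some_colour_dfn _ _ _ (fun x => inl x) _ (fun z => inr (g (inr (inr z))))).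
have hproj : dfn S M proj := dfn_exists m0 hD.
have hD' : dfn S M D'.
  have h1 : dfn S M (fun t : W' + cvars cs -> U => proj (t \o inl \o inl)) :=
    dfn_reindex (fun w => inl (inl w)) hproj.
  have h2 : dfn S M (fun t : W' + cvars cs -> U => forall j,
      proj (fun w => t (inl (inr (j, w))))).
    by apply: dfn_conj_fin => j; exact: (dfn_reindex (fun w => inl (inr (j, w))) hproj).
  have h3 : dfn S M (fun u : (W' + cvars cs) + X -> U =>
      alpha' (copair (u \o inr) (u \o inl \o inl)) ->
      psi' (u \o inr) \/ some_colour (u \o inr) (u \o inl \o inr)).
    apply: dfn_imp.
      apply: (@dfn_pull _ _ (fun z : X + W' => match z with
        | inl x => inl (inr x) | inr w => inl (inl (inl w)) end) _ _ _ halpha').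
      by move=> t [].
    apply: dfn_or; first exact: (dfn_reindex inr hpsi').
    by apply: (@some_colour_dfn _ _ _ (fun x => inl (inr x)) _ (fun z => inl (inl (inr z)))).
  by apply: dfn_ext (dfn_and h1 (dfn_and h2 (dfn_forall m0 h3))) => t;
    split=> [[? [? ?]]|[]].
have Ut' : ultra tau' by exact: ultra_push.
have mt' : marginals (push (fun g : W' + cvars cs -> M => g \o inr) tau').
  have [_ mt2] := mt; apply: marginals_mono mt2 => E hE tE.
  exact: (rt _ (dfn_reindex (fun z => inr (inr z)) hE) tE).
have tD' : tau' [set g | D' (emb g)].
  have rD := rt _ hD tD; apply: (ultraS Ur) (ultraI Ur rD (rq _ qG)) => d [/= Dd od].
  have [pe he] := eP d Dd od; split.
  - by exists (emb d \o inr); move: Dd; congr D; apply/funext => -[].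
  - exact: pe.
  move=> x [a1 a2 a3]; have [||px|[g]] := he x.
  - exact: a2.
  - by move=> g; rewrite in_cons => /orP[/eqP->|/a3].
  - by left; left.
  by rewrite in_cons => /orP[/eqP->|gG] sg; [right|left; right; exists g].
have [|e' [pe' he']] := IH Ut' mt' halpha' hpsi' hD' tD'.
  by move=> t [_ _ h3] x /h3.
exists (fun j => match j with
  | (i, None) => fun w => e' i (inl w) | (i, Some j) => fun w => e' i (inr (j, w)) end).
split=> [[i [j|]]|x ax aG].
- by have [a [_ h2 _]] := pe' i; exact: (h2 j).
- by have [a [h1 _ _]] := pe' i.
apply: he' => i; split=> [|j|g gG].
- exact: (ax (i, None)).
- exact: (ax (i, Some j)).
- exact: aG.
Qed.
End Step.

Lemma broom cs : dividing_colours cs -> exists I, broom_conclusion cs I.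
Proof.
elim: cs => [_|c cs IH /= [dc dcs]].
  exists unit => W tau alpha psi D Ut _ _ _ _ tD Dc.
  have [g Dg] := ultra_nonempty Ut tD; exists (fun _ => g \o inl); split=> [_|x ax].
    by exists (emb g \o inr); move: Dg => /=; congr D; apply/funext => -[].
  by have [//|//] := Dc _ Dg x (ax tt).
have [I hI] := IH dcs; exists (copy_index I (length_of c)).
move=> W tau alpha psi D Ut mt halpha hpsi hD tD Dc.
have [_ Uq nq] := dc.
have noG (g : base c cs W) : g \in [::] -> D (emb g) by [].
have [e [pe he]] := broom_copies dc dcs hI Ut mt halpha hpsi hD tD Dc noG (often_not Uq nq).
exists e; split=> // x ax; have [//|//|[]//] := he x ax.
Qed.
End Broom.

(** * Cardinal arithmetic *)

Lemma card_le_of_inj (A B : Type) (X : set A) (Y : set B) (f : A -> B) :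
  (forall x, X x -> Y (f x)) -> (forall x y, X x -> X y -> f x = f y -> x = y) -> X #<= Y.
Proof.
move=> fXY finj; have [h] : $|{injfun X >-> Y}|.
  by apply/injfunPex; exists f => // x y /set_mem Xx /set_mem Xy; exact: finj.
exact: inj_card_le h.
Qed.

Lemma inj_of_card_le (A B : Type) (Y : set B) :
  [set: A] #<= Y -> exists f : A -> B, (forall x, Y (f x)) /\ injective f.
Proof.
move/card_leP=> [h]; exists (fun x => val (h (exist _ x (mem_set I)))).
split=> [x|x y /val_inj]; first exact: (set_mem (valP _)).
by move/(@inj _ _ _ h) => /(_ (mem_set I) (mem_set I)) [].
Qed.

Lemma comparable_types (X Y : Type) :
  (exists f : X -> Y, injective f) \/ (exists f : Y -> X, injective f).
Proof.
pose Q (R : set (X * Y)) := forall a b, R a -> R b -> (a.1 = b.1 <-> a.2 = b.2).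
have [|R [QR maxR]] := @Zorn_bigcup _ Q.
  move=> C CQ tot a b [R1 C1 R1a] [R2 C2 R2b].
  have [R12|R21] := tot _ _ C1 C2; first by apply: (CQ _ C2) => //; exact: R12.
  by apply: (CQ _ C1) => //; exact: R21.
have [domR|ndom] := pselect (forall x, exists y, R (x, y)).
  left; have [f fP] := choice domR; exists f => x x' ff.
  exact: ((QR _ _ (fP x) (fP x')).2 ff).
have [ranR|nran] := pselect (forall y, exists x, R (x, y)).
  right; have [f fP] := choice ranR; exists f => y y' ff.
  exact: ((QR _ _ (fP y) (fP y')).1 ff).
have /existsNP[x nx] := ndom; have /existsNP[y ny] := nran.
exfalso; apply: (maxR (R `|` [set (x, y)])).
  split; first by move=> z Rz; left.
  by move=> /(_ (x, y) (or_intror (erefl _))) Rxy; apply: nx; exists y.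
move=> [x1 y1] [x2 y2] [R1|[-> ->]] [R2|[-> ->]] //=; first exact: (QR _ _ R1 R2).
- split=> E; [case: nx; exists y1|case: ny; exists x1]; by rewrite -?E.
- split=> E; [case: nx; exists y2|case: ny; exists x2]; by rewrite ?E.
Qed.

(** [Y * bool] embeds into [Y] when [Y] is infinite.  By Zorn's lemma there is a
maximal injection [D * bool -> D] with [D] a subset of [Y]; the complement of
[D] is finite, since otherwise a copy of the naturals could be added to [D],
and is absorbed into [D] by a shift along a sequence in [D]. *)
Lemma doubling (Y : Type) : (exists f : nat -> Y, injective f) ->
  exists f : Y * bool -> Y, injective f.
Proof.
move=> [e einj].
pose field (R : set ((Y * bool) * Y)) := [set y | exists b z, R ((y, b), z)].
pose Q (R : set ((Y * bool) * Y)) :=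
  [/\ forall a b, R a -> R b -> (a.1 = b.1 <-> a.2 = b.2),
      forall y b, field R y -> exists z, R ((y, b), z)
    & forall a, R a -> field R a.2].
have [|R [[funR domR ranR] maxR]] := @Zorn_bigcup _ Q.
  move=> C CQ tot; split.
  - move=> a b [R1 C1 R1a] [R2 C2 R2b].
    have [R12|R21] := tot _ _ C1 C2.
      by have [h _ _] := CQ _ C2; apply: h => //; exact: R12.
    by have [h _ _] := CQ _ C1; apply: h => //; exact: R21.
  - move=> y b [b' [z [R1 C1 R1z]]]; have [_ h _] := CQ _ C1.
    by have [|z' Rz'] := h y b; [exists b', z|exists z'; exists R1].
  - move=> a [R1 C1 R1a]; have [_ _ h] := CQ _ C1; have [b [z Rz]] := h _ R1a.
    by exists b, z; exists R1.
pose D := field R.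
have hR y b : exists z, D y -> R ((y, b), z).
  have [Dy|nDy] := pselect (D y); last by exists y.
  by have [z Rz] := domR y b Dy; exists z.
have [F0|/infiniteP/inj_of_card_le[g [gD ginj']]] := pselect (finite_set (~` D)); last first.
  exfalso; pose R2 : set ((Y * bool) * Y) :=
    [set a | exists n (b : bool), a = ((g n, b), g (n.*2 + b))].
  have ngD n : ~ D (g n) := gD n.
  have fU y : field (R `|` R2) y -> D y \/ exists n, y = g n.
    by move=> [b [z [Rz|[n [b' [-> _ _]]]]]]; [left; exists b, z|right; exists n].
  apply: (maxR (R `|` R2)).
    split; first by move=> z Rz; left.
    move=> /(_ ((g 0, false), g 0)) h; apply: (ngD 0); exists false, (g 0); apply: h.
    by right; exists 0, false.
  split.
  - move=> a b [Ra|[n [c ->]]] [Rb|[n' [c' ->]]] /=; first exact: funR.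
    + split=> E; exfalso.
        by apply: (ngD n'); exists c', a.2; move: Ra; case: (a) E => a1 a2 /= ->.
      by apply: (ngD (n'.*2 + c')); rewrite -E; exact: ranR.
    + split=> E; exfalso.
        by apply: (ngD n); exists c, b.2; move: Rb; case: (b) E => b1 b2 /= ->.
      by apply: (ngD (n.*2 + c)); rewrite E; exact: ranR.
    + split=> [[/ginj' -> ->]//|/ginj' E].
      have cc : c = c'.
        by have := congr1 odd E; rewrite !oddD !odd_double; case: (c); case: (c').
      by move: E; rewrite cc => /addIn /double_inj ->.
  - move=> y b /fU[Dy|[n ->]]; first by have [z Rz] := domR y b Dy; exists z; left.
    by exists (g (n.*2 + b)); right; exists n, b.
  - move=> a [Ra|[n [c ->]]] /=.
      by have [b [z Rz]] := ranR _ Ra; exists b, z; left.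
    by exists false, (g ((n.*2 + c).*2 + false)); right; exists (n.*2 + c), false.
have /infiniteP/inj_of_card_le[d [dD dinj']] : infinite_set D.
  move=> Dfin; have : finite_set [set: Y].
    by rewrite -(setUv D); rewrite finite_setU.
  by apply/infiniteP; apply: (card_le_of_inj (f := e)) => // x y _ _; exact: einj.
have [l lE] := (@finite_seqP {classic Y} _).1 F0.
have lD (y : {classic Y}) : y \in l -> ~ D y.
  by move=> yl; have : (~` D) y by rewrite lE.
have lnD (y : {classic Y}) : y \notin l -> D y.
  by move=> yl; apply: contrapT => nD; have : (~` D) y by []; rewrite lE /= (negPf yl).
pose spec (y : {classic Y}) z := [\/ y \in l /\ z = d (index y l),
  exists2 n, y = d n & z = d (n + size l)
  | [/\ y \notin l, forall n, y <> d n & z = y]].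
have /choice[s sP] : forall y : Y, exists z : Y, spec y z.
  move=> y; have [yl|yl] := boolP ((y : {classic Y}) \in l).
    by exists (d (index (y : {classic Y}) l)); constructor 1.
  have [[n yn]|ny] := pselect (exists n, y = d n).
    by exists (d (n + size l)); constructor 2; exists n.
  by exists y; constructor 3; split=> // n yn; apply: ny; exists n.
have sD y : D (s y).
  case: (sP y) => [[_ ->]|[n _ ->]|[yl _ ->]]; [exact: dD|exact: dD|exact: lnD].
have sinj y y' : s y = s y' -> y = y'.
  case: (sP y) => [[yl ->]|[n -> ->]|[yl yn ->]];
    case: (sP y') => [[y'l ->]|[n' -> ->]|[y'l y'n ->]].
  - move/dinj' => ii; rewrite -[y](@nth_index {classic Y} y y l) // ii.
    exact: (@nth_index {classic Y} y y' l).
  - move/dinj' => E; have : index (y : {classic Y}) l < size l by rewrite index_mem.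
    by rewrite E ltnNge leq_addl.
  - by move=> E; case: (y'n (index (y : {classic Y}) l)).
  - move/dinj' => E; have : index (y' : {classic Y}) l < size l by rewrite index_mem.
    by rewrite -E ltnNge leq_addl.
  - by move/dinj'/eqP; rewrite eqn_add2r => /eqP->.
  - by move=> E; case: (y'n (n + size l)).
  - by move=> E; case: (yn (index (y' : {classic Y}) l)).
  - by move=> E; case: (yn (n' + size l)).
  - by [].
have /choice[h hP] : forall a : Y * bool, exists z, R ((s a.1, a.2), z).
  by move=> [y b]; exact: (domR _ b (sD y)).
exists h => -[y b] [y' b'] hh.
have := (funR _ _ (hP (y, b)) (hP (y', b'))).2 hh.
by move=> /= [/sinj -> ->].
Qed.

Lemma sval_inj (A : Type) (Q : A -> Prop) (x y : {x | Q x}) : sval x = sval y -> x = y.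
Proof.
by case: x y => [x Qx] [y Qy] /= E; subst y; rewrite (Prop_irrelevance Qx Qy).
Qed.

Section SmallUnion.
Variables (L : language) (K U : Type) (T : set (sentence L)) (S : structure L U).
Hypothesis hS : monster K T S.

(** If [K] embedded into the union, then it would be the union of two parts, and
would embed into the double of the larger one, hence into that part. *)
Lemma small_union (A B : set U) : small K A -> small K B -> small K (A `|` B).
Proof.
move=> [AK KA] [BK KB].
have [e [_ einj]] := inj_of_card_le (monster_nat hS).1.
have Kdouble : exists f : K * bool -> K, injective f by apply: doubling; exists e.
split.
  have [f finj] := Kdouble; have [u] : inhabited U := (monster_models hS).1.
  have inK (C : set U) : C #<= [set: K] -> exists g : U -> K,
      forall x y, C x -> C y -> g x = g y -> x = y.
    move/card_leP=> [h]; have [g gP] : exists g : U -> K, forall x (Cx : C x),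
        g x = val (h (exist _ x (mem_set Cx))).
      have /choice[g gP] : forall x, exists k, forall (Cx : C x),
          k = val (h (exist _ x (mem_set Cx))).
        move=> x; have [Cx|nCx] := pselect (C x); last by exists (e 0).
        by exists (val (h (exist _ x (mem_set Cx)))) => Cx'; rewrite (Prop_irrelevance Cx Cx').
      by exists g.
    exists g => x y Cx Cy; rewrite (gP x Cx) (gP y Cy) => /val_inj.
    by move/(@inj _ _ _ h) => /(_ (mem_set I) (mem_set I)) [].
  have [gA gAi] := inK A AK; have [gB gBi] := inK B BK.
  pose g x := if `[< A x >] then f (gA x, true) else f (gB x, false).
  apply: (card_le_of_inj (f := g)) => // x y ABx ABy; rewrite /g.
  case: asboolP => Ax; case: asboolP => Ay /finj[] //; first exact: gAi.
  by case: ABx => // Bx; case: ABy => // By; exact: gBi.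
move=> /inj_of_card_le[f [fAB finj]].
pose X := {k | A (f k)}; pose Y := {k | ~ A (f k)}.
have into (Z : Type) (C : set U) (i : Z -> U) : (forall z, C (i z)) -> injective i ->
    ~ ([set: K] #<= C) -> (exists j : K -> Z * bool, injective j) -> False.
  move=> iC iinj KC [j jinj]; have Zinf : infinite_set [set: Z].
    move=> Zfin; have : finite_set [set: Z * bool].
      by rewrite -setXTT; apply: finite_setX => //; exact: finite_finset.
    apply/infiniteP; apply: (card_le_of_inj (f := j \o e)) => // x y _ _ /jinj; exact: einj.
  have [d [_ dinj]] := inj_of_card_le ((infiniteP _).1 Zinf).
  have [h hinj] := doubling (ex_intro _ d dinj).
  apply: KC; apply: (card_le_of_inj (f := i \o (h \o j))) => [k _|k k' _ _ /iinj/hinj/jinj//].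
  exact: iC.
have [[g ginj]|[g ginj]] := comparable_types X Y.
- apply: (into Y B (fun y => f (sval y))) => //.
  + by move=> [y nAy] /=; case: (fAB y).
  + by move=> y y' /finj /sval_inj.
  pose j k : Y * bool := match pselect (A (f k)) with
    | left Ak => (g (exist _ k Ak), true) | right nAk => (exist _ k nAk, false) end.
  exists j => k k'; rewrite /j; case: pselect => Ak; case: pselect => Ak' // [].
  + by move/ginj => [].
  + by [].
- apply: (into X A (fun y => f (sval y))) => //.
  + by move=> [y Ay].
  + by move=> y y' /finj /sval_inj.
  pose j k : X * bool := match pselect (A (f k)) with
    | left Ak => (exist _ k Ak, true) | right nAk => (g (exist _ k nAk), false) end.
  exists j => k k'; rewrite /j; case: pselect => Ak; case: pselect => Ak' // [].
  + by [].
  + by move/ginj => [].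
Qed.
End SmallUnion.

(** * The coheir *)

Section Guarded.
Variables (L : language) (K U : Type) (T : set (sentence L)) (S : structure L U).
Hypothesis hS : monster K T S.
Variables (M : set U) (m0 : M).
Hypothesis hM : small K M.
Hypothesis hMS : elementary_submodel S M.

Lemma dfn_mono V (A B : set U) (D : (V -> U) -> Prop) : A `<=` B -> dfn S A D -> dfn S B D.
Proof.
move=> AB [psi psiP].
pose g (z : V + A) : V + B := match z with inl x => inl x
  | inr u => inr (exist _ (val u) (mem_set (AB _ (set_mem (valP u))))) end.
exists (form_map g psi) => v; rewrite psiP sat_map.
by rewrite (_ : params v = params v \o g) //; apply/funext => -[].
Qed.

Lemma dfn_params V W (D : (V + W -> U) -> Prop) (w : W -> U) (A : set U) :
  M `<=` A -> range w `<=` A -> dfn S M D -> dfn S A (fun v => D (copair v w)).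
Proof.
move=> MA wA [psi psiP]; have wAz z : A (w z) by apply: wA; exists z.
pose g (z : (V + W) + M) : V + A := match z with inl (inl x) => inl x
  | inl (inr z) => inr (exist _ (w z) (mem_set (wAz z)))
  | inr m => inr (exist _ (val m) (mem_set (MA _ (set_mem (valP m))))) end.
exists (form_map g psi) => v; rewrite psiP sat_map.
by rewrite (_ : params _ = params v \o g) //; apply/funext => -[[]|].
Qed.

Lemma dfn_unparams V W (chi : (V -> U) -> Prop) (w : W -> U) :
  dfn S (M `|` range w) chi ->
  exists2 D : (V + W -> U) -> Prop, dfn S M D & forall v, chi v <-> D (copair v w).
Proof.
move=> [psi psiP].
have /choice[f fP] : forall u : M `|` range w, exists z : W + M, params w z = val u.
  move=> u; have := set_mem (valP u) => -[Mu|[x _ wx]]; last by exists (inl x).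
  by exists (inr (exist _ (val u) (mem_set Mu))).
pose g (z : V + (M `|` range w)) : (V + W) + M := match z with inl x => inl (inl x)
  | inr u => match f u with inl x => inl (inr x) | inr m => inr m end end.
exists (fun t => sat S (params t) (form_map g psi)); first by exists (form_map g psi).
move=> v; rewrite psiP sat_map (_ : params v = params (copair v w) \o g) //.
by apply/funext => -[//|u] /=; rewrite -(fP u); case: (f u).
Qed.

Lemma same_type_extend X W (b b' : X -> U) (a : W -> U) :
  small K [set: X] -> small K [set: W] -> same_type S M b' b ->
  exists a' : W -> U, same_type S M (copair b' a) (copair b a').
Proof.
move=> sX sW bb.
pose F : set ((W -> U) -> Prop) := [set D | exists E,
  [/\ dfn S M E, E (copair b' a) & D = fun w => E (copair b w)]].
have [||_ [E [hE _ ->]]|l lF|a' ha] := @compactness _ _ _ _ _ hS W (M `|` range b) F.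
- apply: (small_union hS) => //; apply: small_le sX _; exact: card_image_le.
- exact: sW.
- have hE' : dfn S M (fun t : W + X -> U => E (copair (t \o inr) (t \o inl))).
    by apply: (@dfn_pull _ _ _ _ _ _ (fun z : X + W => match z with
      | inl x => inl (inr x) | inr w => inl (inl w) end) _ _ _ hE) => t [].
  by apply: (dfn_params _ _ hE') => x; [left|right].
- pose Q (i : {classic (W -> U) -> Prop}) E :=
    i \in l -> [/\ dfn S M E, E (copair b' a) & i = fun w => E (copair b w)].
  have /choice[e eP] : forall i, exists E, Q i E.
    move=> i; have [/lF[E EP]|ni] := pselect (i \in l); first by exists E.
    by exists (fun=> True).
  have hC : dfn S M (fun t => forall i, i \in l -> e i t).
    by apply: dfn_conj => i /eP[].
  have [|w hw] := bb _ (dfn_exists m0 hC).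
    by exists a => i /eP[].
  by exists w => D Dl; have [_ _ ->] := eP _ Dl; exact: hw.
by exists a' => E hE Ea; apply: (ha (fun w => E (copair b w))); exists E.
Qed.

Lemma type_ultra V (v : V -> U) : exists2 tau : set (set (V -> M)), ultra tau &
  forall E, dfn S M E -> E v -> tau [set g | E (emb g)].
Proof.
pose B : set (set (V -> M)) := [set Z | exists E,
  [/\ dfn S M E, E v & Z = [set g | E (emb g)]]].
have [||_ [E [hE Ev ->]]|tau Ut Bt] := @ultra_extend _ B.
- by exists [set g | True], (fun=> True); split=> //; exact: dfn_true.
- move=> _ _ [E [hE Ev ->]] [E' [hE' E'v ->]].
  exists [set g | E (emb g) /\ E' (emb g)] => //.
  by exists (fun g => E g /\ E' g); split=> //; exact: dfn_and.
- have [|g Eg] := tarski hMS (inhabits (val m0)) hE; first by exists v.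
  by exists g.
by exists tau => // E hE Ev; apply: Bt; exists E.
Qed.

Local Notation colour := (@colour U M).

Definition divides_list X (chi : (X -> U) -> Prop) :=
  exists cs (a : cvars cs -> U),
  [/\ @dividing_colours _ _ S M X cs, matches S a & forall x, chi x <-> some_colour x a].

Lemma divides_listU X (chi chi' : (X -> U) -> Prop) :
  divides_list chi -> divides_list chi' -> divides_list (fun x => chi x \/ chi' x).
Proof.
move=> [cs [a [dcs ma ea]]] h'.
suff [cs' [a' [d' m' e']]] : divides_list (fun x => some_colour x a \/ chi' x).
  by exists cs', a'; split=> // x; rewrite -e' ea.
elim: cs a dcs ma {chi ea} => [|c cs IH] a /=.
  move=> _ _; have [cs' [a' [d' m' e']]] := h'; exists cs', a'; split=> // x.
  by rewrite -e'; split=> [[[]|//]|]; right.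
move=> [dc dcs] [mc mcs]; have [cs' [a' [d' m' e']]] := IH _ dcs mcs.
exists (c :: cs'), (copair (a \o inl) a'); split=> //= x.
rewrite -[copair (a \o inl) a' \o inr]/a' -[copair (a \o inl) a' \o inl]/(a \o inl).
by rewrite -e'; tauto.
Qed.

Lemma divides_list_seq X (J : eqType) (s : seq J) (chi : J -> (X -> U) -> Prop) :
  (forall j, j \in s -> coheir_dividing S M (chi j)) ->
  divides_list (fun x => exists2 j, j \in s & chi j x).
Proof.
elim: s => [_|j s IH h].
  by exists [::], (fun z : void => match z with end); split=> //= x; split=> [[]|].
have [|cs [a [dcs ma ea]]] := IH; first by move=> i si; apply: h; rewrite in_cons si orbT.
have [n [D [d [hD De [q [t [Uq dq nq]]]]]]] := h j (mem_head _ _).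
pose c : colour X := Colour D q t.
exists (c :: cs), (copair d a); split=> [||x] //=.
rewrite -De -[copair d a \o inr]/a -ea; split=> [[i]|[jx|[i si ix]]].
- by rewrite in_cons => /orP[/eqP->|si]; [left|right; exists i].
- by exists j; rewrite // mem_head.
- by exists i; rewrite // in_cons si orbT.
Qed.

Variable I : Type.
Hypothesis sI : small K [set: I].

Lemma colouring_dfn (cs : seq (colour U)) (D : (U + I -> U) -> Prop) :
  dividing_colours S cs -> dfn S M D -> dfn S M (fun t : I + cvars cs -> U =>
    forall z : U -> U, D (copair z (t \o inl)) -> some_colour z (t \o inr)).
Proof.
move=> dcs hD.
apply: (@dfn_forall _ _ _ _ m0 _ U (fun t => D (copair (t \o inr) (t \o inl \o inl)) ->
  some_colour (t \o inr) (t \o inl \o inr))).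
apply: dfn_imp.
  apply: (@dfn_pull _ _ _ _ _ _ (fun z : U + I => match z with
    | inl x => inl (inr x) | inr i => inl (inl (inl i)) end) _ _ _ hD) => t [] //.
by apply: (@some_colour_dfn _ _ _ _ _ _ _ _ (fun x => inl (inr x)) _
  (fun z => inl (inl (inr z)))).
Qed.

(** The variables [z] are indexed by the monster model itself, so that the
identity is a tuple that enumerates every possible set of parameters. *)
Definition guarded (b : I -> U) (D : (U + I -> U) -> Prop) := dfn S M D /\
  exists2 chi, divides_list chi & forall z, D (copair z b) -> chi z.

Lemma guardedU b D D' : guarded b D -> guarded b D' -> guarded b (fun t => D t \/ D' t).
Proof.
move=> [hD [chi dchi Dchi]] [hD' [chi' dchi' Dchi']]; split; first exact: dfn_or.
exists (fun x => chi x \/ chi' x); first exact: divides_listU.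
by move=> z [/Dchi|/Dchi']; [left|right].
Qed.

Lemma guarded_false b : guarded b (fun=> False).
Proof.
split; first exact: dfn_false.
exists (fun=> False) => //.
by exists [::], (fun z : void => match z with end).
Qed.

Lemma guarded_same_type b b' D : same_type S M b' b -> guarded b' D -> guarded b D.
Proof.
move=> bb [hD [chi [cs [a [dcs ma ea]]] Dchi]]; split=> //.
have [a' aa] := same_type_extend a sI (small_fin hS _) bb.
exists (fun z => some_colour z a'); last first.
  pose E (t : I + cvars cs -> U) :=
    forall z, D (copair z (t \o inl)) -> some_colour z (t \o inr).
  by apply: (aa E); [exact: colouring_dfn|move=> z /Dchi/ea].
exists cs, a'; split=> //; apply: matches_same_type ma => E hE Ea.
exact: (aa (fun t => E (t \o inr)) (dfn_reindex inr hE) Ea).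
Qed.

(** Otherwise the identity would satisfy [D(z, e j)] for all the tuples [e j] that
the broom lemma provides when [psi] is false. *)
Lemma guarded_avoidable b theta D : dfn S M theta -> theta b -> guarded b D ->
  exists m : I -> M, theta (emb m) /\ ~ D (copair id (emb m)).
Proof.
move=> htheta tb [hD [chi [cs [a [dcs ma ea]]] Dchi]].
apply: contrapT => nm.
have Dm (m : I -> M) : theta (emb m) -> D (copair id (emb m)).
  by move=> tm; apply: contrapT => nD; apply: nm; exists m.
have [J hJ] := broom m0 hMS dcs; have [tau Ut tt] := type_ultra (copair b a).
pose E (t : I + cvars cs -> U) := theta (t \o inl) /\
  forall z, D (copair z (t \o inl)) -> some_colour z (t \o inr).
have hE : dfn S M E.
  by apply: dfn_and; [exact: dfn_reindex|exact: colouring_dfn].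
have [||||||e [eE eF]] := hJ I tau D (fun=> False) E Ut.
- apply: (matches_marginals dcs ma) => F hF Fa.
  exact: (tt (fun t => F (t \o inr)) (dfn_reindex inr hF) Fa).
- exact: hD.
- exact: dfn_false.
- exact: hE.
- by apply: tt => //; split=> // z /Dchi/ea.
- by move=> t [_ h] z /h; right.
by apply: (eF id) => j; have [a' [tj _]] := eE j; exact: Dm.
Qed.

Lemma coheir_ultra b : exists2 F : set (set (I -> M)), ultra F &
  (forall theta, dfn S M theta -> theta b -> F [set m | theta (emb m)]) /\
  (forall D, guarded b D -> F [set m | ~ D (copair id (emb m))]).
Proof.
pose B : set (set (I -> M)) := [set Z | exists theta D,
  [/\ dfn S M theta, theta b, guarded b D &
    Z = [set m | theta (emb m) /\ ~ D (copair id (emb m))]]].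
have [||_ [theta [D [ht tb gD ->]]]|F UF BF] := @ultra_extend _ B.
- exists [set m | True /\ ~ False], (fun=> True), (fun=> False); split=> //.
  + exact: dfn_true.
  + exact: guarded_false.
- move=> _ _ [t [D [ht tb gD ->]]] [t' [D' [ht' tb' gD' ->]]].
  exists [set m | (t (emb m) /\ t' (emb m)) /\
      ~ (D (copair id (emb m)) \/ D' (copair id (emb m)))].
    exists (fun m => t m /\ t' m), (fun m => D m \/ D' m); split=> //.
    + exact: dfn_and.
    + exact: guardedU.
  by move=> m [[tm t'm] /not_orP[nD nD']].
- have [m ?] := guarded_avoidable ht tb gD; by exists m.
exists F => //; split=> [theta ht tb|D gD].
  have : F [set m | theta (emb m) /\ ~ False].
    by apply: BF; exists theta, (fun=> False); split=> //; exact: guarded_false.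
  by apply: (ultraS UF) => m [].
have : F [set m | True /\ ~ D (copair id (emb m))].
  by apply: BF; exists (fun=> True), D; split=> //; exact: dfn_true.
by apply: (ultraS UF) => m [].
Qed.
End Guarded.

Section ExtendVariables.
Variables (U : Type) (M : set U) (m0 : M) (B : set U).

Definition extend_vars (v : B -> U) (u : U) : U :=
  match pselect (u \in B) with left Bu => v (exist _ u Bu) | right _ => val m0 end.

Lemma extend_vars_val (v : B -> U) : extend_vars v \o val = v.
Proof.
apply/funext => u; rewrite /extend_vars /=; case: pselect => [Bu|/(_ (valP u))//].
by congr v; apply: val_inj.
Qed.

Lemma extend_vars_params (v : B -> U) u : extend_vars v u = params v
  match pselect (u \in B) with left Bu => inl (exist _ u Bu) | right _ => inr m0 end.
Proof. by rewrite /extend_vars; case: pselect. Qed.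
End ExtendVariables.

Section Forking.
Variables (L : language) (K U : Type) (T : set (sentence L)) (S : structure L U).
Hypothesis hS : monster K T S.
Hypothesis hNATP : NATP S.
Variables (M : set U) (m0 : M).
Hypothesis hM : small K M.
Hypothesis hMS : elementary_submodel S M.

Lemma coheir_dividing_extend (B : set U) (chi : (B -> U) -> Prop) :
  coheir_dividing S M chi -> coheir_dividing S M (fun z : U -> U => chi (z \o val)).
Proof.
move=> [k [D [d [hD De [q [t [Uq dq nq]]]]]]].
pose D' (w : U + 'I_k -> U) := D (copair (w \o inl \o val) (w \o inr)).
exists k, D', d; split.
- by apply: (@dfn_pull _ _ _ _ _ _ (fun z : B + 'I_k => match z with
    | inl x => inl (inl (val x)) | inr i => inl (inr i) end) _ _ _ hD) => w [].
- by move=> z; rewrite De.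
exists q, t; split=> //; rewrite (_ : compatible D' = compatible D) //.
apply/funext => l; apply/propext; split=> -[v vl].
  by exists (v \o val) => y /vl.
exists (extend_vars m0 v) => y /vl; rewrite /D'.
by rewrite -[v in D (copair v _) -> _](extend_vars_val m0 v).
Qed.

Variable I : Type.
Hypothesis sI : small K [set: I].

(** By compactness finitely many formulas of [tp(B/Mb)] already imply the
disjunction of the Kim-dividing formulas; [D] is their conjunction with [b]
replaced by variables. *)
Lemma guarded_of_kim_forks (B : set U) (b : I -> U) : small K B ->
  kim_forks S M (tp S (fun c : B => val c) (M `|` range b)) ->
  exists D : (B + I -> U) -> Prop, [/\ dfn S M D, D (copair val b) &
    guarded S M b (fun t => D (copair (t \o inl \o val) (t \o inr)))].
Proof.
move=> sB [n [psi [kd forks]]].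
pose psi' (j : 'I_n.+1) (z : U -> U) := holds S (z \o val) (psi j).
have [j _|cs [a [dcs ma ea]]] :=
    @divides_list_seq _ _ S M U _ (enum 'I_n.+1) psi'.
  exact: (coheir_dividing_extend (kim_divides_coheir hS hNATP m0 hM hMS (kd j))).
have sMb : small K (M `|` range b).
  by apply: (small_union hS) => //; apply: small_le sI _; exact: card_image_le.
pose F : set ((B -> U) -> Prop) := [set D | dfn S (M `|` range b) D /\ D val].
pose nocol (v : B -> U) := ~ some_colour (extend_vars m0 v) a.
have [l [lF lN]] : exists l : seq {classic (B -> U) -> Prop}, (forall D, D \in l -> F D) /\
    forall v, (forall D, D \in l -> (D : (B -> U) -> Prop) v) -> some_colour (extend_vars m0 v) a.
  apply: contrapT => nl.
  pose A := (M `|` range b) `|` range a.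
  have [||D [[hD _]|->]|l lF|v hv] := @compactness _ _ _ _ _ hS B A (F `|` [set nocol]).
  - apply: (small_union hS) => //; apply: small_le (small_fin hS (cvars cs)) _.
    exact: card_image_le.
  - by apply: small_le sB _; move: (card_setT B); rewrite card_eq_le => /andP[].
  - by apply: dfn_mono hD => x Ax; left.
  - pose G (t : B + cvars cs -> U) := ~ some_colour (extend_vars m0 (t \o inl)) (t \o inr).
    have hG : dfn S M G.
      apply: dfn_not; apply: (@some_colour_dfn _ _ _ _ _ _ _ _
        (fun u => match pselect (u \in B) with
          | left Bu => inl (inl (exist _ u Bu)) | right _ => inr m0 end)
        _ (fun z => inl (inr z))) => // v z.
      by rewrite extend_vars_params; case: pselect.
    have := @dfn_params _ _ _ _ _ _ G a A _ _ hG; apply.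
      by move=> x Mx; left; left.
    by move=> x ax; right.
  - apply: contrapT => nv; apply: nl.
    exists [seq D <- l | `[< F D >]]; split=> [D|v vl].
      by rewrite mem_filter => /andP[/asboolP].
    apply: contrapT => nc; apply: nv; exists v => D Dl.
    have [FD|->//] := lF D Dl; apply: vl; rewrite mem_filter Dl andbT; exact/asboolP.
  have [|j hj] := forks v.
    move=> phi [ophi hphi]; apply: (hv (fun v => holds S v phi)); left; split=> //.
    exact: overP.
  apply: (hv nocol); [by right|apply/ea; exists j; rewrite ?mem_enum //].
  by rewrite /psi' extend_vars_val.
have hchi : dfn S (M `|` range b) (fun v : B -> U => forall D, D \in l -> (D : (B -> U) -> Prop) v).
  by apply: dfn_conj => D /lF[].
have [D hD chiD] := dfn_unparams hchi.
exists D; split=> //; first by apply/chiD => E /lF[].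
split.
  by apply: (@dfn_pull _ _ _ _ _ _ (fun z : B + I => match z with
    | inl x => inl (inl (val x)) | inr i => inl (inr i) end) _ _ _ hD) => w [].
exists (fun z => some_colour z a); first by exists cs, a.
move=> z /= Dz; have /lN/ea[j je hj] := (chiD (z \o val)).2 Dz.
by apply/ea; exists j => //; move: hj; rewrite /psi' extend_vars_val.
Qed.
End Forking.

Theorem corollary3p17
  (L : language) (T : set (sentence L)) (hT : complete_theory T)
  (K U : Type) (S : structure L U) (hS : monster K T S) (hNATP : NATP S)
  (M : set U) (hM : small K M) (hMS : elementary_submodel S M)
  (I : Type) (hI : small K [set: I]) (b : I -> U) :
  exists p : set (pform L U I),
    [/\ global_coheir S M p,
        tp S b M `<=` p
      & forall (B : set U) (b' : I -> U),
          small K B -> realizes S b' (restr p (M `|` B)) ->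
          ~ kim_forks S M (tp S (fun c : B => val c) (M `|` range b'))].
Proof.
have [m0] := submodel_inhabited hMS (monster_models hS).1.
have [F UF [Fb Fg]] := coheir_ultra m0 hMS b.
pose p : set (pform L U I) := [set phi | F [set m | holds S (emb m) phi]].
have over_p (A : set U) (E : (I -> U) -> Prop) b' : M `<=` A -> dfn S A E ->
    realizes S b' (restr p A) -> F [set m | E (emb m)] -> E b'.
  move=> MA hE bp FE; have [phi ophi phiE] := dfn_over hE.
  by apply/phiE; apply: bp; split=> //; apply: (ultraS UF) FE => m /phiE.
have fsM : fin_sat_in S M p.
  move=> G0 /(@finite_seqP {classic pform L U I})[l lE] G0p.
  have /(ultra_nonempty UF)[m hm] : F [set m | forall phi : {classic pform L U I},
      phi \in l -> holds S (emb m) (phi : pform L U I)].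
    by apply: ultra_all => // phi pl; apply: (G0p phi); rewrite lE.
  exists (emb m); split=> [_ [i _ <-]|phi]; first exact: (set_mem (valP (m i))).
  by rewrite lE => /hm.
exists p; split.
- split=> //; split=> [G0 fG0 G0p|phi].
    by have [v [_ vG]] := fsM G0 fG0 G0p; exists v; split.
  have [|nphi] := lem (p phi); [by left|right].
  by apply: (ultraS UF) ((ultra_setC UF _).2 nphi).
- by move=> phi [ophi hphi]; exact: (Fb _ (overP S ophi) hphi).
move=> B b' sB bp /(guarded_of_kim_forks hS hNATP m0 hM hMS hI sB)[D [hD Db gD]].
(* [D] is guarded at [b'], and [b] has the same type over [M] as [b'] *)
have bb : same_type S M b' b.
  move=> E hE Eb'; apply: contrapT => nE.
  have MA : M `<=` M `|` B by move=> x; left.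
  apply: (over_p (M `|` B) (fun w => ~ E w) b' MA _ bp _ Eb').
    exact: (dfn_mono MA (dfn_not hE)).
  exact: (Fb _ (dfn_not hE) nE).
have nD := Fg _ (guarded_same_type hS m0 hM hI bb gD).
apply: (over_p (M `|` B) (fun w => ~ D (copair val w)) b' _ _ bp nD Db).
  by move=> x; left.
have hD' : dfn S M (fun t : I + B -> U => ~ D (copair (t \o inr) (t \o inl))).
  apply: dfn_not; apply: (@dfn_pull _ _ _ _ _ _ (fun z : B + I => match z with
    | inl x => inl (inr x) | inr i => inl (inl i) end) _ _ _ hD) => w [] //.
apply: (dfn_params _ _ hD') => [x|_ [x _ <-]]; first by left.
by right; exact: (set_mem (valP x)).
Qed.
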